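(* Let $0<p\leq 1$. Let $(\mathcal{M},\tau)$ be a noncommutative probability space, $(\mathcal{M}_k)_{k\geq 1}$ an increasing sequence of von Neumann subalgebras of $\mathcal{M}$, and $\mathcal{E}_k$ the conditional expectation from $\mathcal{M}$ onto $\mathcal{M}_k$. Then for any $n\geq 1$ and any sequence $(x_k)_{k=1}^n$ of positive operators in $\mathcal{M}$, $$\Big\|\sum_{k=1}^n x_k\Big\|_{L_p(\mathcal{M})}\leq \frac{1}{p}\,\Big\|\sum_{k=1}^n \mathcal{E}_k(x_k)\Big\|_{L_p(\mathcal{M})}.$$ Moreover, the constant $1/p$ is best possible: for no $C<1/p$ does the inequality with $C$ in place of $1/p$ hold for all such $(\mathcal{M},\tau)$, $(\mathcal{M}_k)_{k\ge1}$, $n$ and $(x_k)_{k=1}^n$.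
   Context: A noncommutative probability space $(\mathcal{M},\tau)$ is a von Neumann algebra $\mathcal{M}$ equipped with a normal faithful trace $\tau$ satisfying $\tau(\mathbf{1})=1$. For $0<p<\infty$, $L_p(\mathcal{M})$ is the associated noncommutative $L_p$-space with (quasi-)norm $\|x\|_{L_p(\mathcal{M})}=\tau(|x|^p)^{1/p}$, where $|x|=(x^*x)^{1/2}$. The conditional expectation $\mathcal{E}_k:\mathcal{M}\to\mathcal{M}_k$ is the $\tau$-preserving one: $\tau(\mathcal{E}_k(x))=\tau(x)$, $\mathcal{E}_k(y)=y$, $\mathcal{E}_k(xy)=\mathcal{E}_k(x)y$ and $\mathcal{E}_k(yx)=y\mathcal{E}_k(x)$ for $x\in\mathcal{M}$, $y\in\mathcal{M}_k$. *)

(* Defs.v *)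
From HB Require Import structures.
From mathcomp Require Import all_boot all_order all_algebra.
From mathcomp Require Import complex.
From mathcomp Require Import all_classical all_reals all_analysis.

Set Implicit Arguments.
Unset Strict Implicit.
Unset Printing Implicit Defensive.

Import Order.TTheory GRing.Theory Num.Theory.
Import numFieldNormedType.Exports.

Local Open Scope classical_set_scope.
Local Open Scope complex_scope.
Local Open Scope ring_scope.

(* Inner products are linear in the first variable. *)
Record hilbertSpace (R : realType) := HilbertSpace {
  hs_sort :> completeNormedModType R[i];
  hs_dot : {dot hs_sort for Num.conj};
  hs_normE : forall h : hs_sort, `|h| ^+ 2 = hs_dot h h }.

Section Operators.
Variables (R : realType) (H : hilbertSpace R).
Implicit Types (a b x y : H -> H) (M N : set (H -> H)) (tau : (H -> H) -> R[i]).

Definition norm_bounds a : set R :=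
  [set c | 0 <= c /\ forall h : H, `|a h| <= c%:C * `|h|].

Definition bounded_op a : Prop := linear a /\ norm_bounds a !=set0.

Definition opnorm a : R := inf (norm_bounds a).

Definition is_adjoint a b : Prop :=
  forall h k : H, hs_dot H (a h) k = hs_dot H h (b k).

(* By Riesz, every bounded operator has exactly one bounded adjoint. *)
Definition adj a : H -> H :=
  xget 0 [set b | bounded_op b /\ is_adjoint a b].

(* [0 <= z] in [R[i]] says that [z] is real and nonnegative, so that positive
   operators are self-adjoint. *)
Definition positive_op a : Prop :=
  bounded_op a /\ forall h : H, 0 <= hs_dot H (a h) h.

Definition op_le a b : Prop := positive_op (b - a).

Definition commutant M : set (H -> H) :=
  [set a | bounded_op a /\ forall b, M b -> a \o b = b \o a].

(* The bicommutant identity makes M a weakly closed algebra of bounded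
   operators containing the identity of H; in particular, an inclusion of von
   Neumann algebras on H is automatically unital. *)
Definition von_neumann_algebra M : Prop :=
  (forall a, M a -> M (adj a)) /\ commutant (commutant M) = M.

Definition op_horner (q : {poly R}) a : H -> H :=
  fun h => \sum_(i < size q) (q`_i)%:C *: iter i a h.

(* Continuous functional calculus of a positive operator a, whose spectrum lies
   in [0, opnorm a]: f(a) is the norm limit of q_n(a) for any polynomials q_n
   converging to f uniformly on [0, opnorm a]. *)
Definition is_fun_calc (f : R -> R) a b : Prop :=
  bounded_op b /\
  forall e : R, 0 < e -> exists q : {poly R},
    (forall t : R, 0 <= t <= opnorm a -> `|q.[t] - f t| <= e) /\
    opnorm (op_horner q a - b) <= e.

Definition fun_calc (f : R -> R) a : H -> H :=
  xget 0 [set b | is_fun_calc f a b].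

(* Only meant for a positive and s > 0. *)
Definition op_pow a (s : R) : H -> H := fun_calc (fun t => t `^ s) a.

Definition op_abs x : H -> H := op_pow (adj x \o x) (2^-1).

(* S is a norm-bounded increasing net of positive elements of M, indexed by
   itself, with supremum a. *)
Definition directed_sup M (S : set (H -> H)) a : Prop :=
  [/\ S !=set0,
      forall s, S s -> M s /\ positive_op s,
      forall s t, S s -> S t -> exists u, [/\ S u, op_le s u & op_le t u],
      M a /\ (forall s, S s -> op_le s a) &
      forall b, M b -> (forall s, S s -> op_le s b) -> op_le a b].

(* Only the restriction of tau to M is relevant. *)
Record normal_faithful_tracial_state M tau : Prop := NormalFaithfulTracialState {
  trace_linear : forall (c : R[i]) x y, M x -> M y ->
    tau (c *: x + y) = c * tau x + tau y;
  trace_pos : forall x, M x -> positive_op x -> 0 <= tau x;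
  trace_unit : tau idfun = 1;
  trace_tracial : forall x y, M x -> M y -> tau (x \o y) = tau (y \o x);
  trace_faithful : forall x, M x -> tau (adj x \o x) = 0 -> x = 0;
  trace_normal : forall S a, directed_sup M S a ->
    complex.Re (tau a) = sup [set complex.Re (tau s) | s in S] }.

(* On M these properties determine E, since E x is then the element of N with
   tau (E x \o y) = tau (x \o y) for all y in N. *)
Record conditional_expectation M N tau (E : (H -> H) -> H -> H) : Prop :=
 ConditionalExpectation {
  condexp_range : forall x, M x -> N (E x);
  condexp_linear : forall (c : R[i]) x y, M x -> M y ->
    E (c *: x + y) = c *: E x + E y;
  condexp_pos : forall x, M x -> positive_op x -> positive_op (E x);
  condexp_trace : forall x, M x -> tau (E x) = tau x;
  condexp_id : forall y, N y -> E y = y;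
  condexp_modr : forall x y, M x -> N y -> E (x \o y) = E x \o y;
  condexp_modl : forall x y, M x -> N y -> E (y \o x) = y \o E x }.

(* The trace is real on positive elements of M; Re only changes the type. *)
Definition Lp_norm tau (p : R) x : R :=
  complex.Re (tau (op_pow (op_abs x) p)) `^ p^-1.

End Operators.

Definition dual_Doob_inequality (R : realType) (p C : R) : Prop :=
  forall (H : hilbertSpace R) (M : set (H -> H)) (tau : (H -> H) -> R[i])
    (N : nat -> set (H -> H)) (E : nat -> (H -> H) -> H -> H),
  von_neumann_algebra M ->
  normal_faithful_tracial_state M tau ->
  (forall k, (1 <= k)%N -> von_neumann_algebra (N k) /\ N k `<=` M) ->
  (forall k, (1 <= k)%N -> N k `<=` N k.+1) ->
  (forall k, (1 <= k)%N -> conditional_expectation M (N k) tau (E k)) ->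
  forall (n : nat) (x : nat -> H -> H), (1 <= n)%N ->
  (forall k, (1 <= k <= n)%N -> M (x k) /\ positive_op (x k)) ->
  Lp_norm tau p (\sum_(1 <= k < n.+1) x k) <=
    C * Lp_norm tau p (\sum_(1 <= k < n.+1) E k (x k)).

(* Main.v *)
(* Write S_k = E_1 x_1 + ... + E_k x_k, S = S_n and X = x_1 + ... + x_n.

   Upper bound.  For concave f, Klein's inequality reads
   tau(f(Y)) <= tau(f(A)) + tau(f'(A)(Y - A)).  Applied to f = t^p with
   (Y, A) = (S_(k-1), S_k) and telescoped, it gives
   p * sum_k tau(S_k^(p-1) E_k x_k) <= tau(S^p).  As S_k <= S and t^(p-1) is
   operator antitone, tau(S^(p-1) x_k) <= tau(S_k^(p-1) x_k), which is
   tau(S_k^(p-1) E_k x_k) because S_k lies in M_k; hence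
   p * tau(S^(p-1) X) <= tau(S^p).  Klein's inequality once more, now for
   (Y, A) = (pX, S), yields p^p tau(X^p) <= tau(S^p).  Negative powers are made
   sense of by replacing t with t + c, and c tends to 0 at the end.

   Klein's inequality and the antitonicity both follow, for functions of the
   form 1/(t + c), from the positivity of
   (B^-1 - A^-1) B (B^-1 - A^-1) = B^-1 - 2 A^-1 + A^-1 B A^-1,
   and powers are uniform limits of positive combinations of such functions:
   the sum over j in Z of u^(jp)/(t + u^j) is multiplied by exactly u^(p-1)
   when t is replaced by ut, so it is close to a multiple of t^(p-1) when u is
   close to 1.

   Sharpness.  On a finite commutative probability space whose tails have mass
   r^k with r = b^-p, let M_k forget everything about the tail {i >= k} and let
   x_k be b^k times the indicator of the atom k.  Then S <= p b X outside an
   atom whose contribution stays bounded while tau(X^p) tends to infinity, and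
   b tends to 1. *)
Require Import Defs.
From HB Require Import structures.
From mathcomp Require Import all_boot all_order all_algebra.
From mathcomp Require Import complex ring lra.
From mathcomp Require Import all_classical all_reals all_analysis.

Set Implicit Arguments.
Unset Strict Implicit.
Unset Printing Implicit Defensive.

Import Order.TTheory GRing.Theory Num.Theory.
Import numFieldNormedType.Exports.

Local Open Scope classical_set_scope.
Local Open Scope complex_scope.
Local Open Scope ring_scope.

(** * Inner products and norms *)

Section HilbertSpace.
Variables (R : realType) (H : hilbertSpace R).
Implicit Types (h k : H) (c : R).

(** The operator f(a) is available only through polynomials that approximate f on [0, [opnorm a]],
    with no spectral theorem behind it. What replaces the spectrum is one algebraic fact: a
    polynomial nonnegative on [0, c] lies in the cone obtained from 1, X and c - X by sums,
    nonnegative scalars and multiplication by squares, so its value at a positive a with norm c is a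
    positive operator. Norm bounds, convergence and positivity of f(a) all follow from it. No
    Weierstrass theorem is invoked either: 1/(t + c) is expanded in a geometric series and sums of
    such functions then reach the powers, so the sums that prove the trace inequalities also show
    that powers have a calculus. The delicate point is Klein's inequality for t^p: the function and
    its derivative must be approximated by one and the same positive combination, and the two limits
    must have constants in the ratio p. That ratio is not visible in the series; it is extracted
    from concavity. The exponent p = 1 lies outside these sums, and there the inequality is an
    equality of traces. *)

Definition rdot h k : R := complex.Re (hs_dot H h k).
Definition nrm h : R := complex.Re `|h|.

Lemma nrmE h : `|h| = (nrm h)%:C.
Proof. by rewrite /nrm RRe_real // ger0_real. Qed.

Lemma nrm_ge0 h : 0 <= nrm h.
Proof. by have := normr_ge0 h; rewrite nrmE ler0c. Qed.

Lemma nrm_le h c : (`|h| <= c%:C) = (nrm h <= c).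
Proof. by rewrite nrmE lecR. Qed.

Lemma nrmD h k : nrm (h + k) <= nrm h + nrm k.
Proof. by rewrite -nrm_le rmorphD /= -!nrmE ler_normD. Qed.

Lemma nrmN h : nrm (- h) = nrm h.
Proof. by rewrite /nrm normrN. Qed.

Lemma nrmZ (z : R[i]) h : nrm (z *: h) = complex.Re `|z| * nrm h.
Proof.
apply: complexI; rewrite rmorphM /= -!nrmE normrZ.
by congr (_ * _); rewrite RRe_real // ger0_real.
Qed.

Lemma nrmZr c h : nrm (c%:C *: h) = `|c| * nrm h.
Proof. by rewrite nrmZ normc_def /= expr0n /= addr0 sqrtr_sqr. Qed.

Lemma nrm0 : nrm 0 = 0.
Proof. by rewrite /nrm normr0. Qed.

Lemma nrm0_eq0 h : nrm h = 0 -> h = 0.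
Proof. by move=> h0; apply/eqP; rewrite -normr_eq0 nrmE h0. Qed.

Lemma dotDl h1 h2 k : hs_dot H (h1 + h2) k = hs_dot H h1 k + hs_dot H h2 k.
Proof. exact: linearDl. Qed.
Lemma dotDr k h1 h2 : hs_dot H k (h1 + h2) = hs_dot H k h1 + hs_dot H k h2.
Proof. exact: linearDr. Qed.
Lemma dotZl (z : R[i]) h k : hs_dot H (z *: h) k = z * hs_dot H h k.
Proof. exact: (linearZl_LR (hs_dot H)). Qed.
Lemma dotZr (z : R[i]) h k : hs_dot H h (z *: k) = z^* * hs_dot H h k.
Proof. exact: (linearZr_LR (hs_dot H)). Qed.
Lemma dotC h k : hs_dot H h k = (hs_dot H k h)^*.
Proof. by rewrite hermC expr0 mul1r. Qed.

Lemma rdotC h k : rdot h k = rdot k h.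
Proof. by rewrite /rdot dotC; case: (hs_dot H k h). Qed.

Lemma rdotDl h1 h2 k : rdot (h1 + h2) k = rdot h1 k + rdot h2 k.
Proof. by rewrite /rdot dotDl raddfD. Qed.
Lemma rdotDr k h1 h2 : rdot k (h1 + h2) = rdot k h1 + rdot k h2.
Proof. by rewrite rdotC rdotDl !(rdotC k). Qed.
Lemma rdotZl c h k : rdot (c%:C *: h) k = c * rdot h k.
Proof.
by rewrite /rdot dotZl; case: (hs_dot H h k) => a b /=; rewrite mul0r subr0.
Qed.
Lemma rdotZr c h k : rdot k (c%:C *: h) = c * rdot k h.
Proof. by rewrite rdotC rdotZl rdotC. Qed.
Lemma rdot0l k : rdot 0 k = 0.
Proof. by rewrite -(scale0r k) rdotZl mul0r. Qed.
Lemma rdot0r k : rdot k 0 = 0.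
Proof. by rewrite rdotC rdot0l. Qed.
Lemma rdotNl h k : rdot (- h) k = - rdot h k.
Proof.
have := rdotZl (-1) h k; rewrite mulN1r => <-.
by rewrite rmorphN rmorph1 scaleN1r.
Qed.
Lemma rdotNr h k : rdot k (- h) = - rdot k h.
Proof. by rewrite rdotC rdotNl rdotC. Qed.

Lemma dot_rdot h : hs_dot H h h = (rdot h h)%:C.
Proof. by rewrite /rdot RRe_real // ger0_real // -hs_normE exprn_ge0. Qed.

Lemma nrm_sqr h : nrm h ^+ 2 = rdot h h.
Proof. by apply: complexI; rewrite rmorphXn /= -nrmE hs_normE dot_rdot. Qed.

Lemma rdot_ge0 h : 0 <= rdot h h.
Proof. by rewrite -nrm_sqr exprn_ge0 // nrm_ge0. Qed.

Lemma rdot_eq0 h : rdot h h = 0 -> h = 0.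
Proof. by rewrite -nrm_sqr => /eqP; rewrite sqrf_eq0 => /eqP/nrm0_eq0. Qed.

Lemma nrm_le_sqr h c : 0 <= c -> (nrm h <= c) = (rdot h h <= c ^+ 2).
Proof. by move=> c0; rewrite -nrm_sqr ler_sqr // nnegrE ?nrm_ge0. Qed.

(** The constant [c] may have any sign, which frees every later use from checking it; hence the
    division by [|c| + 1] in the proof. *)
Lemma nrm_small_eq0 h c : (forall e, 0 < e -> nrm h <= e * c) -> h = 0.
Proof.
move=> he; apply: nrm0_eq0; apply/eqP; rewrite eq_le nrm_ge0 andbT.
apply/ler_addgt0Pr => e e0; rewrite add0r.
have c0 : 0 < `|c| + 1 by rewrite ltr_pwDr.
apply: le_trans (he (e / (`|c| + 1)) _) _; first by rewrite divr_gt0.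
rewrite -mulrA -[leRHS]mulr1 ler_pM2l // mulrC ler_pdivrMr // mul1r.
by rewrite (le_trans (ler_norm c)) // lerDl.
Qed.

Lemma rdot_le h k : rdot h k <= nrm h * nrm k.
Proof.
have [/nrm0_eq0->|hn0] := eqVneq (nrm h) 0; first by rewrite rdot0l nrm0 mul0r.
have [/nrm0_eq0->|kn0] := eqVneq (nrm k) 0; first by rewrite rdot0r nrm0 mulr0.
have h0 : 0 < nrm h by rewrite lt_def hn0 nrm_ge0.
have k0 : 0 < nrm k by rewrite lt_def kn0 nrm_ge0.
(* This square expands to 2 |h| |k| (|h| |k| - Re <h, k>). *)
have := rdot_ge0 ((nrm k)%:C *: h - (nrm h)%:C *: k).
rewrite !(rdotDl, rdotDr, rdotZl, rdotZr, rdotNl, rdotNr) (rdotC k h) -!nrm_sqr.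
by move=> h1; rewrite -(ler_pM2l (mulr_gt0 h0 k0)); nra.
Qed.

Lemma rdot_abs_le h k : `|rdot h k| <= nrm h * nrm k.
Proof. by rewrite ler_norml rdot_le lerNl -rdotNl -(nrmN h) rdot_le. Qed.

Definition rscale := (rdotDl, rdotDr, rdotZl, rdotZr, rdotNl, rdotNr).

End HilbertSpace.

(** * Bounded and positive operators *)

Section Operators.
Variables (R : realType) (H : hilbertSpace R).
Implicit Types (h k : H) (c e : R) (a b : H -> H) (z : R[i]) (p q : {poly R}).

Lemma linopD a h k : linear a -> a (h + k) = a h + a k.
Proof. by move=> la; have := la 1 h k; rewrite !scale1r. Qed.
Lemma linop0 a : linear a -> a 0 = 0.
Proof.
move=> la; have := linopD 0 0 la; rewrite addr0 => e.
by apply: (addrI (a 0)); rewrite -e addr0.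
Qed.
Lemma linopZ a z h : linear a -> a (z *: h) = z *: a h.
Proof. by move=> la; have := la z h 0; rewrite !addr0 linop0 // addr0. Qed.
Lemma linopN a h : linear a -> a (- h) = - a h.
Proof. by move=> la; rewrite -scaleN1r linopZ // scaleN1r. Qed.
Lemma linopB a h k : linear a -> a (h - k) = a h - a k.
Proof. by move=> la; rewrite linopD // linopN. Qed.
Lemma linear_addop a b : linear a -> linear b -> linear (a + b).
Proof.
by move=> la lb z h k /=; rewrite !fctE la lb scalerDr addrACA.
Qed.
Lemma linear_scaleop z a : linear a -> linear (z *: a).
Proof.
by move=> la c h k /=; rewrite !fctE la scalerDr !scalerA mulrC.
Qed.
Lemma linear_oppop a : linear a -> linear (- a).
Proof. by move=> la c h k /=; rewrite !fctE la opprD scalerN. Qed.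
Lemma linear_subop a b : linear a -> linear b -> linear (a - b).
Proof. by move=> la lb; apply: linear_addop => //; apply: linear_oppop. Qed.
Lemma linear_compop a b : linear a -> linear b -> linear (a \o b).
Proof. by move=> la lb c h k /=; rewrite lb la. Qed.
Lemma zero_op h : (0 : H -> H) h = 0.
Proof. by []. Qed.
Lemma linear_zeroop : linear (0 : H -> H).
Proof. by move=> c h k; rewrite !zero_op scaler0 addr0. Qed.

Definition opbound a c := forall h, nrm (a h) <= c * nrm h.

Lemma norm_boundsP a c : norm_bounds a c <-> 0 <= c /\ opbound a c.
Proof.
by split=> -[c0 ac]; split=> // h; have := ac h; rewrite !nrmE -rmorphM /= lecR.
Qed.

Lemma opnorm_ge0 a : 0 <= opnorm a.
Proof.
rewrite /opnorm; have [->|ne] := eqVneq (norm_bounds a) set0.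
  by rewrite inf0.
by apply: lb_le_inf; [exact/set0P | move=> c /norm_boundsP[]].
Qed.

Lemma opnorm_bound a : bounded_op a -> opbound a (opnorm a).
Proof.
case=> _ ne h; have [h0|hn0] := eqVneq (nrm h) 0.
  by case: ne => c /norm_boundsP[c0 /(_ h)]; rewrite h0 !mulr0.
rewrite -ler_pdivrMr ?lt_def ?hn0 ?nrm_ge0 //.
apply: lb_le_inf => // c /norm_boundsP[c0 ac].
by rewrite ler_pdivrMr ?lt_def ?hn0 ?nrm_ge0 //; exact: ac.
Qed.

Lemma opnorm_le a c : 0 <= c -> opbound a c -> opnorm a <= c.
Proof.
move=> c0 ac; apply: ge_inf; last exact/norm_boundsP.
by exists 0 => d /norm_boundsP[].
Qed.

Lemma opbound_bounded a c : 0 <= c -> linear a -> opbound a c -> bounded_op a.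
Proof. by move=> c0 la ac; split=> //; exists c; exact/norm_boundsP. Qed.

Lemma bounded_opbound a : bounded_op a -> exists2 c, 0 <= c & opbound a c.
Proof. by exists (opnorm a); [exact: opnorm_ge0|exact: opnorm_bound]. Qed.

Lemma opboundW a c d : c <= d -> opbound a c -> opbound a d.
Proof. by move=> cd ac h; apply: le_trans (ac h) _; rewrite ler_wpM2r ?nrm_ge0. Qed.

Lemma opboundD a b c d : opbound a c -> opbound b d -> opbound (a + b) (c + d).
Proof.
by move=> ac bd h; rewrite fctE (le_trans (nrmD _ _)) // mulrDl lerD.
Qed.
Lemma opboundN a c : opbound a c -> opbound (- a) c.
Proof. by move=> ac h; rewrite fctE nrmN. Qed.
Lemma opboundB a b c d : opbound a c -> opbound b d -> opbound (a - b) (c + d).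
Proof. by move=> ac bd; apply: opboundD => //; apply: opboundN. Qed.
Lemma opboundZ a z c : opbound a c -> opbound (z *: a) (complex.Re `|z| * c).
Proof.
move=> ac h; rewrite fctE nrmZ -mulrA ler_wpM2l //.
by rewrite -ler0c RRe_real // ger0_real.
Qed.
Lemma opboundM a b c d : 0 <= c -> opbound a c -> opbound b d ->
  opbound (a \o b) (c * d).
Proof.
by move=> c0 ac bd h /=; rewrite (le_trans (ac _)) // -mulrA ler_wpM2l.
Qed.

Lemma bounded_opD a b : bounded_op a -> bounded_op b -> bounded_op (a + b).
Proof.
move=> ba bb; have [c c0 ac] := bounded_opbound ba.
have [d d0 bd] := bounded_opbound bb.
apply: (@opbound_bounded _ (c + d)); first exact: addr_ge0.
  by apply: linear_addop; [case: ba|case: bb].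
exact: opboundD.
Qed.
Lemma bounded_opZ z a : bounded_op a -> bounded_op (z *: a).
Proof.
move=> ba; have [c c0 ac] := bounded_opbound ba.
apply: (@opbound_bounded _ (complex.Re `|z| * c)); last exact: opboundZ.
  by rewrite mulr_ge0 // -ler0c RRe_real // ger0_real.
by apply: linear_scaleop; case: ba.
Qed.
Lemma bounded_opN a : bounded_op a -> bounded_op (- a).
Proof.
by move=> ba; have := bounded_opZ (-1) ba; rewrite scaleN1r.
Qed.
Lemma bounded_opB a b : bounded_op a -> bounded_op b -> bounded_op (a - b).
Proof. by move=> ba bb; apply: bounded_opD => //; apply: bounded_opN. Qed.
Lemma bounded_opM a b : bounded_op a -> bounded_op b -> bounded_op (a \o b).
Proof.
move=> ba bb; have [c c0 ac] := bounded_opbound ba.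
have [d d0 bd] := bounded_opbound bb.
apply: (@opbound_bounded _ (c * d)); first exact: mulr_ge0.
  by apply: linear_compop; [case: ba|case: bb].
exact: opboundM.
Qed.
Lemma bounded_op1 : bounded_op (idfun : H -> H).
Proof. by apply: (@opbound_bounded _ 1) => // h; rewrite mul1r. Qed.
Lemma bounded_op0 : bounded_op (0 : H -> H).
Proof.
apply: (@opbound_bounded _ 0) => // [|h]; first exact: linear_zeroop.
by rewrite mul0r zero_op nrm0.
Qed.

(* The real part of the form already determines self-adjointness, because
   [Im <h, k> = Re <h, i k>]. *)
Definition symm a := forall h k, rdot (a h) k = rdot h (a k).

Lemma Im_dot h k : complex.Im (hs_dot H h k) = rdot h ('i *: k).
Proof.
rewrite /rdot dotZr; case: (hs_dot H h k) => u v /=.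
by rewrite mul0r sub0r mulN1r opprK.
Qed.

Lemma symm_adjoint a : linear a -> symm a -> is_adjoint a a.
Proof.
move=> la sa h k; apply/eqP; rewrite eq_complex; apply/andP; split; apply/eqP.
  exact: sa.
by rewrite !Im_dot sa linopZ.
Qed.

Lemma positive_opP a :
  positive_op a <-> [/\ bounded_op a, symm a & forall h, 0 <= rdot (a h) h].
Proof.
split=> [[ba pa]|[ba sa pa]]; last first.
  split=> // h; rewrite lecE; apply/andP; split; last exact: pa.
  apply/eqP; have la : linear a by case: ba.
  have := symm_adjoint la sa h h; rewrite [RHS]dotC.
  by case: (hs_dot H (a h) h) => u v /= [] v0; lra.
have la : linear a by case: ba.
have im0 h : complex.Im (hs_dot H (a h) h) = 0 by exact: ger0_Im.
split=> // [h k|h]; last by have := pa h; rewrite lecE => /andP[].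
(* Polarization: the imaginary part of the form at [h + 'i *: k] is Re <a k, h> - Re <a h, k> plus
   terms already known to vanish. *)
have := im0 (h + 'i *: k).
rewrite linopD // linopZ // !dotDl !dotDr !dotZl !dotZr !raddfD /=.
have := im0 k; have := im0 h; rewrite (rdotC h) /rdot.
move: (hs_dot H _ _) (hs_dot H _ _) (hs_dot H _ _) (hs_dot H _ _).
by move=> [? ?] [? ?] [? ?] [? ?] /= -> ->; lra.
Qed.

End Operators.

(** * Polynomials that are nonnegative on an interval *)

Section NonnegativePolynomials.
Variables (R : realType) (c : R) (c_gt0 : 0 < c).
Implicit Types (p q r s : {poly R}) (x y t k : R).

Lemma horner_ge0_closure r x :
  (forall e, 0 < e -> exists2 t, `|t - x| < e & 0 <= r.[t]) -> 0 <= r.[x].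
Proof.
move=> rx; rewrite leNgt; apply/negP => rx0.
have /cvgrPdist_lt := @continuous_horner R r x.
move=> /(_ (- r.[x])); rewrite oppr_gt0 => /(_ rx0) [e /= e0 he].
have [t tx rt] := rx e e0.
have := he t; rewrite /= distrC => /(_ tx).
by rewrite ltr_norml => /andP[]; lra.
Qed.

Definition nneg_on r := forall t, 0 <= t <= c -> 0 <= r.[t].

(** Dividing by a factor that vanishes at [x] leaves the sign of the quotient at [x] unknown.
    Continuity supplies it, from the right if [x < c] and from the left otherwise, so that the
    approach stays in the interval. *)
Lemma nneg_on_punctured r x : 0 <= x <= c ->
  (forall t, 0 <= t <= c -> t != x -> 0 <= r.[t]) -> nneg_on r.
Proof.
move=> xc hr t tc; have [->|] := eqVneq t x; last exact: hr.
apply: horner_ge0_closure => e e0.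
have [xc2|xc2] := ltP x c.
  exists (x + Num.min (e / 2) (c - x)).
    rewrite addrAC subrr add0r ger0_norm; last by rewrite le_min; apply/andP; split=> //; lra.
    by rewrite gt_min; apply/orP; left; lra.
  have m0 : 0 < Num.min (e / 2) (c - x) by rewrite lt_min; apply/andP; split=> //; lra.
  have m1 : Num.min (e / 2) (c - x) <= c - x by rewrite ge_min lexx orbT.
  by apply: hr; [lra|rewrite gt_eqF //; lra].
exists (x - Num.min (e / 2) c).
  rewrite addrAC subrr add0r normrN ger0_norm; last by rewrite le_min; apply/andP; split=> //; lra.
  by rewrite gt_min; apply/orP; left; lra.
have m0 : 0 < Num.min (e / 2) c by rewrite lt_min; apply/andP; split=> //; lra.
have m1 : Num.min (e / 2) c <= c by rewrite ge_min lexx orbT.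
by apply: hr; [lra|rewrite lt_eqF //; lra].
Qed.

Variable cone : {poly R} -> Prop.
Hypotheses (coneD : forall p q, cone p -> cone q -> cone (p + q))
  (coneZ : forall k p, 0 <= k -> cone p -> cone (k *: p))
  (coneM : forall s p, cone p -> cone (s ^+ 2 * p))
  (cone1 : cone 1) (coneX : cone 'X) (coneBX : cone (c%:P - 'X)).

(** The cone is not assumed closed under products, only under multiplication by squares; this
    identity yields the one product that is required. *)
Lemma cone_XB : cone ('X * (c%:P - 'X)).
Proof.
have -> : 'X * (c%:P - 'X) =
    c^-1 *: ((c%:P - 'X) ^+ 2 * 'X + 'X ^+ 2 * (c%:P - 'X)).
  have -> : (c%:P - 'X) ^+ 2 * 'X + 'X ^+ 2 * (c%:P - 'X) =
      c%:P * ('X * (c%:P - 'X)) :> {poly R} by ring.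
  by rewrite mul_polyC scalerA mulVf ?gt_eqF // scale1r.
by apply: coneZ; [rewrite invr_ge0 ltW|apply: coneD; apply: coneM].
Qed.

(* Stability under multiplication by the two boundary factors is what makes
   the induction on the number of roots go through. *)
Definition cone4 q :=
  [/\ cone q, cone ('X * q), cone ((c%:P - 'X) * q)
    & cone ('X * (c%:P - 'X) * q)].

Lemma cone4D p q : cone4 p -> cone4 q -> cone4 (p + q).
Proof. by case=> ? ? ? ? [? ? ? ?]; split; rewrite ?(mulrDr _ p); apply: coneD. Qed.
Lemma cone4Z k p : 0 <= k -> cone4 p -> cone4 (k *: p).
Proof. by move=> k0 [? ? ? ?]; split; rewrite -?scalerAr; apply: coneZ. Qed.
Lemma cone4M s p : cone4 p -> cone4 (s ^+ 2 * p).
Proof. by case=> ? ? ? ?; split; rewrite 1?(mulrCA _ (s ^+ 2)); apply: coneM. Qed.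
Lemma cone41 : cone4 1.
Proof. by split; rewrite ?mulr1 //; exact: cone_XB. Qed.
Lemma cone4X p : cone4 p -> cone4 ('X * p).
Proof.
case=> p1 p2 p3 p4; split=> //.
- by rewrite mulrA -expr2; apply: coneM.
- by rewrite mulrCA mulrA.
- have -> : 'X * (c%:P - 'X) * ('X * p) = 'X ^+ 2 * ((c%:P - 'X) * p) by ring.
  exact: coneM.
Qed.
Lemma cone4BX p : cone4 p -> cone4 ((c%:P - 'X) * p).
Proof.
case=> p1 p2 p3 p4; split=> //; first by rewrite mulrA.
- by rewrite mulrA -expr2; apply: coneM.
- have -> : 'X * (c%:P - 'X) * ((c%:P - 'X) * p) =
    (c%:P - 'X) ^+ 2 * ('X * p) by ring.
  exact: coneM.
Qed.

(** The remainder modulo the real quadratic with roots z and its conjugate is m1 X + m0 with real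
    coefficients. Vanishing at z, it has m1 Im z = 0, so it is zero. *)
Lemma nonreal_root_factor q (z : R[i]) : complex.Im z != 0 ->
  root (map_poly (real_complex R) q) z ->
  exists r, q = (('X - (complex.Re z)%:P) ^+ 2 + (complex.Im z ^+ 2)%:P) * r.
Proof.
case: z => x y /= y0 qz.
set d := ('X - x%:P) ^+ 2 + (y ^+ 2)%:P.
have dE : d = 'X^2 + ((- 2 * x)%:P * 'X + (x ^+ 2 + y ^+ 2)%:P).
  by rewrite /d polyCD !polyC_exp polyCM polyCN; ring.
have sd : size d = 3%N.
  rewrite dE size_polyDl size_polyXn // ltnS.
  by rewrite size_MXaddC; case: ifP => // _; rewrite ltnS size_polyC_leq1.
have dz : root (map_poly (real_complex R) d) (x +i* y).
  rewrite rootE /d rmorphD rmorphXn rmorphB /= map_polyX !map_polyC /= !hornerE.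
  by rewrite /= ; simpc; rewrite eq_complex /= ; apply/andP; split; apply/eqP; ring.
exists (q %/ d); rewrite mulrC {1}(divp_eq q d).
set m := q %% d.
suff -> : m = 0 by rewrite addr0.
have sm : (size m < 3)%N by rewrite -sd ltn_modp -size_poly_eq0 sd.
have mz : root (map_poly (real_complex R) m) (x +i* y).
  have : root (map_poly (real_complex R) (q %/ d * d + m)) (x +i* y).
    by rewrite -divp_eq.
  rewrite !rootE rmorphD rmorphM /= hornerD hornerM.
  by move: dz; rewrite rootE => /eqP ->; rewrite mulr0 add0r.
have mE : m = m`_1 *: 'X + (m`_0)%:P.
  apply/polyP => -[|[|i]]; rewrite !coefE /= ?mulr0 ?mulr1 ?add0r ?addr0 //.
  by rewrite nth_default //; apply: (@leq_trans 2).
move: mz; rewrite mE rootE rmorphD /= map_polyZ map_polyX map_polyC /= !hornerE.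
simpc => /eqP[e1 e2].
have m1 : m`_1 = 0 by apply/eqP; move/eqP: e2; rewrite mulf_eq0 (negPf y0) orbF.
by move: e1; rewrite m1 mul0r add0r => ->; rewrite scale0r add0r.
Qed.

(** Induction on the degree, by the position of one complex root. A nonreal root splits off a square
    plus a positive constant; a root at or left of 0 splits off X plus a nonnegative constant; a
    root at or right of c splits off c - X plus a nonnegative constant; a root inside the interval
    is double and splits off a square. *)
Lemma nneg_cone4 q : nneg_on q -> cone4 q.
Proof.
have [n] := ubnP (size q); elim: n q => // n IH q; rewrite ltnS => sq q0.
have [s1|s1] := leqP (size q) 1.
  have qE := size1_polyC s1; have k0 := q0 0.
  rewrite qE -alg_polyC; apply: cone4Z cone41.
  by move: k0; rewrite qE hornerC coefC /=; apply; rewrite lexx ltW.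
have [z qz] : exists z, root (map_poly (real_complex R) q) z.
  by apply/closed_rootP; rewrite size_map_poly gtn_eqF.
have [y0|y0] := eqVneq (complex.Im z) 0; last first.
  have [r qE] := nonreal_root_factor y0 qz.
  set x := complex.Re z in qE *; set y := complex.Im z in y0 qE *.
  have d0 t : 0 < (('X - x%:P) ^+ 2 + (y ^+ 2)%:P).[t].
    rewrite !hornerE ltr_wpDl ?sqr_ge0 // lt_def sqr_ge0 andbT.
    by rewrite expf_eq0 /=.
  have r4 : cone4 r.
    apply: IH.
      apply: leq_trans sq; rewrite qE.
      have r_n0 : r != 0.
        by apply: contraTneq s1 => r0; rewrite qE r0 mulr0 size_poly0.
      rewrite size_mul //; last first.
        by apply/eqP => d00; have := d0 0; rewrite d00 horner0 ltxx.
      have -> : size (('X - x%:P) ^+ 2 + (y ^+ 2)%:P) = 3%N.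
        rewrite size_polyDl size_exp_XsubC //.
        by rewrite (leq_ltn_trans (size_polyC_leq1 _)).
      by rewrite addSn /= addSn ltnS leq_addl.
    by move=> t tc; have := q0 t tc; rewrite qE hornerM pmulr_rge0.
  rewrite qE mulrDl mul_polyC; apply: cone4D; first exact: cone4M.
  by apply: cone4Z; rewrite ?sqr_ge0.
move: qz y0; case: z => x y /= qz y0; rewrite {}y0 {y} in qz.
have qx : root q x.
  by move: qz; rewrite -[x +i* 0]/(x%:C) fmorph_root.
have [r qE] := factor_theorem q x qx.
have r_n0 : r != 0.
  by apply: contraTneq s1 => r0; rewrite qE r0 mul0r size_poly0.
have sr : (size r < n)%N.
  by apply: leq_trans sq; rewrite qE size_Mmonic ?monicXsubC // size_XsubC addn2.
have qt t : q.[t] = r.[t] * (t - x) by rewrite qE !hornerE.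
have [x0|x0] := leP x 0.
  have r4 : cone4 r.
    apply: IH => //; apply: (@nneg_on_punctured _ 0); first by rewrite lexx ltW.
    move=> t tc tn0; have := q0 t tc; rewrite qt pmulr_lge0 //.
    have /andP[t0 _] := tc; have t1 : 0 < t by rewrite lt_def tn0.
    by lra.
  have -> : q = 'X * r + (- x) *: r by rewrite qE -mul_polyC polyCN; ring.
  by apply: cone4D; [exact: cone4X|apply: cone4Z => //; rewrite oppr_ge0].
have [xc|xc] := leP c x.
  have r4 : cone4 (- r).
    apply: IH; first by rewrite size_polyN.
    apply: (@nneg_on_punctured _ c); first by rewrite lexx ltW.
    move=> t tc tnc; have := q0 t tc.
    rewrite qt hornerN -mulrNN pmulr_lge0 // oppr_gt0 subr_lt0.
    by have /andP[_ t0] := tc; apply: lt_le_trans xc; rewrite lt_def eq_sym tnc.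
  have -> : q = (c%:P - 'X) * (- r) + (x - c) *: (- r).
    by rewrite qE -mul_polyC polyCB; ring.
  by apply: cone4D; [exact: cone4BX|apply: cone4Z => //; rewrite subr_ge0].
(* The factor t - x changes sign at the interior point x while q does not, so [r] is nonpositive on
   the left of x and nonnegative on the right. *)
have rx : root r x.
  rewrite rootE eq_le; apply/andP; split.
    rewrite -oppr_ge0 -hornerN; apply: horner_ge0_closure => e e0.
    have m0 : 0 < Num.min (e / 2) x by rewrite lt_min; apply/andP; split=> //; lra.
    have m1 : Num.min (e / 2) x <= x by rewrite ge_min lexx orbT.
    have m2 : Num.min (e / 2) x <= e / 2 by rewrite ge_min lexx.
    exists (x - Num.min (e / 2) x).
      by rewrite addrAC subrr add0r normrN ger0_norm; lra.
    have := q0 (x - Num.min (e / 2) x).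
    rewrite qt hornerN addrAC subrr add0r => h.
    by have := h ltac:(lra); rewrite mulrN -mulNr pmulr_lge0.
  apply: horner_ge0_closure => e e0.
  have m0 : 0 < Num.min (e / 2) (c - x) by rewrite lt_min; apply/andP; split=> //; lra.
  have m1 : Num.min (e / 2) (c - x) <= c - x by rewrite ge_min lexx orbT.
  have m2 : Num.min (e / 2) (c - x) <= e / 2 by rewrite ge_min lexx.
  exists (x + Num.min (e / 2) (c - x)).
    by rewrite addrAC subrr add0r ger0_norm; lra.
  have := q0 (x + Num.min (e / 2) (c - x)).
  rewrite qt addrAC subrr add0r => h.
  by have := h ltac:(lra); rewrite pmulr_lge0.
have [s rE] := factor_theorem r x rx.
have ss : (size s < n)%N.
  apply: leq_trans sr; rewrite rE size_Mmonic ?monicXsubC //; last first.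
    by apply: contraNneq r_n0 => s0; rewrite rE s0 mul0r.
  by rewrite size_XsubC addn2 ltnS leqnSn.
have -> : q = ('X - x%:P) ^+ 2 * s by rewrite qE rE; ring.
apply/cone4M/IH => //; apply: (@nneg_on_punctured _ x); first lra.
move=> t tc tx; have := q0 t tc; rewrite qt rE !hornerE.
rewrite -mulrA -expr2 pmulr_lge0 // lt_def sqr_ge0 andbT expf_eq0 /=.
by rewrite subr_eq0.
Qed.

End NonnegativePolynomials.

(** * Polynomials of a positive operator *)

Section OpHorner.
Variables (R : realType) (H : hilbertSpace R).
Implicit Types (h k : H) (c e : R) (a b : H -> H) (z : R[i]) (p q : {poly R}).

(** The range of the defining sum depends on the size of the polynomial, which sums and products
    change; a common longer range makes them comparable. *)
Lemma op_horner_wide n q a h : (size q <= n)%N ->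
  op_horner q a h = \sum_(i < n) (q`_i)%:C *: iter i a h.
Proof.
move=> sn; rewrite /op_horner (big_ord_widen n (fun i => (q`_i)%:C *: iter i a h)) //.
rewrite big_mkcond /=; apply: eq_bigr => i _; case: ltnP => // si.
by rewrite nth_default // scale0r.
Qed.

Lemma op_hornerD p q a : op_horner (p + q) a = op_horner p a + op_horner q a.
Proof.
apply/funext => h; rewrite fctE.
rewrite !(@op_horner_wide (maxn (size p) (size q))) ?leq_maxl ?leq_maxr ?size_polyD //.
by rewrite -big_split /=; apply: eq_bigr => i _; rewrite coefD rmorphD scalerDl.
Qed.

Lemma op_hornerZ c q a : op_horner (c *: q) a = c%:C *: op_horner q a.
Proof.
apply/funext => h; rewrite fctE.
rewrite (@op_horner_wide (size q)) ?size_scale_leq // /op_horner scaler_sumr.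
by apply: eq_bigr => i _; rewrite coefZ rmorphM scalerA.
Qed.

Lemma op_horner0 a : op_horner 0 a = 0.
Proof. by apply/funext => h; rewrite /op_horner size_poly0 big_ord0. Qed.

Lemma op_hornerC c a : op_horner c%:P a = c%:C *: idfun.
Proof.
apply/funext => h; rewrite fctE.
by rewrite (@op_horner_wide 1) ?size_polyC_leq1 // big_ord1 coefC.
Qed.

Lemma op_hornerN q a : op_horner (- q) a = - op_horner q a.
Proof. by rewrite -scaleN1r op_hornerZ rmorphN1 scaleN1r. Qed.
Lemma op_hornerB p q a : op_horner (p - q) a = op_horner p a - op_horner q a.
Proof. by rewrite op_hornerD op_hornerN. Qed.

Lemma op_hornerMX q a : op_horner (q * 'X) a = op_horner q a \o a.
Proof.
apply/funext => h /=.
rewrite (@op_horner_wide (size q).+1); last first.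
  by rewrite (leq_trans (size_polyMleq _ _)) // size_polyX addn2.
rewrite big_ord_recl /= coefMX /= scale0r add0r.
by apply: eq_bigr => i _; rewrite coefMX -iterSr.
Qed.

Lemma op_hornerX a : op_horner 'X a = a.
Proof.
by rewrite -[X in op_horner X]mul1r op_hornerMX op_hornerC rmorph1 scale1r.
Qed.

Lemma op_horner1 a : op_horner 1 a = idfun.
Proof. by rewrite op_hornerC rmorph1 scale1r. Qed.

Lemma linear_op_horner q a : linear a -> linear (op_horner q a).
Proof.
move=> la; elim/poly_ind: q => [|q c IH].
  by rewrite op_horner0; exact: linear_zeroop.
rewrite op_hornerD op_hornerMX op_hornerC; apply: linear_addop.
  exact: linear_compop.
exact: linear_scaleop.
Qed.

Lemma bounded_op_horner q a : bounded_op a -> bounded_op (op_horner q a).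
Proof.
move=> ba; elim/poly_ind: q => [|q c IH].
  by rewrite op_horner0; exact: bounded_op0.
rewrite op_hornerD op_hornerMX op_hornerC; apply: bounded_opD.
  exact: bounded_opM.
exact/bounded_opZ/bounded_op1.
Qed.

Lemma op_hornerM p q a : linear a ->
  op_horner (p * q) a = op_horner p a \o op_horner q a.
Proof.
move=> la; have lp := linear_op_horner p la; elim/poly_ind: q => [|q c IH].
  by rewrite mulr0 op_horner0; apply/funext => h /=; rewrite linop0.
rewrite mulrDr mulrA [p * c%:P]mulrC mul_polyC !op_hornerD !op_hornerMX IH.
rewrite op_hornerZ op_hornerC; apply/funext => h /=.
by rewrite !fctE /= (linopD _ _ lp) (linopZ _ _ lp).
Qed.

Lemma op_horner_comp p q a : linear a ->
  op_horner (p \Po q) a = op_horner p (op_horner q a).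
Proof.
move=> la; elim/poly_ind: p => [|p c IH].
  by rewrite comp_poly0 !op_horner0.
rewrite comp_poly_MXaddC !op_hornerD op_hornerMX op_hornerM // IH.
by rewrite !op_hornerC.
Qed.

Lemma op_horner_commute q a b : linear b -> a \o b = b \o a ->
  op_horner q a \o b = b \o op_horner q a.
Proof.
move=> lb ab; elim/poly_ind: q => [|q c IH].
  by rewrite op_horner0; apply/funext => h /=; rewrite linop0.
rewrite op_hornerD op_hornerMX op_hornerC; apply/funext => h.
have := congr1 (@^~ (a h)) IH; have := congr1 (@^~ h) ab => /= e1 e2.
by rewrite /= !fctE /= (linopD _ _ lb) (linopZ _ _ lb) e1 e2.
Qed.

Lemma symm_op_horner q a : linear a -> symm a -> symm (op_horner q a).
Proof.
move=> la sa; elim/poly_ind: q => [|q c IH] h k.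
  by rewrite op_horner0 !zero_op rdot0l rdot0r.
have := congr1 (@^~ k) (op_horner_commute q la (erefl (a \o a))).
rewrite /= => e; rewrite op_hornerD op_hornerMX op_hornerC !fctE /=.
by rewrite !rscale IH sa e.
Qed.

Lemma positive_op_le_opnorm a h : positive_op a ->
  rdot (a h) h <= opnorm a * rdot h h.
Proof.
case/positive_opP=> ba sa pa; have := opnorm_bound ba h.
have c0 := opnorm_ge0 a; move: (opnorm a) c0 => c c0.
rewrite le_eqVlt in c0; case/orP: c0 => [/eqP <-|c0].
  rewrite mul0r mul0r => a0; have -> : a h = 0; last by rewrite rdot0l.
  by apply: nrm0_eq0; apply/eqP; rewrite eq_le a0 nrm_ge0.
move=> ac; have ac2 : rdot (a h) (a h) <= c ^+ 2 * rdot h h.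
  rewrite -!nrm_sqr -exprMn ler_sqr ?nnegrE ?nrm_ge0 //.
  by rewrite mulr_ge0 ?nrm_ge0 // ltW.
have := rdot_ge0 (c%:C *: h - a h).
rewrite !rscale (rdotC h (a h)) => h0.
rewrite -(ler_pM2l c0) mulrA -expr2.
by nra.
Qed.

(** The substitute for the spectral theorem: the polynomials whose value at [a] has a nonnegative
    form satisfy all the cone axioms. *)
Lemma op_horner_ge0 q a : positive_op a -> nneg_on (opnorm a) q ->
  positive_op (op_horner q a).
Proof.
move=> pa q0; have [ba sa ra] := (positive_opP a).1 pa; have [la _] := ba.
apply/positive_opP; split; first exact: bounded_op_horner.
  exact: symm_op_horner.
(* Norm zero is separate because the cone argument needs c > 0; then [a] is zero and only the
   constant term of [q] survives. *)
have := opnorm_ge0 a; rewrite le_eqVlt => /orP[/eqP c0|c0].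
  have a0 h : a h = 0.
    apply: nrm0_eq0; apply/eqP; rewrite eq_le nrm_ge0 andbT.
    by have := opnorm_bound ba h; rewrite -c0 mul0r.
  have qE h : op_horner q a h = q.[0]%:C *: h.
    rewrite horner_coef0; elim/poly_ind: q {q0} => [|q d IH].
      by rewrite op_horner0 coef0 scale0r.
    rewrite op_hornerD op_hornerMX op_hornerC fctE /= a0 linop0; last exact: linear_op_horner.
    by rewrite add0r coefD coefMX coefC /= add0r.
  by move=> h; rewrite qE rdotZl mulr_ge0 ?rdot_ge0 //; apply: q0; rewrite lexx opnorm_ge0.
pose cone (q : {poly R}) := forall h, 0 <= rdot (op_horner q a h) h.
suff : cone4 (opnorm a) cone q by case.
apply: nneg_cone4 => //.
- by move=> p r p0 r0 h; rewrite op_hornerD fctE rdotDl addr_ge0.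
- by move=> k p k0 p0 h; rewrite op_hornerZ fctE rdotZl mulr_ge0.
(* One factor s(a) moves to the other side of the inner product, since it is self-adjoint. *)
- move=> s p p0 h.
  have -> : s ^+ 2 * p = s * (p * s) by ring.
  by rewrite !op_hornerM //= symm_op_horner //; exact: p0.
- by move=> h; rewrite op_horner1 rdot_ge0.
- by move=> h; rewrite op_hornerX.
- move=> h; rewrite op_hornerB op_hornerX op_hornerC !fctE rdotDl rdotNl rdotZl subr_ge0.
  exact: positive_op_le_opnorm.
Qed.

(** The square of the norm of q(a) h is <q(a)^2 h, h>, so the bound is positivity of e^2 - q^2 at
    [a]. *)
Lemma op_horner_bound q a e : positive_op a -> 0 <= e ->
  (forall t, 0 <= t <= opnorm a -> `|q.[t]| <= e) -> opbound (op_horner q a) e.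
Proof.
move=> pa e0 qe h; have [[la _] sa _] := (positive_opP a).1 pa.
rewrite nrm_le_sqr ?mulr_ge0 ?nrm_ge0 // exprMn nrm_sqr.
have : positive_op (op_horner ((e ^+ 2)%:P - q * q) a).
  apply: op_horner_ge0 => // t tc; rewrite !hornerE.
  have := qe t tc; rewrite -ler_sqr ?nnegrE // real_normK ?num_real //.
  by rewrite -expr2 subr_ge0.
case/positive_opP => _ _ /(_ h).
rewrite op_hornerB op_hornerC op_hornerM // !fctE /= rdotDl rdotNl rdotZl.
by rewrite subr_ge0 symm_op_horner.
Qed.

End OpHorner.

(** * Functional calculus *)

Section FunctionalCalculus.
Variables (R : realType) (H : hilbertSpace R).
Implicit Types (h k : H) (c e t : R) (a b : H -> H) (z : R[i]) (p q : {poly R}).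
Implicit Types (f g : R -> R).

Lemma cvg_of_rate (u : nat -> H) c :
  (forall n m, (n <= m)%N -> nrm (u n - u m) <= n.+1%:R^-1 * c) ->
  exists l, forall n, nrm (u n - l) <= n.+1%:R^-1 * c.
Proof.
move=> hu; have c0 : 0 <= c.
  have := hu 0%N 0%N (leqnn 0); rewrite subrr nrm0 invr1 mul1r; exact.
have rate e : 0 < e -> exists N : nat, N.+1%:R^-1 * c < e.
  move=> e0; exists (Num.truncn (c / e)); rewrite mulrC ltr_pdivrMr //.
  by rewrite -ltr_pdivrMl // mulrC truncnS_gt // .
have uc : cvg (u n @[n --> \oo]).
  apply: cauchy_cvg; apply: cauchy_exP => e e0.
  have eE : e = (complex.Re e)%:C by rewrite RRe_real // gtr0_real.
  have {}e0 : 0 < complex.Re e by move: e0; rewrite {1}eE ltcR.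
  have [N hN] := rate _ e0; exists (u N).
  rewrite /nbhs /=; near=> n.
  rewrite -ball_normE /= eE nrmE ltcR (le_lt_trans _ hN) // hu //.
  by near: n; exists N.
exists (lim (u n @[n --> \oo])) => n; set l := lim _.
apply/ler_addgt0Pr => e e0.
have /cvgrPdist_lt /(_ e%:C) : u n @[n --> \oo] --> l by [].
rewrite ltcR => /(_ e0) [N _ hN].
have := hN (maxn n N) (leq_maxr _ _).
rewrite nrmE ltcR -nrmN opprB => h1.
rewrite -(subrK (u (maxn n N)) (u n)) -addrA (le_trans (nrmD _ _)) //.
by rewrite lerD ?(ltW h1) // hu // leq_maxl.
Unshelve. all: by end_near. Qed.

(** The rate is uniform in the vector up to its norm, so the pointwise limit has a linearity defect
    of at most C / (n + 1) for every n. *)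
Lemma op_limit (u : nat -> H -> H) :
  (forall n, bounded_op (u n)) ->
  (forall n m, (n <= m)%N -> opbound (u n - u m) n.+1%:R^-1) ->
  exists2 b, bounded_op b & forall n, opbound (u n - b) n.+1%:R^-1.
Proof.
move=> bu hu.
have /choice[b hb] : forall h, exists l, forall n,
    nrm (u n h - l) <= n.+1%:R^-1 * nrm h.
  by move=> h; apply: cvg_of_rate => n m nm; exact: hu.
have lb : linear b.
  move=> z h k; apply/eqP; rewrite -subr_eq0; apply/eqP.
  pose C := nrm (z *: h + k) + complex.Re `|z| * nrm h + nrm k.
  apply: (@nrm_small_eq0 _ _ _ C) => e e0.
  pose n := Num.truncn e^-1.
  have ne : n.+1%:R^-1 <= e.
    by rewrite invf_ple ?posrE // ltW // truncnS_gt.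
  have z0 : 0 <= complex.Re `|z| by rewrite -ler0c RRe_real // ger0_real.
  have C0 : 0 <= C by rewrite !addr_ge0 ?mulr_ge0 ?nrm_ge0.
  apply: le_trans (ler_wpM2r C0 ne).
  have ln : linear (u n) by case: (bu n).
  have -> : b (z *: h + k) - (z *: b h + b k) =
     - (u n (z *: h + k) - b (z *: h + k)) + (z *: (u n h - b h) + (u n k - b k)).
    rewrite ln scalerBr opprB -addrA; congr (_ + _).
    by rewrite addrACA -[- _ - _]opprD addKr.
  apply: (le_trans (nrmD _ _)); rewrite nrmN /C -addrA mulrDr lerD //.
  apply: (le_trans (nrmD _ _)); rewrite mulrDr lerD //.
  by rewrite nrmZ mulrCA ler_wpM2l.
have ub n : opbound (u n - b) n.+1%:R^-1 by move=> h; exact: hb.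
exists b => //.
have -> : b = u 0%N - (u 0%N - b) by rewrite opprB addrC subrK.
apply: bounded_opB; first exact: bu.
apply: (@opbound_bounded _ _ _ 1%:R^-1); [by rewrite invr_ge0| |exact: ub].
by apply: linear_subop => //; case: (bu 0%N).
Qed.

(** Approximation is required on every [0, L], not on one spectrum, so that the same f can be
    applied to operators of different norms. This class plays the role of the continuous
    functions. *)
Definition papprox f := forall L e, 0 < e ->
  exists q, forall t, 0 <= t <= L -> `|q.[t] - f t| <= e.

Lemma op_eq_small a b c : (forall e, 0 < e -> opbound (a - b) (e * c)) -> a = b.
Proof.
move=> ab; apply/funext => h; apply/eqP; rewrite -subr_eq0; apply/eqP.
apply: (@nrm_small_eq0 _ _ _ (c * nrm h)) => e e0.
by rewrite mulrA; exact: ab.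
Qed.

Lemma is_fun_calcP f a b : is_fun_calc f a b ->
  bounded_op a -> forall e, 0 < e -> exists2 q : {poly R},
    (forall t, 0 <= t <= opnorm a -> `|q.[t] - f t| <= e) &
    opbound (op_horner q a - b) e.
Proof.
move=> [bb hb] ba e e0; have [q [qf qb]] := hb e e0; exists q => //.
apply: (opboundW qb); apply: opnorm_bound; apply: bounded_opB => //.
exact: bounded_op_horner.
Qed.

Lemma fun_calc_exists f a : positive_op a -> papprox f ->
  is_fun_calc f a (fun_calc f a).
Proof.
move=> pa pf; have [ba _ _] := (positive_opP a).1 pa.
rewrite /fun_calc; apply: xgetPex.
(* Half of 1 / (n + 1), so that two approximants of index at least n differ by at most 1 / (n +
   1). *)
have n0 (n : nat) : 0 < n.+1%:R^-1 / 2 :> R by rewrite divr_gt0 ?invr_gt0.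
have /choice[q hq] n := pf (opnorm a) (n.+1%:R^-1 / 2) (n0 n).
have [b bb hb] : exists2 b, bounded_op b &
    forall n, opbound (op_horner (q n) a - b) n.+1%:R^-1.
  apply: op_limit => [n|n m nm]; first exact: bounded_op_horner.
  rewrite -op_hornerB; apply: op_horner_bound => // t tc.
  have -> : (q n - q m).[t] = ((q n).[t] - f t) - ((q m).[t] - f t).
    by rewrite !hornerE; ring.
  rewrite (le_trans (ler_normB _ _)) // [leRHS]splitr lerD ?hq //.
  rewrite (le_trans (hq m t tc)) // ler_pM2r ?invr_gt0 // lef_pV2 ?posrE //.
  by rewrite ler_nat.
exists b; split=> // e e0; pose n := Num.truncn e^-1.
have ne : n.+1%:R^-1 <= e by rewrite invf_ple ?posrE // ltW // truncnS_gt.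
exists (q n); split.
  move=> t tc; apply: le_trans (hq n t tc) _; apply: le_trans ne.
  by rewrite ler_pdivrMr // ler_peMr ?invr_ge0 // ler1n.
apply: le_trans ne; apply: opnorm_le; first by rewrite invr_ge0.
exact: hb.
Qed.

End FunctionalCalculus.

(** * Functions approximable by polynomials on every interval [0, L] *)

Section PolynomialApproximation.
Variable R : realType.
Implicit Types (c e t L : R) (p q r : {poly R}) (f g : R -> R).

Lemma horner_bounded q L : exists2 K, 0 < K & forall t, 0 <= t <= L -> `|q.[t]| <= K.
Proof.
elim/poly_ind: q => [|q c [K K0 hK]]; first by exists 1 => // t _; rewrite horner0 normr0.
exists (K * (`|L| + 1) + `|c|) => [|t tL].
  by rewrite ltr_pwDl // mulr_gt0 // ltr_pwDr.
rewrite !hornerE (le_trans (ler_normD _ _)) // lerD2r normrM ler_pM ?hK //.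
case/andP: tL => t0 tL; rewrite ger0_norm // (le_trans tL) //.
by rewrite (le_trans (ler_norm L)) // lerDl.
Qed.

Lemma papprox_bounded f L : papprox f ->
  exists2 K, 0 < K & forall t, 0 <= t <= L -> `|f t| <= K.
Proof.
move=> pf; have [q hq] := pf L 1 ltr01; have [K K0 hK] := horner_bounded q L.
exists (K + 1) => [|t tL]; first by rewrite addr_gt0.
have -> : f t = q.[t] - (q.[t] - f t) by ring.
by rewrite (le_trans (ler_normB _ _)) // lerD ?hK ?hq.
Qed.

Lemma papprox_ext f g : (forall t, 0 <= t -> f t = g t) -> papprox f -> papprox g.
Proof.
move=> fg pf L e e0; have [q hq] := pf L e e0.
by exists q => t tL; rewrite -fg ?hq //; case/andP: tL.
Qed.

Lemma papprox_horner q : papprox (horner q).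
Proof. by move=> L e e0; exists q => t _; rewrite subrr normr0 ltW. Qed.

Lemma papprox_cst c : papprox (fun=> c).
Proof.
by apply: papprox_ext (papprox_horner c%:P) => t _; rewrite hornerC.
Qed.

Lemma papproxD f g : papprox f -> papprox g -> papprox (fun t => f t + g t).
Proof.
move=> pf pg L e e0; have e20 : 0 < e / 2 by rewrite divr_gt0.
have [q hq] := pf L _ e20; have [r hr] := pg L _ e20; exists (q + r) => t tL.
rewrite hornerD opprD addrACA (le_trans (ler_normD _ _)) // [leRHS]splitr.
by rewrite lerD ?hq ?hr.
Qed.

Lemma papproxM f g : papprox f -> papprox g -> papprox (fun t => f t * g t).
Proof.
move=> pf pg L e e0; have [K K0 hK] := papprox_bounded L pf.
have e10 : 0 < e / 2 / K by rewrite !divr_gt0.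
have [r hr] := pg L _ e10; have [K' K'0 hK'] := horner_bounded r L.
have e20 : 0 < e / 2 / K' by rewrite !divr_gt0.
have [q hq] := pf L _ e20; exists (q * r) => t tL.
have -> : (q * r).[t] - f t * g t = (q.[t] - f t) * r.[t] + f t * (r.[t] - g t).
  by rewrite hornerM; ring.
rewrite (le_trans (ler_normD _ _)) // [leRHS]splitr !normrM lerD //.
  apply: le_trans (ler_pM _ _ (hq t tL) (hK' t tL)) _ => //.
  by rewrite divfK ?gt_eqF.
apply: le_trans (ler_pM _ _ (hK t tL) (hr t tL)) _ => //.
by rewrite mulrCA mulfV ?mulr1 ?gt_eqF.
Qed.

Lemma papproxZ c f : papprox f -> papprox (fun t => c * f t).
Proof. exact/papproxM/papprox_cst. Qed.

Lemma papproxB f g : papprox f -> papprox g -> papprox (fun t => f t - g t).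
Proof.
move=> pf pg; apply: papprox_ext (papproxD pf (papproxZ (-1) pg)) => t _.
by rewrite mulN1r.
Qed.

Lemma papprox_limit f :
  (forall L e, 0 < e -> exists2 g, papprox g &
     forall t, 0 <= t <= L -> `|g t - f t| <= e) -> papprox f.
Proof.
move=> hf L e e0; have e20 : 0 < e / 2 by rewrite divr_gt0.
have [g pg gf] := hf L _ e20; have [q hq] := pg L _ e20; exists q => t tL.
have -> : q.[t] - f t = (q.[t] - g t) + (g t - f t) by ring.
by rewrite (le_trans (ler_normD _ _)) // [leRHS]splitr lerD ?hq ?gf.
Qed.

Lemma papprox_comp f r : papprox f -> (forall t, 0 <= t -> 0 <= r.[t]) ->
  papprox (fun t => f r.[t]).
Proof.
move=> pf r0 L e e0; have [K K0 hK] := horner_bounded r L.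
have [q hq] := pf K e e0; exists (q \Po r) => t tL; rewrite horner_comp hq //.
by rewrite r0 ?(le_trans (ler_norm _) (hK t tL)) //; case/andP: tL.
Qed.

(** With w = (L - t) / (L + c), the function is (L + c)^-1 / (1 - w), and w stays in [0, rho] with
    rho < 1 for t in [0, L]; the approximants are the partial geometric sums. *)
Lemma papprox_inv c : 0 < c -> papprox (fun t => (t + c)^-1).
Proof.
move=> c0 L' e e0; pose L := `|L'|.
have L0 : 0 <= L by exact: normr_ge0.
have Lc0 : 0 < L + c by rewrite ltr_wpDl.
pose rho := L / (L + c).
have rho0 : 0 <= rho by rewrite divr_ge0 // ltW.
have rho1 : rho < 1 by rewrite ltr_pdivrMr // mul1r ltrDl.
have : (rho ^+ n @[n --> \oo] --> 0)%classic by apply: cvg_expr; rewrite ger0_norm.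
move=> /cvgrPdist_lt /(_ (e * c) (mulr_gt0 e0 c0)) [n _ /(_ n (leqnn n))].
rewrite /= sub0r normrN ger0_norm ?exprn_ge0 // => rn.
pose w : {poly R} := (L + c)^-1 *: (L%:P - 'X).
exists ((L + c)^-1 *: \sum_(i < n) w ^+ i) => t /andP[t0 tL'].
have tL : t <= L by rewrite (le_trans tL') // ler_norm.
have tc0 : 0 < t + c by rewrite ltr_wpDl.
have wE : w.[t] = (L - t) / (L + c) by rewrite /w !hornerE mulrC.
have w0 : 0 <= w.[t] by rewrite wE divr_ge0 ?subr_ge0 // ltW.
have wr : w.[t] <= rho by rewrite wE ler_pM2r ?invr_gt0 // gerBl.
have w1 : 1 - w.[t] = (t + c) / (L + c).
  by rewrite wE; field; rewrite gt_eqF.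
have -> : ((L + c)^-1 *: \sum_(i < n) w ^+ i).[t] - (t + c)^-1 =
    - (w.[t] ^+ n / (t + c)).
  have := subrXX 1 w.[t] n; rewrite expr1n w1.
  have -> : \sum_(i < n) 1 ^+ (n.-1 - i) * w.[t] ^+ i = (\sum_(i < n) w ^+ i).[t].
    by rewrite horner_sum; apply: eq_bigr => i _; rewrite expr1n mul1r horner_exp.
  move: (\sum_(i < n) w ^+ i) => S wS; rewrite (hornerZ _ S).
  have -> : w.[t] ^+ n = 1 - (t + c) / (L + c) * S.[t] by rewrite -wS subKr.
  by field; rewrite !gt_eqF.
rewrite normrN ger0_norm ?divr_ge0 ?exprn_ge0 ?(ltW tc0) //.
rewrite ler_pdivrMr //; apply: (@le_trans _ _ (rho ^+ n)).
  by rewrite lerXn2r // nnegrE.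
by rewrite (le_trans (ltW rn)) // ler_pM2l // lerDr.
Qed.

End PolynomialApproximation.

(** * Algebraic rules of the functional calculus *)

Section FunctionalCalculusTheory.
Variables (R : realType) (H : hilbertSpace R).
Implicit Types (h k : H) (c e t : R) (a b : H -> H) (z : R[i]) (p q r : {poly R}).
Implicit Types (f g : R -> R).

Lemma fun_calc_bounded f a : positive_op a -> papprox f -> bounded_op (fun_calc f a).
Proof. by move=> pa /(fun_calc_exists pa)[]. Qed.

Lemma fun_calc_approx f a e : positive_op a -> papprox f -> 0 < e ->
  exists2 q : {poly R}, (forall t, 0 <= t <= opnorm a -> `|q.[t] - f t| <= e) &
    opbound (op_horner q a - fun_calc f a) e.
Proof.
move=> pa pf; apply: is_fun_calcP; first exact: fun_calc_exists.
by case/positive_opP: pa.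
Qed.

(** The definition only promises some polynomial close to f and to f(a). An arbitrary [q] is within
    2 e of that one on the interval, hence the factor 3. *)
Lemma fun_calc_near f a q e : positive_op a -> papprox f -> 0 < e ->
  (forall t, 0 <= t <= opnorm a -> `|q.[t] - f t| <= e) ->
  opbound (op_horner q a - fun_calc f a) (3 * e).
Proof.
move=> pa pf e0 qf; have [r rf rb] := fun_calc_approx pa pf e0.
rewrite -(subrKA (op_horner r a)).
have -> : 3 * e = 2 * e + e by ring.
apply: opboundD => //; rewrite -op_hornerB; apply: op_horner_bound => // [|t tc].
  by rewrite mulr_ge0 // ltW.
have -> : (q - r).[t] = (q.[t] - f t) - (r.[t] - f t) by rewrite !hornerE; ring.
by rewrite (le_trans (ler_normB _ _)) // mulr_natl mulr2n lerD ?qf ?rf.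
Qed.

Lemma fun_calc_eq f a b C : positive_op a -> papprox f ->
  (forall e, 0 < e -> exists2 q : {poly R},
    (forall t, 0 <= t <= opnorm a -> `|q.[t] - f t| <= e) &
    opbound (op_horner q a - b) (e * C)) -> fun_calc f a = b.
Proof.
move=> pa pf hb; apply: (@op_eq_small _ _ _ _ (3 + C)) => e e0.
have [q qf qb] := hb e e0; have := fun_calc_near pa pf e0 qf.
move=> /opboundN; rewrite opprB => h.
rewrite -(subrKA (op_horner q a)) mulrDr [e * 3]mulrC.
exact: opboundD.
Qed.

Lemma fun_calc_ext f g a : positive_op a -> papprox f -> papprox g ->
  (forall t, 0 <= t <= opnorm a -> f t = g t) -> fun_calc f a = fun_calc g a.
Proof.
move=> pa pf pg fg; apply: (@fun_calc_eq _ _ _ 1) => // e e0.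
have [q qg qb] := fun_calc_approx pa pg e0.
by exists q; rewrite ?mulr1 // => t tc; rewrite fg ?qg.
Qed.

Lemma fun_calc_horner q a : positive_op a -> fun_calc (horner q) a = op_horner q a.
Proof.
move=> pa; apply: (@fun_calc_eq _ _ _ 0) => // [|e e0]; first exact: papprox_horner.
exists q => [t _|]; first by rewrite subrr normr0 ltW.
by move=> h; rewrite subrr zero_op nrm0 mulr0 mul0r.
Qed.

Lemma fun_calcD f g a : positive_op a -> papprox f -> papprox g ->
  fun_calc (fun t => f t + g t) a = fun_calc f a + fun_calc g a.
Proof.
move=> pa pf pg; apply: (@fun_calc_eq _ _ _ 1) => // [|e e0]; first exact: papproxD.
have e20 : 0 < e / 2 by rewrite divr_gt0.
have [q qf qb] := fun_calc_approx pa pf e20.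
have [r rg rb] := fun_calc_approx pa pg e20.
exists (q + r) => [t tc|].
  rewrite hornerD opprD addrACA (le_trans (ler_normD _ _)) // [leRHS]splitr.
  by rewrite lerD ?qf ?rg.
by rewrite op_hornerD opprD addrACA mulr1 [e]splitr; apply: opboundD.
Qed.

Lemma fun_calcM f g a : positive_op a -> papprox f -> papprox g ->
  fun_calc (fun t => f t * g t) a = fun_calc f a \o fun_calc g a.
Proof.
move=> pa pf pg; have [ba _ _] := (positive_opP a).1 pa; have [la _] := ba.
have [K K0 hK] := papprox_bounded (opnorm a) pf.
have [K' K'0 hK'] := papprox_bounded (opnorm a) pg.
have [c c0 hc] := bounded_opbound (fun_calc_bounded pa pf).
have [d d0 hd] := bounded_opbound (fun_calc_bounded pa pg).
have pfg := papproxM pf pg.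
apply: (@op_eq_small _ _ _ _ (3 * (K' + K + 1) + (c + d + 1))) => e e0.
(* A tolerance of at most 1 makes the product of two errors no larger than one error. *)
pose e' := Num.min e 1.
have e'0 : 0 < e' by rewrite lt_min e0 /=.
have e'1 : e' <= 1 by rewrite ge_min lexx orbT.
have e'e : e' <= e by rewrite ge_min lexx.
have [q qf qb] := fun_calc_approx pa pf e'0.
have [r rg rb] := fun_calc_approx pa pg e'0.
have KK : 0 < e' * (K' + K + 1) by rewrite mulr_gt0 // !addr_gt0.
have cd0 : 0 <= 3 * (K' + K + 1) + (c + d + 1).
  by rewrite !addr_ge0 ?mulr_ge0 ?addr_ge0 // ltW.
apply: (@opboundW _ _ _ (e' * (3 * (K' + K + 1) + (c + d + 1)))).
  by rewrite ler_wpM2r.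
have := @fun_calc_near _ _ (q * r) _ pa pfg KK.
move=> /(_ _)/wrap[t tc|].
  have -> : (q * r).[t] - f t * g t =
      (q.[t] - f t) * g t + f t * (r.[t] - g t) + (q.[t] - f t) * (r.[t] - g t).
    by rewrite hornerM; ring.
  have -> : e' * (K' + K + 1) = e' * K' + K * e' + e' by ring.
  rewrite (le_trans (ler_normD _ _)) // lerD //.
    rewrite (le_trans (ler_normD _ _)) // !normrM lerD //.
      by rewrite ler_pM ?qf ?hK'.
    by rewrite ler_pM ?rg ?hK.
  rewrite normrM (le_trans (ler_pM _ _ (qf t tc) (rg t tc))) //.
  by rewrite ler_piMr // ltW.
rewrite op_hornerM // => /opboundN; rewrite opprB => h.
rewrite -(subrKA (op_horner q a \o op_horner r a)) mulrDr.
have -> : e' * (3 * (K' + K + 1)) = 3 * (e' * (K' + K + 1)) by ring.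
apply: opboundD => //.
have lf : linear (fun_calc f a) by case: (fun_calc_bounded pa pf).
have -> : (op_horner q a \o op_horner r a) - (fun_calc f a \o fun_calc g a) =
    ((op_horner q a - fun_calc f a) \o (op_horner r a - fun_calc g a)) +
    ((op_horner q a - fun_calc f a) \o fun_calc g a) +
    (fun_calc f a \o (op_horner r a - fun_calc g a)).
  apply/funext => k; rewrite !fctE /=.
  have lq := linear_op_horner q la.
  rewrite (linopB _ _ lq) !(linopB _ _ lf).
  by rewrite [RHS]addrAC subrK subrKA.
have -> : e' * (c + d + 1) = e' * 1 + e' * d + c * e' by ring.
apply: opboundD; last exact: opboundM.
apply: opboundD; apply: opboundM => //; try exact: ltW.
exact: opboundW e'1 rb.
Qed.

End FunctionalCalculusTheory.

(** * Positive operators, von Neumann algebras and traces *)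

Section PositiveOperators.
Variables (R : realType) (H : hilbertSpace R).
Implicit Types (h k : H) (c e t : R) (a b s : H -> H) (z : R[i]) (p q r : {poly R}).
Implicit Types (f g : R -> R).

Lemma positive_bounded a : positive_op a -> bounded_op a.
Proof. by case. Qed.
Lemma positive_linear a : positive_op a -> linear a.
Proof. by case=> -[]. Qed.
Lemma positive_symm a : positive_op a -> symm a.
Proof. by case/positive_opP. Qed.
Lemma positive_rdot a h : positive_op a -> 0 <= rdot (a h) h.
Proof. by case/positive_opP. Qed.

Lemma positive_op0 : positive_op (0 : H -> H).
Proof.
apply/positive_opP; split; first exact: bounded_op0.
  by move=> h k; rewrite !zero_op rdot0l rdot0r.
by move=> h; rewrite zero_op rdot0l.
Qed.

Lemma positive_op1 : positive_op (idfun : H -> H).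
Proof.
by apply/positive_opP; split; [exact: bounded_op1| |move=> h; exact: rdot_ge0].
Qed.

Lemma positive_opD a b : positive_op a -> positive_op b -> positive_op (a + b).
Proof.
move=> pa pb; apply/positive_opP; split=> [|h k|h].
- by apply: bounded_opD; apply: positive_bounded.
- by rewrite !fctE rdotDl rdotDr !positive_symm.
- by rewrite fctE rdotDl addr_ge0 ?positive_rdot.
Qed.

Lemma positive_opZ c a : 0 <= c -> positive_op a -> positive_op (c%:C *: a).
Proof.
move=> c0 pa; apply/positive_opP; split=> [|h k|h].
- by apply: bounded_opZ; apply: positive_bounded.
- by rewrite !fctE rdotZl rdotZr positive_symm.
- by rewrite fctE rdotZl mulr_ge0 ?positive_rdot.
Qed.

Lemma positive_op_sum (I : Type) (l : seq I) (P : pred I) (F : I -> H -> H) :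
  (forall i, P i -> positive_op (F i)) -> positive_op (\sum_(i <- l | P i) F i).
Proof.
move=> pF; apply: (big_ind (@positive_op R H)) => //; first exact: positive_op0.
exact: positive_opD.
Qed.

Lemma positive_op_sandwich s a : bounded_op s -> symm s -> positive_op a ->
  positive_op (s \o a \o s).
Proof.
move=> bs ss pa; apply/positive_opP; split=> [|h k|h] /=.
- by do 2 apply: bounded_opM => //; exact: positive_bounded.
- by rewrite ss positive_symm // ss.
- by rewrite ss positive_rdot.
Qed.

Lemma symmB a b : symm a -> symm b -> symm (a - b).
Proof. by move=> sa sb h k; rewrite !fctE !rscale sa sb. Qed.

(** Symmetry and nonnegativity of the form are both preserved by norm limits; [C] may have any
    sign. *)
Lemma positive_op_closed a C : bounded_op a ->
  (forall e, 0 < e -> exists2 b, positive_op b & opbound (b - a) (e * C)) ->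
  positive_op a.
Proof.
move=> ba hb; apply/positive_opP; split=> // [h k|h].
  apply/eqP; rewrite -subr_eq0 -normr_eq0 eq_le normr_ge0 andbT.
  apply/ler_addgt0Pr => e e0; rewrite add0r.
  pose K := C * (nrm h * nrm k) *+ 2; pose d := e / (`|K| + 1).
  have K0 : 0 < `|K| + 1 by rewrite ltr_pwDr.
  have d0 : 0 < d by rewrite divr_gt0.
  have [b pb hba] := hb d d0.
  have -> : rdot (a h) k - rdot h (a k) = rdot h ((b - a) k) - rdot ((b - a) h) k.
    by rewrite !fctE !rscale (positive_symm pb); ring.
  rewrite (le_trans (ler_normB _ _)) //; apply: (@le_trans _ _ (d * K)).
    rewrite /K -mulrnAr mulrA mulr2n mulrDr lerD // (le_trans (rdot_abs_le _ _)) //.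
      by rewrite [leRHS]mulrCA ler_wpM2l ?nrm_ge0 //; exact: hba.
    by rewrite mulrA ler_wpM2r ?nrm_ge0 //; exact: hba.
  rewrite /d -mulrA ler_piMr // ?(ltW e0) // mulrC ler_pdivrMr // mul1r.
  by rewrite (le_trans (ler_norm K)) // lerDl.
apply/ler_addgt0Pr => e e0.
pose K := C * (nrm h * nrm h); pose d := e / (`|K| + 1).
have K0 : 0 < `|K| + 1 by rewrite ltr_pwDr.
have d0 : 0 < d by rewrite divr_gt0.
have [b pb hba] := hb d d0.
have -> : rdot (a h) h = rdot (b h) h - rdot ((b - a) h) h.
  by rewrite !fctE !rscale; ring.
have dKe : d * K <= e.
  rewrite /d -mulrA ler_piMr // ?(ltW e0) // mulrC ler_pdivrMr // mul1r.
  by rewrite (le_trans (ler_norm K)) // lerDl.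
have h1 : rdot ((b - a) h) h <= d * K.
  by rewrite (le_trans (rdot_le _ _)) // /K !mulrA ler_wpM2r ?nrm_ge0 //.
by have := positive_rdot h pb; lra.
Qed.

Lemma fun_calc_ge0 f a : positive_op a -> papprox f ->
  (forall t, 0 <= t <= opnorm a -> 0 <= f t) -> positive_op (fun_calc f a).
Proof.
move=> pa pf f0; apply: (@positive_op_closed _ 2); first exact: fun_calc_bounded.
move=> e e0; have [q qf qb] := fun_calc_approx pa pf e0.
(* Near a nonnegative f the polynomial [q] may dip to -e; adding e repairs this at a cost of e in
   norm. *)
exists (op_horner (q + e%:P) a).
  apply: op_horner_ge0 => // t tc; rewrite hornerD hornerC.
  by have := qf t tc; have := f0 t tc; rewrite ler_norml => ? /andP[]; lra.
rewrite op_hornerD addrAC mulr_natr mulr2n; apply: opboundD => //.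
rewrite op_hornerC => h; rewrite fctE nrmZr ger0_norm //; exact: ltW.
Qed.

Lemma fun_calc_cst c a : positive_op a -> fun_calc (fun=> c) a = c%:C *: idfun.
Proof.
move=> pa; rewrite -(op_hornerC c a) -fun_calc_horner //; apply: fun_calc_ext => //.
- exact: papprox_cst.
- exact: papprox_horner.
- by move=> t _; rewrite hornerC.
Qed.

Lemma fun_calc_id a : positive_op a -> fun_calc id a = a.
Proof.
move=> pa; rewrite -[RHS]op_hornerX -fun_calc_horner //.
apply: fun_calc_ext => //; last by move=> t _; rewrite hornerX.
  by apply: papprox_ext (papprox_horner 'X) => t _; rewrite hornerX.
exact: papprox_horner.
Qed.

Lemma fun_calcZ c f a : positive_op a -> papprox f ->
  fun_calc (fun t => c * f t) a = c%:C *: fun_calc f a.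
Proof.
move=> pa pf; rewrite fun_calcM //; last exact: papprox_cst.
by rewrite fun_calc_cst //; apply/funext.
Qed.

Lemma fun_calcB f g a : positive_op a -> papprox f -> papprox g ->
  fun_calc (fun t => f t - g t) a = fun_calc f a - fun_calc g a.
Proof.
move=> pa pf pg; have pNg := papproxZ (-1) pg.
rewrite -[- fun_calc g a]scaleN1r -(rmorphN1 (real_complex R)) -fun_calcZ //.
rewrite -fun_calcD //; congr (fun_calc _ a).
by apply/funext => t; rewrite mulN1r.
Qed.

(** A polynomial inner function suffices for the two substitutions that occur: the square inside
    [op_abs] and the dilation of X by p. *)
Lemma fun_calc_comp f r a : positive_op a -> papprox f ->
  (forall t, 0 <= t -> 0 <= r.[t]) ->
  fun_calc f (op_horner r a) = fun_calc (fun t => f r.[t]) a.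
Proof.
move=> pa pf r0; have la := positive_linear pa.
have pra : positive_op (op_horner r a).
  by apply: op_horner_ge0 => // t /andP[t0 _]; exact: r0.
have pfr := papprox_comp pf r0.
have [K K0 hK] := horner_bounded r (opnorm a).
(* No spectral mapping is known, so one interval has to cover both the values of [r] and the norm of
   r(a). *)
pose L := Num.max K (opnorm (op_horner r a)).
apply: (@op_eq_small _ _ _ _ 6) => e e0; have [q hq] := pf L e e0.
have q1 : opbound (op_horner q (op_horner r a) - fun_calc f (op_horner r a)) (3 * e).
  apply: fun_calc_near => // t /andP[t0 tL]; apply: hq.
  by rewrite t0 le_max tL orbT.
have q2 : opbound (op_horner (q \Po r) a - fun_calc (fun t => f r.[t]) a) (3 * e).
  apply: fun_calc_near => // t /andP[t0 tL]; rewrite horner_comp; apply: hq.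
  by rewrite r0 //= le_max (le_trans (ler_norm _)) // hK ?t0.
move: q2 q1; rewrite op_horner_comp // => q2 /opboundN; rewrite opprB => q1.
rewrite -(subrKA (op_horner q (op_horner r a))).
have -> : e * 6 = 3 * e + 3 * e by ring.
exact: opboundD.
Qed.

Lemma fun_calc_commute f a b : positive_op a -> papprox f -> bounded_op b ->
  a \o b = b \o a -> fun_calc f a \o b = b \o fun_calc f a.
Proof.
move=> pa pf bb ab; have [c c0 hc] := bounded_opbound bb; have [lb _] := bb.
apply: (@op_eq_small _ _ _ _ (c + c)) => e e0.
have [q _ qb] := fun_calc_approx pa pf e0.
have qab := op_horner_commute q lb ab.
have -> : (fun_calc f a \o b) - (b \o fun_calc f a) =
   (b \o (op_horner q a - fun_calc f a)) - ((op_horner q a - fun_calc f a) \o b).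
  apply/funext => h; have := congr1 (@^~ h) qab; rewrite !fctE /= => ->.
  by rewrite (linopB _ _ lb) opprB [X in _ = X]addrC addrA subrK.
rewrite mulrDr; apply: opboundB; last by apply: opboundM => //; exact: ltW.
by rewrite mulrC; apply: opboundM.
Qed.

Lemma adjoint_unique a b b' : is_adjoint a b -> is_adjoint a b' -> b = b'.
Proof.
move=> ab ab'; apply/funext => k; apply/eqP; rewrite -subr_eq0.
apply/eqP/rdot_eq0; rewrite rdotDr rdotNr; apply/eqP; rewrite subr_eq0.
by rewrite /rdot -ab -ab'.
Qed.

Lemma adj_eq a b : bounded_op b -> is_adjoint a b -> adj a = b.
Proof.
move=> bb ab; pose S := [set b' | bounded_op b' /\ is_adjoint a b'].
have [_ h] := @xgetPex _ (0 : H -> H) S (ex_intro _ b (conj bb ab)).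
exact: adjoint_unique h ab.
Qed.

Lemma adj_positive a : positive_op a -> adj a = a.
Proof.
move=> pa; apply: adj_eq; first exact: positive_bounded.
by apply: symm_adjoint; [exact: positive_linear|exact: positive_symm].
Qed.

Lemma op_abs_positive a : papprox (fun t : R => t `^ 2^-1) ->
  positive_op a -> op_abs a = a.
Proof.
move=> ps pa; rewrite /op_abs adj_positive // /op_pow.
have la := positive_linear pa.
have -> : a \o a = op_horner ('X * 'X) a by rewrite op_hornerM // op_hornerX.
rewrite fun_calc_comp // => [|t t0]; last by rewrite !hornerE mulr_ge0.
rewrite -[RHS]fun_calc_id //; apply: fun_calc_ext => //.
- by apply: (papprox_comp ps) => t t0; rewrite !hornerE mulr_ge0.
- by apply: papprox_ext (papprox_horner 'X) => t _; rewrite hornerX.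
- move=> t /andP[t0 _]; rewrite !hornerE -expr2 -powR_mulrn // -powRrM.
  by rewrite divff ?powRr1.
Qed.

End PositiveOperators.

(** * Von Neumann algebras through the bicommutant *)

Section VonNeumannAlgebra.
Variables (R : realType) (H : hilbertSpace R) (M : set (H -> H)).
Hypothesis vM : von_neumann_algebra M.
Implicit Types (a b x y : H -> H) (c : R).

Lemma commutantP (S : set (H -> H)) a : commutant S a <->
  bounded_op a /\ forall b, S b -> forall h, a (b h) = b (a h).
Proof.
split=> -[ba ab]; split=> // b Sb; last by apply/funext => h; exact: ab.
by move=> h; exact: (congr1 (@^~ h) (ab b Sb)).
Qed.

Lemma vn_commutant a : M a <-> commutant (commutant M) a.
Proof. by case: vM => _ ->. Qed.

Lemma vn_bounded a : M a -> bounded_op a.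
Proof. by case/vn_commutant. Qed.

Lemma vn_linear a : M a -> linear a.
Proof. by case/vn_bounded. Qed.

Lemma commutant_linear (S : set (H -> H)) a : commutant S a -> linear a.
Proof. by case=> -[]. Qed.

Lemma vn1 : M idfun.
Proof. by apply/vn_commutant/commutantP; split=> //; exact: bounded_op1. Qed.

Lemma vnD a b : M a -> M b -> M (a + b).
Proof.
move=> Ma Mb; apply/vn_commutant/commutantP; split.
  by apply: bounded_opD; exact: vn_bounded.
move=> c Mc h; move: Ma Mb => /vn_commutant/commutantP[_ ac] /vn_commutant/commutantP[_ bc].
by rewrite !fctE ac // bc // (linopD _ _ (commutant_linear Mc)).
Qed.

Lemma vnZ z a : M a -> M (z *: a).
Proof.
move=> Ma; apply/vn_commutant/commutantP; split; first exact/bounded_opZ/vn_bounded.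
move=> c Mc h; move: Ma => /vn_commutant/commutantP[_ ac].
by rewrite !fctE ac // (linopZ _ _ (commutant_linear Mc)).
Qed.

Lemma vn0 : M 0.
Proof. by rewrite -[0](scale0r (idfun : H -> H)); exact/vnZ/vn1. Qed.

Lemma vnN a : M a -> M (- a).
Proof. by move=> Ma; rewrite -scaleN1r; exact: vnZ. Qed.

Lemma vnB a b : M a -> M b -> M (a - b).
Proof. by move=> Ma Mb; exact/vnD/vnN. Qed.

Lemma vnM a b : M a -> M b -> M (a \o b).
Proof.
move=> Ma Mb; apply/vn_commutant/commutantP; split.
  by apply: bounded_opM; exact: vn_bounded.
move=> c Mc h; move: Ma Mb => /vn_commutant/commutantP[_ ac] /vn_commutant/commutantP[_ bc].
by rewrite /= bc // ac.
Qed.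

Lemma vn_sum (I : Type) (l : seq I) (P : pred I) (F : I -> H -> H) :
  (forall i, P i -> M (F i)) -> M (\sum_(i <- l | P i) F i).
Proof.
by move=> MF; apply: (big_ind M) => //; [exact: vn0|exact: vnD].
Qed.

(** Whatever commutes with [a] commutes with f(a), so f(a) lies in the bicommutant. *)
Lemma vn_fun_calc (f : R -> R) a : M a -> positive_op a -> papprox f -> M (fun_calc f a).
Proof.
move=> Ma pa pf; apply/vn_commutant; split; first exact: fun_calc_bounded.
move=> b Mb; apply: fun_calc_commute => //; first by case: Mb.
by have /vn_commutant[_ ->] := Ma.
Qed.

End VonNeumannAlgebra.

(** * The real part of the trace *)

Section Trace.
Variables (R : realType) (H : hilbertSpace R) (M : set (H -> H)).
Variable tau : (H -> H) -> R[i].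
Hypotheses (vM : von_neumann_algebra M) (tM : normal_faithful_tracial_state M tau).
Hypothesis papprox_sqrt : papprox (fun t : R => t `^ 2^-1).
Implicit Types (a b x y : H -> H) (c : R).

Definition real_trace a : R := complex.Re (tau a).

Lemma rtrD a b : M a -> M b -> real_trace (a + b) = real_trace a + real_trace b.
Proof.
move=> Ma Mb; rewrite /real_trace -[a in LHS]scale1r (trace_linear tM) // mul1r.
by rewrite raddfD.
Qed.

Lemma tau0 : tau 0 = 0.
Proof.
have := trace_linear tM 1 (vn0 vM) (vn0 vM); rewrite scale1r addr0 mul1r => e.
by apply: (addrI (tau 0)); rewrite -e addr0.
Qed.

Lemma rtrZ c a : M a -> real_trace (c%:C *: a) = c * real_trace a.
Proof.
move=> Ma; rewrite /real_trace -[_ *: _]addr0 (trace_linear tM) ?tau0 ?addr0 //; last exact: vn0.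
by case: (tau a) => u v /=; rewrite mul0r subr0.
Qed.

Lemma rtrN a : M a -> real_trace (- a) = - real_trace a.
Proof.
by move=> Ma; rewrite -scaleN1r -(rmorphN1 (real_complex R)) rtrZ // mulN1r.
Qed.

Lemma rtrB a b : M a -> M b -> real_trace (a - b) = real_trace a - real_trace b.
Proof. by move=> Ma Mb; rewrite rtrD ?rtrN //; exact: vnN. Qed.

Lemma rtrC a b : M a -> M b -> real_trace (a \o b) = real_trace (b \o a).
Proof. by move=> Ma Mb; rewrite /real_trace (trace_tracial tM). Qed.

Lemma rtr1 : real_trace idfun = 1.
Proof. by rewrite /real_trace (trace_unit tM). Qed.

Lemma rtr_ge0 a : M a -> positive_op a -> 0 <= real_trace a.
Proof. by move=> Ma pa; have := trace_pos tM Ma pa; rewrite lecE => /andP[]. Qed.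

Lemma rtr_sum (I : Type) (l : seq I) (P : pred I) (F : I -> H -> H) :
  (forall i, P i -> M (F i)) ->
  real_trace (\sum_(i <- l | P i) F i) = \sum_(i <- l | P i) real_trace (F i).
Proof.
move=> MF; apply: (@proj2 (M (\sum_(i <- l | P i) F i))).
elim/big_ind2: _ => [|a u b v [Ma <-] [Mb <-]|i Pi]; last by split=> //; exact: MF.
  by split; [exact: vn0|rewrite /real_trace tau0].
by split; [exact: vnD|rewrite rtrD].
Qed.

(** The product need not be positive, but with s the square root of [a] traciality replaces s s x by
    the positive operator s x s. *)
Lemma rtrM_ge0 a x : M a -> positive_op a -> M x -> positive_op x ->
  0 <= real_trace (a \o x).
Proof.
move=> Ma pa Mx px; pose s := fun_calc (fun t : R => t `^ 2^-1) a.
have Ms : M s by apply: vn_fun_calc.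
have ps : positive_op s by apply: fun_calc_ge0 => // t _; exact: powR_ge0.
have aE : a = s \o s.
  rewrite -fun_calcM // -[LHS]fun_calc_id //; apply: fun_calc_ext => //.
  - by apply: papprox_ext (papprox_horner 'X) => t _; rewrite hornerX.
  - exact: papproxM.
  - move=> t /andP[t0 _]; have half : 2^-1 + 2^-1 = 1 :> R by lra.
    by rewrite -powRD half ?oner_eq0 // powRr1.
rewrite aE -compA rtrC //; last exact: vnM.
apply: rtr_ge0; first by do 2?apply: vnM.
by apply: positive_op_sandwich => //; [exact: positive_bounded|exact: positive_symm].
Qed.

End Trace.

(** * Geometric sums of resolvents and powers *)

Section ScalingSeries.
Variables (R : realType) (u gam rho : R).
Hypotheses (u0 : 0 < u) (gam0 : 0 < gam) (rho0 : 0 < rho) (rho1 : rho < 1).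
Variables a b : nat -> R -> R.
Hypotheses
  (aS : forall j t, 0 < t -> a j.+1 (u * t) = gam * a j t)
  (bS : forall j t, 0 < t -> b j (u * t) = gam * b j.+1 t)
  (a0E : forall t, a 0%N t = b 0%N t)
  (a_mono : forall j s t, 0 < s <= t -> 0 <= a j t <= a j s)
  (b_mono : forall j s t, 0 < s <= t -> 0 <= b j t <= b j s)
  (a_bound : forall j t, 0 < t -> a j t <= (1 + t^-1) * rho ^+ j)
  (b_bound : forall j t, 0 < t -> b j t <= (1 + t^-1) * rho ^+ j).

(** A window of a two-sided series: [a j] is the term of index j and [b j] the term of index -j. The
    [b] part starts at 1 because index 0 is counted by [a 0]. *)
Definition scal_sum n t := \sum_(j < n) (a j t + b j.+1 t).

Lemma scal_sumS n t : scal_sum n.+1 t = scal_sum n t + (a n t + b n.+1 t).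
Proof. by rewrite /scal_sum big_ord_recr. Qed.

(** Dilation by u lowers each index by one, so the window loses its top term [a n] and gains
    [b n.+2] at the bottom. *)
Lemma scal_sum_shift n t : 0 < t ->
  scal_sum n.+1 (u * t) = gam * (scal_sum n.+1 t - a n t + b n.+2 t).
Proof.
move=> t0; elim: n => [|n IH].
  by rewrite /scal_sum !big_ord1 /= a0E !bS //; ring.
by rewrite scal_sumS IH [scal_sum n.+2 t]scal_sumS aS // bS //; ring.
Qed.

(** Tails decrease in t, so convergence at a point s is uniform on [s, oo). *)
Lemma scal_tail_mono n m s t : (n <= m)%N -> 0 < s <= t ->
  0 <= scal_sum m t - scal_sum n t <= scal_sum m s - scal_sum n s.
Proof.
move=> nm st; elim: m nm => [|m IH].
  by rewrite leqn0 => /eqP ->; rewrite !subrr lexx.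
rewrite leq_eqVlt => /orP[/eqP <-|]; first by rewrite !subrr lexx.
rewrite ltnS => /IH; rewrite !scal_sumS.
by have := a_mono m st; have := b_mono m.+1 st; lra.
Qed.

Lemma scal_sum_mono n s t : 0 < s <= t -> 0 <= scal_sum n t <= scal_sum n s.
Proof.
by move=> st; have := @scal_tail_mono 0 n _ _ (leq0n n) st; rewrite /scal_sum !big_ord0 !subr0.
Qed.

Lemma scal_sum_bound n t : 0 < t -> scal_sum n t <= 2 * (1 + t^-1) / (1 - rho).
Proof.
move=> t0; have K0 : 0 < 1 + t^-1 by rewrite addr_gt0 ?invr_gt0.
rewrite ler_pdivlMr ?subr_gt0 //.
(* The exact geometric partial sum is the form that passes through the induction. *)
suff : scal_sum n t * (1 - rho) <= 2 * (1 + t^-1) * (1 - rho ^+ n).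
  move/le_trans; apply; rewrite ger_pMr ?mulr_gt0 //.
  by rewrite gerBl exprn_ge0 // ltW.
elim: n => [|n IH]; first by rewrite /scal_sum big_ord0 mul0r expr0 subrr mulr0.
rewrite scal_sumS mulrDl.
have h : a n t + b n.+1 t <= 2 * (1 + t^-1) * rho ^+ n.
  rewrite mulr2n !mulrDl mul1r lerD ?a_bound //.
  rewrite (le_trans (b_bound _ t0)) // ler_pM2l // exprS ler_piMl ?exprn_ge0 //; exact: ltW.
have := ler_wpM2r (ltW (_ : 0 < 1 - rho)) h; rewrite subr_gt0 => /(_ rho1).
rewrite exprS; lra.
Qed.

Lemma scal_sum_cvg t : 0 < t -> cvgn (fun n => scal_sum n t).
Proof.
move=> t0; apply: nondecreasing_is_cvgn.
  move=> n m nm; rewrite -subr_ge0.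
  by have /andP[] := @scal_tail_mono n m t t nm ltac:(by rewrite t0 lexx).
by exists (2 * (1 + t^-1) / (1 - rho)) => _ [n _ <-]; exact: scal_sum_bound.
Qed.

Definition scal_lim t := limn (fun n => scal_sum n t).

Lemma scal_limP t e : 0 < t -> 0 < e ->
  exists N, forall n, (N <= n)%N -> `|scal_lim t - scal_sum n t| < e.
Proof.
move=> t0 e0; have /cvgrPdist_lt/(_ e e0)[N _ hN] := scal_sum_cvg t0.
by exists N => n; exact: hN.
Qed.

Lemma scal_lim_mono s t : 0 < s <= t -> scal_lim t <= scal_lim s.
Proof.
move=> st; have s0 : 0 < s by case/andP: st.
have t0 : 0 < t by case/andP: st => ?; exact: lt_le_trans.
apply/ler_addgt0Pr => e e0; have e20 : 0 < e / 2 by rewrite divr_gt0.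
have [N hN] := scal_limP t0 e20; have [N' hN'] := scal_limP s0 e20.
have := hN _ (leq_maxl N N'); have := hN' _ (leq_maxr N N').
have := scal_sum_mono (maxn N N') st.
by rewrite !ltr_norml => ? /andP[? ?] /andP[? ?]; lra.
Qed.

Lemma scal_lim_near s e : 0 < s -> 0 < e -> exists N, forall n, (N <= n)%N ->
  forall t, s <= t -> `|scal_sum n t - scal_lim t| <= e.
Proof.
move=> s0 e0; have e20 : 0 < e / 2 by rewrite divr_gt0.
have [N hN] := scal_limP s0 e20; exists N => n Nn t st.
have t0 : 0 < t := lt_le_trans s0 st.
have sst : 0 < s <= t by rewrite s0.
apply/ler_addgt0Pr => d d0; have [N' hN'] := scal_limP t0 d0.
have := hN' _ (leq_maxr n N').
have := scal_tail_mono (leq_maxl n N') sst.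
have := hN _ Nn; have := hN (maxn n N') (leq_trans Nn (leq_maxl _ _)).
rewrite !ltr_norml ler_norml.
by move=> /andP[? ?] /andP[? ?] /andP[? ?] /andP[? ?]; apply/andP; split; lra.
Qed.

Lemma scal_lim_scale t : 0 < t -> scal_lim (u * t) = gam * scal_lim t.
Proof.
move=> t0; have ut0 : 0 < u * t by rewrite mulr_gt0.
apply/eqP; rewrite -subr_eq0 -normr_eq0 eq_le normr_ge0 andbT.
apply/ler_addgt0Pr => e e0; rewrite add0r.
have K0 : 0 < 1 + t^-1 by rewrite addr_gt0 ?invr_gt0.
(* Four errors: the limits at u t and at t, and the two boundary terms of the shifted window. *)
have e40 : 0 < e / 4 by rewrite divr_gt0.
have g40 : 0 < e / 4 / gam by rewrite divr_gt0.
have [N1 h1] := scal_limP ut0 e40; have [N2 h2] := scal_limP t0 g40.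
have : (rho ^+ n @[n --> \oo] --> 0)%classic by apply: cvg_expr; rewrite ger0_norm // ltW.
have r0 : 0 < e / 4 / gam / (1 + t^-1) by rewrite divr_gt0.
move=> /cvgrPdist_lt /(_ _ r0) [N3 _ h3].
pose n := maxn N1 (maxn N2 N3).
have := h1 n.+1 (leqW (leq_maxl _ _)).
have := h2 n.+1 (leqW (leq_trans (leq_maxl _ _) (leq_maxr _ _))).
have := h3 n (leq_trans (leq_maxr _ _) (leq_maxr _ _)).
rewrite /= sub0r normrN ger0_norm ?exprn_ge0 ?(ltW rho0) // ltr_pdivlMr // mulrC => r1.
have r2 : gam * ((1 + t^-1) * rho ^+ n) < e / 4 by rewrite mulrC -ltr_pdivlMr.
have tt : 0 < t <= t by rewrite t0 lexx.
have a1 : 0 <= gam * a n t <= e / 4.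
  have := a_mono n tt; have := a_bound n t0 => ? /andP[? _].
  rewrite mulr_ge0 ?(ltW gam0) //= (le_trans _ (ltW r2)) // ler_pM2l //.
have b1 : 0 <= gam * b n.+2 t <= e / 4.
  have := b_mono n.+2 tt; have := b_bound n.+2 t0 => h /andP[? _].
  rewrite mulr_ge0 ?(ltW gam0) //= (le_trans _ (ltW r2)) // ler_pM2l //.
  rewrite (le_trans h) // ler_pM2l // -addn2 exprD ler_piMr ?exprn_ge0 ?(ltW rho0) //.
  by rewrite exprn_ile1 // ltW.
rewrite scal_sum_shift //.
have -> : scal_lim (u * t) - gam * scal_lim t =
   (scal_lim (u * t) - gam * (scal_sum n.+1 t - a n t + b n.+2 t)) -
   gam * (scal_lim t - scal_sum n.+1 t) - gam * a n t + gam * b n.+2 t by ring.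
move=> h2' h1'.
have h3' : `|gam * (scal_lim t - scal_sum n.+1 t)| < e / 4.
  by rewrite normrM gtr0_norm // mulrC -ltr_pdivlMr.
move: h1' h3' a1 b1; rewrite !ltr_norml ler_norml.
by move=> /andP[? ?] /andP[? ?] /andP[? ?] /andP[? ?]; apply/andP; split; lra.
Qed.

Lemma scal_lim_gt0 : (forall t, 0 < t -> 0 < a 0%N t) -> 0 < scal_lim 1.
Proof.
move=> a00; apply: lt_le_trans (a00 1 ltr01) _.
apply/ler_addgt0Pr => e e0; have [N hN] := scal_limP ltr01 e0.
have t1 : 0 < (1 : R) <= (1 : R) by rewrite ltr01 lexx.
have := hN N.+1 (leqnSn N); rewrite ltr_norml.
have := @scal_tail_mono 1 N.+1 1 1 isT t1.
have := b_mono 1 t1.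
rewrite {2 4}/scal_sum big_ord1 => /andP[? _] /andP[? _] /andP[? ?]; lra.
Qed.

End ScalingSeries.

(** * Discrete scaling and monotonicity give an approximate power law *)

Section PowerLaw.
Variables (R : realType) (u p : R) (Q : R -> R).
Hypotheses (u1 : 1 < u) (p1 : p < 1) (Q0 : 0 < Q 1).
Hypotheses (QS : forall t, 0 < t -> Q (u * t) = u `^ (p - 1) * Q t)
  (Q_mono : forall s t, 0 < s <= t -> Q t <= Q s).

Lemma scale_nat n t : 0 < t -> Q (u ^+ n * t) = u `^ (p - 1) ^+ n * Q t.
Proof.
move=> t0; elim: n => [|n IH]; first by rewrite !expr0 !mul1r.
have u0 : 0 < u := lt_trans ltr01 u1.
by rewrite !exprS -!mulrA QS ?IH // mulr_gt0 // exprn_gt0.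
Qed.

Lemma scale_int (m : int) : Q (u ^ m) = Q 1 * (u ^ m) `^ (p - 1).
Proof.
have u0 : 0 < u := lt_trans ltr01 u1.
case: m => n.
  rewrite -[u ^ _]/(u ^+ n) -{1}[u ^+ n]mulr1 scale_nat // mulrC.
  by rewrite -!powR_mulrn ?powR_ge0 ?(ltW u0) // -!powRrM [_ * (p - 1)]mulrC.
rewrite NegzE -[u ^ _]/(u ^- n.+1); set k := n.+1.
have uk0 : 0 < u ^+ k by rewrite exprn_gt0.
have g0 : 0 < u `^ (p - 1) by rewrite powR_gt0.
have := @scale_nat k (u ^- k); rewrite invr_gt0 mulfV ?gt_eqF // => /(_ uk0) ->.
rewrite mulrAC -[LHS]mul1r; congr (_ * _).
rewrite -powR_inv1 ?exprn_ge0 ?(ltW u0) // -!powR_mulrn ?powR_ge0 ?(ltW u0) //.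
rewrite -!powRrM -powRD; last by rewrite (gt_eqF u0) implybT.
by rewrite [X in _ `^ X](_ : _ = 0) ?powRr0 //; ring.
Qed.

(** Scaling determines Q exactly at the integer powers of u. Any t lies between two consecutive
    ones, and monotonicity then costs at most a factor u^(p-1), which is near 1 when u is. *)
Lemma power_law t : 0 < t ->
  Q 1 * t `^ (p - 1) * u `^ (p - 1) <= Q t <= Q 1 * t `^ (p - 1) / u `^ (p - 1).
Proof.
move=> t0; have u0 : 0 < u := lt_trans ltr01 u1.
pose m := Num.floor (ln t / ln u).
have lu0 : 0 < ln u by rewrite ln_gt0.
have [m1 m2] : u ^ m <= t /\ t <= u ^ m * u.
  have /andP[] := floor_itv (ln t / ln u); rewrite -/m.
  rewrite ler_pdivlMr // ltr_pdivrMr // => l1 l2.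
  rewrite -[X in _ * X]expr1z -expfzDr ?gt_eqF // -!powR_intmul ?(ltW u0) //.
  by split; rewrite -ler_ln ?posrE ?powR_gt0 // ln_powR // ltW.
have um0 : 0 < u ^ m by rewrite exprz_gt0.
have g0 : 0 < u `^ (p - 1) by rewrite powR_gt0.
have pw x y : 0 < x -> x <= y -> y `^ (p - 1) <= x `^ (p - 1).
  move=> x0 xy; have y0 := lt_le_trans x0 xy.
  have -> : p - 1 = - (1 - p) by rewrite opprB.
  rewrite !powRN lef_pV2 ?posrE ?powR_gt0 //.
  by rewrite ge0_ler_powR ?nnegrE ?(ltW x0) ?(ltW y0) // subr_ge0 ltW.
have qm := scale_int m.
have qm1 : Q (u ^ m * u) = Q 1 * (u ^ m) `^ (p - 1) * u `^ (p - 1).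
  by rewrite mulrC QS // qm mulrC.
apply/andP; split.
  apply: (@le_trans _ _ (Q (u ^ m * u))); last by apply: Q_mono; rewrite t0.
  by rewrite qm1 ler_pM2r // ler_pM2l // pw.
apply: (@le_trans _ _ (Q (u ^ m))); first by apply: Q_mono; rewrite um0.
rewrite qm -mulrA ler_pM2l // ler_pdivlMr // -powRM ?(ltW um0) ?(ltW u0) //.
by rewrite pw.
Qed.

End PowerLaw.

(** * Scalar inequalities for a single resolvent term *)

Section ResolventSums.
Variable R : realType.
Implicit Types (c l s t u p e : R).

(** Young's inequality for x^p and 1, with the conjugate exponents 1/p and 1/(1 - p). *)
Lemma powR_bernoulli p x : 0 < p -> p < 1 -> 0 < x -> x `^ p <= 1 + p * (x - 1).
Proof.
move=> p0 p1 x0; have q0 : 0 < 1 - p by rewrite subr_gt0.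
have := @conjugate_powR R (x `^ p) 1 p^-1 (1 - p)^-1 (powR_ge0 _ _) ler01.
rewrite !invr_gt0 !invrK mulr1 -powRrM mulfV ?gt_eqF // powR1 powRr1 ?(ltW x0) //.
by move=> /(_ p0 q0); rewrite addrC subrK mul1r => /(_ erefl); lra.
Qed.

Lemma resolvent_mono c l s t : 0 < c -> 0 < l -> 0 < s <= t ->
  0 <= c / (t + l) <= c / (s + l).
Proof.
move=> c0 l0 /andP[s0 st]; have t0 := lt_le_trans s0 st.
rewrite divr_ge0 ?addr_ge0 ?(ltW c0) ?(ltW t0) ?(ltW l0) //= ler_pM2l //.
rewrite lef_pV2 ?posrE ?addr_gt0 //.
by rewrite lerD2r.
Qed.

Lemma resolvent2_mono c l s t : 0 < c -> 0 < l -> 0 < s <= t ->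
  0 <= c * l / (t + l) ^+ 2 <= c * l / (s + l) ^+ 2.
Proof.
move=> c0 l0 /andP[s0 st]; have t0 := lt_le_trans s0 st.
have sl : 0 < s + l by rewrite addr_gt0.
have tl : 0 < t + l by rewrite addr_gt0.
apply/andP; split.
  by apply: divr_ge0; [apply: mulr_ge0; exact: ltW|exact: sqr_ge0].
rewrite ler_pM2l ?mulr_gt0 //.
by rewrite lef_pV2 ?posrE ?exprn_gt0 // ler_sqr ?nnegrE ?(ltW sl) ?(ltW tl) // lerD2r.
Qed.

Lemma resolvent2_le c l t : 0 < c -> 0 < l -> 0 < t ->
  c * l / (t + l) ^+ 2 <= c / (t + l).
Proof.
move=> c0 l0 t0; have tl : 0 < t + l by rewrite addr_gt0.
rewrite -subr_ge0; have -> : c / (t + l) - c * l / (t + l) ^+ 2 = c * t / (t + l) ^+ 2.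
  by field; rewrite gt_eqF.
by apply: divr_ge0; [apply: mulr_ge0; exact: ltW|exact: sqr_ge0].
Qed.

(* The tangent-line inequality of the concave function [t / (t + l)]. *)
Lemma resolvent_concave c l x y : 0 < c -> 0 < l -> 0 < x -> 0 < y ->
  y * (c / (y + l)) - x * (c / (x + l)) <= c * l / (x + l) ^+ 2 * (y - x).
Proof.
move=> c0 l0 x0 y0; have xl : 0 < x + l by rewrite addr_gt0.
have yl : 0 < y + l by rewrite addr_gt0.
rewrite -subr_ge0.
have -> : c * l / (x + l) ^+ 2 * (y - x) -
    (y * (c / (y + l)) - x * (c / (x + l))) =
    c * l * (y - x) ^+ 2 / ((x + l) ^+ 2 * (y + l)).
  by field; rewrite !gt_eqF.
apply: divr_ge0; apply: mulr_ge0; rewrite ?sqr_ge0 ?(ltW yl) //.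
by apply: mulr_ge0; exact: ltW.
Qed.

End ResolventSums.

(** * The resolvent sum over the nodes u^j *)

Section GeometricGrid.
Variables (R : realType) (u p : R).
Hypotheses (u1 : 1 < u) (p0 : 0 < p) (p1 : p < 1).
Implicit Types (s t e : R).

Let v := u `^ p.
Let gam := u `^ (p - 1).
(** The upper terms decay like gam^j, because p < 1, and the lower ones like v^-j, because p > 0. *)
Let rho := Num.max gam v^-1.

Let u0 : 0 < u. Proof. exact: lt_trans ltr01 u1. Qed.
Let v0 : 0 < v. Proof. exact: powR_gt0. Qed.
Let v1 : 1 < v.
Proof.
rewrite /v [ltLHS](_ : 1 = 1 `^ p); last by rewrite powR1.
by rewrite gt0_ltr_powR ?nnegrE ?ler01 ?(ltW u0).
Qed.
Let gam0 : 0 < gam. Proof. exact: powR_gt0. Qed.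
Let gamE : gam = v / u.
Proof. by rewrite /gam powRB ?powRr1 ?(ltW u0) // (gt_eqF u0) implybT. Qed.
Let gam1 : gam < 1.
Proof.
rewrite /gam -opprB powRN invf_lt1 ?powR_gt0 //.
rewrite [ltLHS](_ : 1 = 1 `^ (1 - p)); last by rewrite powR1.
by rewrite gt0_ltr_powR ?nnegrE ?ler01 ?(ltW u0) // subr_gt0.
Qed.
Let rho0 : 0 < rho. Proof. by rewrite lt_max gam0. Qed.
Let rho1 : rho < 1. Proof. by rewrite gt_max gam1 invf_lt1. Qed.

Let a j t := v ^+ j / (t + u ^+ j).
Let b j t := v ^- j / (t + u ^- j).
(** [a'] and [b'] are the derivatives in t of [t * a j t] and [t * b j t]; their sum will play the
    derivative of the power. *)
Let a' j t := v ^+ j * u ^+ j / (t + u ^+ j) ^+ 2.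
Let b' j t := v ^- j * u ^- j / (t + u ^- j) ^+ 2.

Let vX j : 0 < v ^+ j. Proof. exact: exprn_gt0. Qed.
Let uX j : 0 < u ^+ j. Proof. exact: exprn_gt0. Qed.
Let vV j : 0 < v ^- j. Proof. by rewrite invr_gt0. Qed.
Let uV j : 0 < u ^- j. Proof. by rewrite invr_gt0. Qed.

Let res_scale c l t : 0 < l -> 0 < t -> v * c / (u * t + u * l) = gam * (c / (t + l)).
Proof.
by move=> l0 t0; rewrite gamE -mulrDr; field; rewrite !gt_eqF // addr_gt0.
Qed.
Let res2_scale c l t : 0 < l -> 0 < t ->
  v * c * (u * l) / (u * t + u * l) ^+ 2 = gam * (c * l / (t + l) ^+ 2).
Proof.
by move=> l0 t0; rewrite gamE -mulrDr; field; rewrite !gt_eqF // addr_gt0.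
Qed.
Let XVS (x : R) j : 0 < x -> x ^- j = x * x ^- j.+1.
Proof. by move=> x0; rewrite exprS; field; rewrite !expf_neq0 ?gt_eqF. Qed.

Let aS j t : 0 < t -> a j.+1 (u * t) = gam * a j t.
Proof. by move=> t0; rewrite /a !exprS res_scale. Qed.
Let bS j t : 0 < t -> b j (u * t) = gam * b j.+1 t.
Proof. by move=> t0; rewrite /b (XVS j u0) (XVS j v0) res_scale. Qed.
Let a'S j t : 0 < t -> a' j.+1 (u * t) = gam * a' j t.
Proof. by move=> t0; rewrite /a' [v ^+ j.+1]exprS [u ^+ j.+1]exprS res2_scale. Qed.
Let b'S j t : 0 < t -> b' j (u * t) = gam * b' j.+1 t.
Proof. by move=> t0; rewrite /b' (XVS j u0) (XVS j v0) res2_scale. Qed.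

Let a0E t : a 0%N t = b 0%N t.
Proof. by rewrite /a /b !expr0 invr1. Qed.
Let a'0E t : a' 0%N t = b' 0%N t.
Proof. by rewrite /a' /b' !expr0 invr1. Qed.

Let a_mono j s t : 0 < s <= t -> 0 <= a j t <= a j s.
Proof. exact: resolvent_mono. Qed.
Let b_mono j s t : 0 < s <= t -> 0 <= b j t <= b j s.
Proof. exact: resolvent_mono. Qed.
Let a'_mono j s t : 0 < s <= t -> 0 <= a' j t <= a' j s.
Proof. exact: resolvent2_mono. Qed.
Let b'_mono j s t : 0 < s <= t -> 0 <= b' j t <= b' j s.
Proof. exact: resolvent2_mono. Qed.

Let a_bound j t : 0 < t -> a j t <= (1 + t^-1) * rho ^+ j.
Proof.
move=> t0; apply: (@le_trans _ _ (gam ^+ j)).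
  rewrite gamE expr_div_n ler_pM2l // lef_pV2 ?posrE ?addr_gt0 //.
  by rewrite lerDr ltW.
apply: (@le_trans _ _ (rho ^+ j)).
  by rewrite lerXn2r ?nnegrE ?(ltW gam0) ?(ltW rho0) // le_max lexx.
by rewrite ler_peMl ?exprn_ge0 ?(ltW rho0) // lerDl invr_ge0 ltW.
Qed.
Let b_bound j t : 0 < t -> b j t <= (1 + t^-1) * rho ^+ j.
Proof.
move=> t0; apply: (@le_trans _ _ (t^-1 * v^-1 ^+ j)).
  rewrite /b exprVn [leLHS]mulrC ler_pM2r // lef_pV2 ?posrE ?addr_gt0 //.
  by rewrite lerDl ltW.
apply: (@le_trans _ _ (t^-1 * rho ^+ j)).
  rewrite ler_pM2l ?invr_gt0 //.
  by rewrite lerXn2r ?nnegrE ?invr_ge0 ?(ltW v0) ?(ltW rho0) // le_max lexx orbT.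
by rewrite ler_wpM2r ?exprn_ge0 ?(ltW rho0) // lerDr.
Qed.
Let a'_bound j t : 0 < t -> a' j t <= (1 + t^-1) * rho ^+ j.
Proof. by move=> t0; apply: le_trans (a_bound j t0); apply: resolvent2_le. Qed.
Let b'_bound j t : 0 < t -> b' j t <= (1 + t^-1) * rho ^+ j.
Proof. by move=> t0; apply: le_trans (b_bound j t0); apply: resolvent2_le. Qed.

Let Q := scal_lim a b.
Let D := scal_lim a' b'.

Let Q_gt0 : 0 < Q 1.
Proof.
apply: (scal_lim_gt0 rho0 rho1 a_mono b_mono a_bound b_bound) => t t0.
by rewrite /a !expr0 divr_gt0 // addr_gt0.
Qed.
Let D_gt0 : 0 < D 1.
Proof.
apply: (scal_lim_gt0 rho0 rho1 a'_mono b'_mono a'_bound b'_bound) => t t0.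
by rewrite /a' !expr0 divr_gt0 ?exprn_gt0 ?mulr_gt0 // addr_gt0.
Qed.

Let Q_near := scal_lim_near rho0 rho1 a_mono b_mono a_bound b_bound.
Let D_near := scal_lim_near rho0 rho1 a'_mono b'_mono a'_bound b'_bound.

Let Q_scale t : 0 < t -> Q (u * t) = gam * Q t.
Proof. exact: (scal_lim_scale u0 gam0 rho0 rho1 aS bS a0E a_mono b_mono a_bound b_bound). Qed.
Let D_scale t : 0 < t -> D (u * t) = gam * D t.
Proof.
exact: (scal_lim_scale u0 gam0 rho0 rho1 a'S b'S a'0E a'_mono b'_mono a'_bound b'_bound).
Qed.

Let Q_law t : 0 < t -> Q 1 * t `^ (p - 1) * gam <= Q t <= Q 1 * t `^ (p - 1) / gam.
Proof.
apply: (power_law u1 p1) => //.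
by move=> s' t' st; apply: (scal_lim_mono rho0 rho1 a_mono b_mono a_bound b_bound).
Qed.
Let D_law t : 0 < t -> D 1 * t `^ (p - 1) * gam <= D t <= D 1 * t `^ (p - 1) / gam.
Proof.
apply: (power_law u1 p1) => //.
by move=> s' t' st; apply: (scal_lim_mono rho0 rho1 a'_mono b'_mono a'_bound b'_bound).
Qed.

Let sum_concave n x y : 0 < x -> 0 < y ->
  y * scal_sum a b n y - x * scal_sum a b n x <= scal_sum a' b' n x * (y - x).
Proof.
move=> x0 y0; rewrite /scal_sum !mulr_sumr mulr_suml -sumrB; apply: ler_sum => j _.
by rewrite [y * _]mulrDr [x * _]mulrDr mulrDl opprD addrACA lerD //; exact: resolvent_concave.
Qed.

Let lim_concave x y : 0 < x -> 0 < y -> y * Q y - x * Q x <= D x * (y - x).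
Proof.
move=> x0 y0; apply/ler_addgt0Pr => e e0.
(* The weights with which the errors of Q at x, of Q at y and of D at x enter. *)
pose K := x + y + `|y - x|.
have K0 : 0 < K by rewrite ltr_pwDl // addr_gt0.
have d0 : 0 < e / K by rewrite divr_gt0.
have [N1 h1] := Q_near x0 d0; have [N2 h2] := Q_near y0 d0.
have [N3 h3] := D_near x0 d0; pose n := maxn N1 (maxn N2 N3).
have := h1 n (leq_maxl _ _) x (lexx _).
have := h2 n (leq_trans (leq_maxl _ _) (leq_maxr _ _)) y (lexx _).
have := h3 n (leq_trans (leq_maxr _ _) (leq_maxr _ _)) x (lexx _).
rewrite -/Q -/D => e3 e2 e1; have := sum_concave n x0 y0.
have -> : e = x * (e / K) + y * (e / K) + `|y - x| * (e / K).
  by rewrite -!mulrDl mulrC divfK // gt_eqF.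
have f1 : `|x * (scal_sum a b n x - Q x)| <= x * (e / K).
  by rewrite normrM gtr0_norm // ler_pM2l.
have f2 : `|y * (scal_sum a b n y - Q y)| <= y * (e / K).
  by rewrite normrM gtr0_norm // ler_pM2l.
have f3 : `|(scal_sum a' b' n x - D x) * (y - x)| <= `|y - x| * (e / K).
  by rewrite normrM mulrC ler_wpM2l.
move: f1 f2 f3; rewrite !ler_norml => /andP[? ?] /andP[? ?] /andP[? ?].
lra.
Qed.

(** Q and D follow power laws with constants unrelated so far. Since D is a supergradient of t Q(t),
    testing it at 1 and u, where u Q(u) = v Q(1), compares D 1 with Q 1 (v - 1) / (u - 1), and
    Bernoulli places this quotient (v - 1) / (u - 1) between p gam and p. *)
Let D_Q : p * Q 1 * gam <= D 1 <= p * Q 1 / gam.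
Proof.
have u10 : 0 < u - 1 by rewrite subr_gt0.
have uQ : u * Q u = v * Q 1.
  by have := Q_scale ltr01; rewrite mulr1 => ->; rewrite gamE mulrA mulrCA divff ?mulr1 ?gt_eqF.
have Du : D u = gam * D 1 by have := D_scale ltr01; rewrite mulr1.
have c1 := lim_concave ltr01 u0; have c2 := lim_concave u0 ltr01.
rewrite uQ mul1r in c1 c2; rewrite Du in c2.
have b1 := powR_bernoulli p0 p1 u0; rewrite -/v in b1.
have uV0 : 0 < u^-1 by rewrite invr_gt0.
have b2 := powR_bernoulli p0 p1 uV0.
(* Bernoulli at 1/u, multiplied by v = u^p, bounds v from below. *)
have {}b2 : 1 <= v + p * gam * (1 - u).
  have e : v * u^-1 `^ p = 1.
    by rewrite /v -powRM ?(ltW u0) ?(ltW uV0) // mulfV ?gt_eqF // powR1.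
  have : v * u^-1 `^ p <= v * (1 + p * (u^-1 - 1)) by rewrite ler_pM2l.
  rewrite e gamE => /le_trans; apply; rewrite le_eqVlt; apply/orP; left.
  by apply/eqP; field; rewrite gt_eqF.
apply/andP; split.
  rewrite -(ler_pM2r u10); apply: le_trans c1.
  have -> : v * Q 1 - Q 1 = (v - 1) * Q 1 by ring.
  have -> : p * Q 1 * gam * (u - 1) = (p * gam * (u - 1)) * Q 1 by ring.
  by rewrite ler_pM2r //; lra.
rewrite ler_pdivlMr // -(ler_pM2r u10); apply: (@le_trans _ _ ((v - 1) * Q 1)).
  by lra.
have -> : p * Q 1 * (u - 1) = p * (u - 1) * Q 1 by ring.
by rewrite ler_pM2r //; lra.
Qed.

(** Pairs of weight and node; dividing by [Q 1] gives the limiting power t^(p-1) coefficient about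
    1. *)
Let grid (n : nat) : seq (R * R) :=
  [seq (v ^+ (j : 'I_n) / Q 1, u ^+ j) | j <- index_enum 'I_n] ++
  [seq (v ^- (j : 'I_n).+1 / Q 1, u ^- j.+1) | j <- index_enum 'I_n].

Let grid_gt0 n z : z \in grid n -> 0 < z.1 /\ 0 < z.2.
Proof.
rewrite mem_cat => /orP[] /mapP[j _ ->] /=; split=> //; exact: divr_gt0.
Qed.

Let grid_sum n t : \sum_(z <- grid n) z.1 / (t + z.2) = scal_sum a b n t / Q 1.
Proof.
rewrite big_cat !big_map /scal_sum big_split /= mulrDl !mulr_suml.
by congr (_ + _); apply: eq_bigr => j _; rewrite mulrAC.
Qed.

Let grid_sum2 n t :
  \sum_(z <- grid n) z.1 * z.2 / (t + z.2) ^+ 2 = scal_sum a' b' n t / Q 1.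
Proof.
rewrite big_cat !big_map /scal_sum big_split /= mulrDl !mulr_suml.
by congr (_ + _); apply: eq_bigr => j _; rewrite ?/a' ?/b'; ring.
Qed.

(** The derivative sum loses a factor [gam] twice, in its power law and in the ratio of the
    constants; hence the square in the condition on [gam]. *)
Lemma geometric_grid_approx (d s : R) : 0 < s -> 0 < d ->
  gam^-1 ^+ 2 <= 1 + d ->
  exists l : seq (R * R), (forall z, z \in l -> 0 < z.1 /\ 0 < z.2) /\
   forall t, s <= t ->
     `|\sum_(z <- l) z.1 / (t + z.2) - t `^ (p - 1)| <= d * (1 + t `^ (p - 1)) /\
     `|\sum_(z <- l) z.1 * z.2 / (t + z.2) ^+ 2 - p * t `^ (p - 1)| <=
       d * (1 + t `^ (p - 1)).
Proof.
move=> s0 d0 gd; have dQ : 0 < d * Q 1 by rewrite mulr_gt0.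
have [N1 h1] := Q_near s0 dQ; have [N2 h2] := D_near s0 dQ.
pose n := maxn N1 N2; exists (grid n); split=> [z|t st]; first exact: grid_gt0.
have t0 := lt_le_trans s0 st; rewrite grid_sum grid_sum2.
have {}h1 := h1 n (leq_maxl _ _) t st; have {}h2 := h2 n (leq_maxr _ _) t st.
have kg : gam * gam^-1 = 1 by rewrite divff ?gt_eqF.
have k0 : 0 < gam^-1 by rewrite invr_gt0.
have k1 : 1 < gam^-1 by rewrite invf_gt1.
have w0 : 0 < t `^ (p - 1) by rewrite powR_gt0.
have g2 : 0 < gam ^+ 2 by rewrite exprn_gt0.
have gd1 : 1 - d <= gam ^+ 2 by nra.
have gd2 : gam^-1 <= 1 + d by nra.
have gd3 : 1 - d <= gam by nra.
have Q1' : Q 1 != 0 by rewrite gt_eqF.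
have q1 : `|scal_sum a b n t / Q 1 - Q t / Q 1| <= d.
  by rewrite -mulrBl normrM [`|(Q 1)^-1|]gtr0_norm ?invr_gt0 // ler_pdivrMr.
have q2 : `|scal_sum a' b' n t / Q 1 - D t / Q 1| <= d.
  by rewrite -mulrBl normrM [`|(Q 1)^-1|]gtr0_norm ?invr_gt0 // ler_pdivrMr.
have r1 : `|Q t / Q 1 - t `^ (p - 1)| <= d * t `^ (p - 1).
  have /andP[l1 l2] := Q_law t0; rewrite ler_norml; apply/andP; split.
    rewrite lerBrDr ler_pdivlMr //; apply: le_trans l1.
    have -> : (- (d * t `^ (p - 1)) + t `^ (p - 1)) * Q 1 =
      Q 1 * t `^ (p - 1) * (1 - d) by ring.
    by rewrite ler_pM2l // mulr_gt0.
  rewrite lerBlDr ler_pdivrMr //; apply: le_trans l2 _.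
  have -> : (d * t `^ (p - 1) + t `^ (p - 1)) * Q 1 =
      Q 1 * t `^ (p - 1) * (1 + d) by ring.
  by rewrite ler_pM2l // mulr_gt0.
have r2 : `|D t / Q 1 - p * t `^ (p - 1)| <= d * t `^ (p - 1).
  have pw : 0 < Q 1 * t `^ (p - 1) by rewrite mulr_gt0.
  have /andP[l1 l2] := D_law t0; have /andP[l3 l4] := D_Q.
  have l5 : Q 1 * t `^ (p - 1) * (p * gam ^+ 2) <= D t.
    apply: le_trans l1; have -> : Q 1 * t `^ (p - 1) * (p * gam ^+ 2) =
      (p * Q 1 * gam) * (t `^ (p - 1) * gam) by ring.
    by rewrite -[leRHS]mulrA ler_pM2r // mulr_gt0.
  have l6 : D t <= Q 1 * t `^ (p - 1) * (p * gam^-1 ^+ 2).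
    apply: (le_trans l2); have -> : Q 1 * t `^ (p - 1) * (p * gam^-1 ^+ 2) =
      (p * Q 1 / gam) * (t `^ (p - 1) / gam) by ring.
    by rewrite -[leLHS]mulrA ler_pM2r // divr_gt0.
  have pd : p * d <= d by rewrite ler_piMl ?(ltW d0) ?(ltW p1).
  have g4 : p * (1 - d) <= p * gam ^+ 2 by rewrite ler_pM2l.
  have g5 : p * gam^-1 ^+ 2 <= p * (1 + d) by rewrite ler_pM2l.
  rewrite ler_norml; apply/andP; split.
    rewrite lerBrDr ler_pdivlMr //; apply: le_trans l5.
    have -> : (- (d * t `^ (p - 1)) + p * t `^ (p - 1)) * Q 1 =
      Q 1 * t `^ (p - 1) * (p - d) by ring.
    by rewrite ler_pM2l //; lra.
  rewrite lerBlDr ler_pdivrMr //; apply: le_trans l6 _.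
  have -> : (d * t `^ (p - 1) + p * t `^ (p - 1)) * Q 1 =
      Q 1 * t `^ (p - 1) * (p + d) by ring.
  by rewrite ler_pM2l //; lra.
move: q1 q2 r1 r2; rewrite !ler_norml => /andP[? ?] /andP[? ?] /andP[? ?] /andP[? ?].
by split; apply/andP; split; lra.
Qed.

End GeometricGrid.

Section PowerApproximation.
Variable R : realType.

(* With [u `^ (1 - p) = sqrt (1 + d)] the grid of ratio [u] reproduces powers up
   to the relative error [d]. *)
Lemma resolvent_sum_approx (p s L e : R) : 0 < p < 1 -> 0 < s -> 0 < e ->
  exists l : seq (R * R), (forall z, z \in l -> 0 < z.1 /\ 0 < z.2) /\
   forall t, s <= t <= L ->
     `|\sum_(z <- l) z.1 / (t + z.2) - t `^ (p - 1)| <= e /\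
     `|\sum_(z <- l) z.1 * z.2 / (t + z.2) ^+ 2 - p * t `^ (p - 1)| <= e.
Proof.
move=> /andP[p0 p1] s0 e0; pose w := s `^ (p - 1).
(* On [s, oo) the power t^(p-1) is at most w, so dividing e by 1 + w turns the error d (1 + t^(p-1))
   into at most e. *)
have w0 : 0 < w by rewrite powR_gt0.
pose d := e / (1 + w); have d0 : 0 < d by rewrite divr_gt0 ?addr_gt0.
pose u := (1 + d) `^ (2^-1 / (1 - p)).
have q0 : 0 < 1 - p by rewrite subr_gt0.
have d1 : 1 < 1 + d by rewrite ltrDl.
have u1 : 1 < u.
  rewrite [ltLHS](_ : 1 = 1 `^ (2^-1 / (1 - p))); last by rewrite powR1.
  by rewrite gt0_ltr_powR ?nnegrE ?ler01 ?(ltW (lt_trans ltr01 d1)) // divr_gt0 ?invr_gt0.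
have gd : (u `^ (p - 1))^-1 ^+ 2 <= 1 + d.
  rewrite -powRN -powR_mulrn ?powR_ge0 // -!powRrM.
  rewrite [X in _ `^ X](_ : _ = 1) ?powRr1 ?(ltW (lt_trans ltr01 d1)) //.
  by field; rewrite gt_eqF.
have [l [l0 hl]] := geometric_grid_approx u1 p0 p1 s0 d0 gd.
exists l; split=> // t /andP[st tL]; have [h1 h2] := hl t st.
have de : d * (1 + t `^ (p - 1)) <= e.
  rewrite -[leRHS](divfK (_ : 1 + w != 0)) ?gt_eqF ?addr_gt0 // ler_pM2l // lerD2l.
  have -> : p - 1 = - (1 - p) by rewrite opprB.
  rewrite /w -[p - 1]opprB !powRN lef_pV2 ?posrE ?powR_gt0 ?(lt_le_trans s0 st) //.
  by rewrite ge0_ler_powR ?nnegrE ?(ltW s0) ?(ltW (lt_le_trans s0 st)) // ltW.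
by split; [exact: le_trans h1 de|exact: le_trans h2 de].
Qed.

End PowerApproximation.

(** * Trace inequalities *)

Section PowerFunctions.
Variable R : realType.
Implicit Types (c e t L s p : R) (l : seq (R * R)).

(** A ratio z in [0, 1] satisfies z <= z^s; this is applied to x / (x + y) and y / (x + y), which
    add up to 1. *)
Lemma powR_subadditive s x y : 0 < s <= 1 -> 0 <= x -> 0 <= y ->
  (x + y) `^ s <= x `^ s + y `^ s.
Proof.
move=> /andP[s0 s1] x0 y0.
have [xy0|xy0] := eqVneq (x + y) 0.
  by rewrite xy0 powR0 ?gt_eqF // addr_ge0 ?powR_ge0.
have xy1 : 0 < x + y by rewrite lt_def xy0 addr_ge0.
have h z : 0 <= z -> z <= x + y -> z / (x + y) * (x + y) `^ s <= z `^ s.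
  move=> z0 zxy; have -> : z `^ s = (z / (x + y)) `^ s * (x + y) `^ s.
    by rewrite -powRM ?divfK ?divr_ge0 // ltW.
  rewrite ler_wpM2r ?powR_ge0 //; have [->|zn0] := eqVneq z 0.
    by rewrite mul0r powR_ge0.
  have q0 : 0 < z / (x + y) by rewrite divr_gt0 // lt_def zn0.
  have q1 : z / (x + y) <= 1 by rewrite ler_pdivrMr // mul1r.
  by rewrite -[leLHS]powRr1 ?(ltW q0) // ger_powR // q0.
have -> : (x + y) `^ s = (x / (x + y) + y / (x + y)) * (x + y) `^ s.
  by rewrite -mulrDl divff // mul1r.
by rewrite mulrDl lerD ?h // ?lerDl ?lerDr.
Qed.

Lemma papprox_seq (r : seq (R * R)) (F : R * R -> R -> R) :
  (forall z, z \in r -> papprox (F z)) -> papprox (fun t => \sum_(z <- r) F z t).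
Proof.
elim: r => [|z r IH] pF.
  by apply: papprox_ext (papprox_cst 0) => t _; rewrite big_nil.
have pz : papprox (F z) by apply: pF; rewrite mem_head.
have pr : papprox (fun t => \sum_(z <- r) F z t).
  by apply: IH => w wr; apply: pF; rewrite in_cons wr orbT.
by apply: papprox_ext (papproxD pz pr) => t _; rewrite big_cons.
Qed.

(** The shift keeps the argument at or above c, away from the singularity of the negative power. *)
Lemma papprox_powR_shift p c : 0 < p < 1 -> 0 < c ->
  papprox (fun t => (t + c) `^ (p - 1)).
Proof.
move=> p01 c0; apply: papprox_limit => L e e0.
have [l [l0 hl]] := resolvent_sum_approx (L + c) p01 c0 e0.
exists (fun t => \sum_(z <- l) z.1 * (t + (c + z.2))^-1).
  apply: papprox_seq => z zl; apply: papproxZ; apply: papprox_inv.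
  by rewrite addr_gt0 //; have [] := l0 z zl.
move=> t /andP[t0 tL]; have [|h _] := hl (t + c); first by rewrite lerDr t0 lerD2r.
by under eq_bigr => z _ do rewrite addrA.
Qed.

Lemma papprox_powR_shift1 p c : 0 < p < 1 -> 0 < c ->
  papprox (fun t => (t + c) `^ p).
Proof.
move=> p01 c0; have /andP[p0 _] := p01.
have pX : papprox (fun t => t + c).
  by apply: papprox_ext (papprox_horner ('X + c%:P)) => t _; rewrite !hornerE.
apply: papprox_ext (papproxM pX (papprox_powR_shift p01 c0)) => t t0.
by rewrite mulr_powRB1 // addr_ge0 // ltW.
Qed.

Lemma powR_small s e : 0 < s -> 0 < e -> exists2 c, 0 < c & c `^ s <= e.
Proof.
move=> s0 e0; exists (e `^ s^-1); first exact: powR_gt0.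
by rewrite -powRrM mulVf ?gt_eqF // powRr1 // ltW.
Qed.

(** By subadditivity (t + c)^s exceeds t^s by at most c^s, uniformly in t, so the shift can be
    removed in the limit. *)
Lemma papprox_powR s : 0 < s <= 1 -> papprox (fun t => t `^ s).
Proof.
move=> s01; have /andP[s0] := s01; rewrite le_eqVlt => /orP[/eqP->|s1].
  by apply: papprox_ext (papprox_horner 'X) => t t0; rewrite hornerX powRr1.
apply: papprox_limit => L e e0; have [c c0 ce] := powR_small s0 e0.
exists (fun t => (t + c) `^ s); first by apply: papprox_powR_shift1; rewrite ?s0.
move=> t /andP[t0 _]; rewrite ger0_norm.
  by have := powR_subadditive s01 t0 (ltW c0); lra.
rewrite subr_ge0 ge0_ler_powR ?nnegrE ?(ltW s0) // ?lerDl ?(ltW c0) //.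
by rewrite addr_ge0 // ltW.
Qed.

End PowerFunctions.

(** * Antitonicity and Klein's inequality under the trace *)

Section TraceInequalities.
Variables (R : realType) (H : hilbertSpace R) (M : set (H -> H)).
Variable tau : (H -> H) -> R[i].
Hypotheses (vM : von_neumann_algebra M) (tM : normal_faithful_tracial_state M tau).
Implicit Types (a b x y A B X : H -> H) (c e t p : R) (f g : R -> R).

Local Notation rtr := (real_trace tau).

Let sqrt_approx : papprox (fun t : R => t `^ 2^-1).
Proof. by apply: papprox_powR; rewrite invr_gt0 ltr0n invf_le1 // ler1n. Qed.

Lemma rtr_fun_calc_le f g A x : M A -> positive_op A -> M x -> positive_op x ->
  papprox f -> papprox g -> (forall t, 0 <= t <= opnorm A -> f t <= g t) ->
  rtr (fun_calc f A \o x) <= rtr (fun_calc g A \o x).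
Proof.
move=> MA pA Mx px pf pg fg; rewrite -subr_ge0 -(rtrB vM tM); last first.
- by apply: vnM => //; apply: vn_fun_calc.
- by apply: vnM => //; apply: vn_fun_calc.
have -> : (fun_calc g A \o x) - (fun_calc f A \o x) =
    fun_calc (fun t => g t - f t) A \o x by rewrite fun_calcB.
have pfg := papproxB pg pf.
apply: (rtrM_ge0 vM tM sqrt_approx) => //; first exact: vn_fun_calc.
by apply: fun_calc_ge0 => // t tA; rewrite subr_ge0 fg.
Qed.

Lemma rtr_fun_calcD f c A x : M A -> positive_op A -> M x -> papprox f ->
  rtr (fun_calc (fun t => f t + c) A \o x) = rtr (fun_calc f A \o x) + c * rtr x.
Proof.
move=> MA pA Mx pf; rewrite fun_calcD //; last exact: papprox_cst.
rewrite fun_calc_cst // -(rtrZ vM tM) // -(rtrD tM) //; last exact: vnZ.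
by apply: vnM => //; apply: vn_fun_calc.
Qed.

Lemma rtr_fun_calc_near f g e A x : M A -> positive_op A -> M x -> positive_op x ->
  papprox f -> papprox g -> (forall t, 0 <= t <= opnorm A -> `|f t - g t| <= e) ->
  rtr (fun_calc f A \o x) <= rtr (fun_calc g A \o x) + e * rtr x.
Proof.
move=> MA pA Mx px pf pg fg; rewrite -rtr_fun_calcD //.
apply: rtr_fun_calc_le => //; first exact/papproxD/papprox_cst.
by move=> t tA; have := fg t tA; rewrite ler_norml => /andP[]; lra.
Qed.

Definition resolvent c A := fun_calc (fun t => (t + c)^-1) A.

Lemma resolventK c A : 0 < c -> positive_op A -> forall h,
  resolvent c A (A h + c%:C *: h) = h /\
  A (resolvent c A h) + c%:C *: resolvent c A h = h.
Proof.
move=> c0 pA h; have pI := papprox_inv c0.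
have pX : papprox (fun t => t + c).
  by apply: papprox_ext (papprox_horner ('X + c%:P)) => t _; rewrite !hornerE.
have XE : fun_calc (fun t => t + c) A = A + c%:C *: idfun.
  rewrite fun_calcD ?fun_calc_id ?fun_calc_cst //; last exact: papprox_cst.
  by apply: papprox_ext (papprox_horner 'X) => t _; rewrite hornerX.
have one (f : R -> R) : papprox f -> (forall t, 0 <= t -> f t = 1) ->
    fun_calc f A = idfun.
  move=> pf f1; rewrite -(scale1r idfun) -(rmorph1 (real_complex R)) -(fun_calc_cst 1 pA).
  apply: fun_calc_ext => //; first exact: papprox_cst.
  by move=> t /andP[t0 _]; exact: f1.
have ne t : 0 <= t -> t + c != 0 by move=> t0; rewrite gt_eqF // ltr_wpDl.
split.
  have := fun_calcM pA pI pX; rewrite one ?XE; last 2 first.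
  - exact: papproxM.
  - by move=> t t0; rewrite mulVf ?ne.
  by move=> /(congr1 (@^~ h)).
have := fun_calcM pA pX pI; rewrite one ?XE; last 2 first.
- exact: papproxM.
- by move=> t t0; rewrite mulfV ?ne.
by move=> /(congr1 (@^~ h)).
Qed.

Lemma resolvent_positive c A : 0 < c -> positive_op A -> positive_op (resolvent c A).
Proof.
move=> c0 pA; apply: fun_calc_ge0 => //; first exact: papprox_inv.
by move=> t /andP[t0 _]; rewrite invr_ge0 addr_ge0 // ltW.
Qed.

(** In this arrangement one positivity serves twice: the subtracted sandwich is positive when A >=
    B, which gives antitonicity, and its trace is the tangent term of Klein's inequality. *)
Lemma resolvent_gap c A B : 0 < c -> positive_op A -> positive_op B ->
  positive_op (resolvent c B - resolvent c A
    - (resolvent c A \o (A - B) \o resolvent c A)).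
Proof.
move=> c0 pA pB; have pa := resolvent_positive c0 pA.
have pb := resolvent_positive c0 pB.
have pBc : positive_op (B + c%:C *: idfun).
  by apply: positive_opD => //; apply/positive_opZ/positive_op1/ltW.
(* The operator B + c between two copies of the difference of resolvents; what remains is to
   identify it with the claimed expression. *)
have := positive_op_sandwich
  (bounded_opB (positive_bounded pb) (positive_bounded pa))
  (symmB (positive_symm pb) (positive_symm pa)) pBc.
congr positive_op; apply/funext => h.
have [KA1 KA2] := resolventK c0 pA (resolvent c A h).
have [_ KA3] := resolventK c0 pA h.
have [_ KB1] := resolventK c0 pB h.
have [KB2 _] := resolventK c0 pB (resolvent c A h).
have [KB3 _] := resolventK c0 pB (resolvent c B h).
have lA := positive_linear pa; have lB := positive_linear pb.
have la := positive_linear pA; have lb := positive_linear pB.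
rewrite !fctE /=.
set u := resolvent c A h in KA1 KA2 KA3 KB2 *.
set v := resolvent c B h in KB1 KB3 *.
have -> : B (v - u) + c%:C *: (v - u) = h - (B u + c%:C *: u).
  by rewrite (linopB _ _ lb) scalerBr addrACA KB1 -opprD.
rewrite (linopB _ _ lB) (linopB _ _ lA) KB2 -/u -/v.
have -> : A u - B u = h - (B u + c%:C *: u).
  by rewrite -[in RHS]KA3 opprD addrACA subrr addr0.
rewrite (linopB _ _ lA) -/u.
by rewrite addrAC.
Qed.

(** Testing against positive x of M reduces operator inequalities to real numbers, which pass to
    limits. Approximability is bundled in because it guarantees that [fun_calc g] is the intended
    operator and not a default. *)
Definition trace_antitone g := papprox g /\
  forall A B x, M A -> positive_op A -> M B -> positive_op B ->
    M x -> positive_op x -> positive_op (A - B) ->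
    rtr (fun_calc g A \o x) <= rtr (fun_calc g B \o x).

Lemma trace_antitone_inv c : 0 < c -> trace_antitone (fun t => (t + c)^-1).
Proof.
move=> c0; have pI := papprox_inv c0; split=> // A B x MA pA MB pB Mx px pAB.
rewrite -subr_ge0 -(rtrB vM tM); try by apply: vnM => //; apply: vn_fun_calc.
have -> : (fun_calc (fun t => (t + c)^-1) B \o x) -
    (fun_calc (fun t => (t + c)^-1) A \o x) =
    (resolvent c B - resolvent c A) \o x by [].
apply: (rtrM_ge0 vM tM sqrt_approx) => //.
  by apply: vnB => //; apply: vn_fun_calc.
rewrite -(subrK (resolvent c A \o (A - B) \o resolvent c A)
  (resolvent c B - resolvent c A)).
apply: positive_opD; first exact: resolvent_gap.
have pa := resolvent_positive c0 pA.
by apply: positive_op_sandwich => //; [exact: positive_bounded|exact: positive_symm].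
Qed.

Lemma trace_antitoneZ c g : 0 <= c -> trace_antitone g ->
  trace_antitone (fun t => c * g t).
Proof.
move=> c0 [pg hg]; split=> [|A B x MA pA MB pB Mx px pAB]; first exact: papproxZ.
have E A' : M A' -> positive_op A' ->
    rtr (fun_calc (fun t => c * g t) A' \o x) = c * rtr (fun_calc g A' \o x).
  move=> MA' pA'; rewrite fun_calcZ // -(rtrZ vM tM) //.
  by apply: vnM => //; apply: vn_fun_calc.
by rewrite !E // ler_wpM2l // hg.
Qed.

Lemma trace_antitoneD f g : trace_antitone f -> trace_antitone g ->
  trace_antitone (fun t => f t + g t).
Proof.
move=> [pf hf] [pg hg]; split=> [|A B x MA pA MB pB Mx px pAB]; first exact: papproxD.
have E A' : M A' -> positive_op A' -> rtr (fun_calc (fun t => f t + g t) A' \o x) =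
    rtr (fun_calc f A' \o x) + rtr (fun_calc g A' \o x).
  by move=> MA' pA'; rewrite fun_calcD // -(rtrD tM) //;
    apply: vnM => //; apply: vn_fun_calc.
by rewrite !E // lerD ?hf ?hg.
Qed.

Lemma trace_antitone_limit g :
  (forall L e, 0 < e -> exists2 g', trace_antitone g' &
     forall t, 0 <= t <= L -> `|g' t - g t| <= e) -> trace_antitone g.
Proof.
move=> hg; have pg : papprox g.
  by apply: papprox_limit => L e e0; have [g' [pg' _] gg'] := hg L e e0; exists g'.
split=> // A B x MA pA MB pB Mx px pAB; apply/ler_addgt0Pr => e e0.
have rx := rtr_ge0 tM Mx px.
(* The replacement of g is paid twice, each time with weight tau(x); the 1 keeps the denominator
   positive. *)
pose d := e / (2 * rtr x + 1).
have d0 : 0 < d by rewrite divr_gt0 // ltr_wpDl // mulr_ge0.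
have [g' [pg' hg'] gg'] := hg (Num.max (opnorm A) (opnorm B)) d d0.
have n1 : rtr (fun_calc g A \o x) <= rtr (fun_calc g' A \o x) + d * rtr x.
  apply: rtr_fun_calc_near => // t /andP[t0 tA]; rewrite distrC gg' // t0 /=.
  by rewrite le_max tA.
have n2 : rtr (fun_calc g' B \o x) <= rtr (fun_calc g B \o x) + d * rtr x.
  apply: rtr_fun_calc_near => // t /andP[t0 tA]; rewrite gg' // t0 /=.
  by rewrite le_max tA orbT.
have n3 := hg' A B x MA pA MB pB Mx px pAB.
have de : d * (2 * rtr x + 1) = e by rewrite divfK // gt_eqF // ltr_wpDl // mulr_ge0.
by nra.
Qed.

(* The trace form of the tangent-line inequality of a concave function [f] with
   derivative [g]. *)
Definition klein f g := [/\ papprox f, papprox g &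
  forall A X, M A -> positive_op A -> M X -> positive_op X ->
    rtr (fun_calc f X) <= rtr (fun_calc f A) + rtr (fun_calc g A \o X)
      - rtr (fun_calc g A \o A)].

Lemma klein_cst c : klein (fun=> c) (fun=> 0).
Proof.
split=> [||A X MA pA MX pX]; try exact: papprox_cst.
by rewrite !fun_calc_cst // scale0r addrK.
Qed.

Lemma klein_ext f g f' g' : (forall t, 0 <= t -> f t = f' t) ->
  (forall t, 0 <= t -> g t = g' t) -> klein f g -> klein f' g'.
Proof.
move=> ff' gg' [pf pg fg]; have pf' := papprox_ext ff' pf.
have pg' := papprox_ext gg' pg; split=> // A X MA pA MX pX.
have eX : fun_calc f' X = fun_calc f X.
  by apply: fun_calc_ext => // t /andP[t0 _]; rewrite ff'.
have eA : fun_calc f' A = fun_calc f A.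
  by apply: fun_calc_ext => // t /andP[t0 _]; rewrite ff'.
have eg : fun_calc g' A = fun_calc g A.
  by apply: fun_calc_ext => // t /andP[t0 _]; rewrite gg'.
by rewrite eX eA eg; exact: fg.
Qed.

Lemma kleinZ c f g : 0 <= c -> klein f g ->
  klein (fun t => c * f t) (fun t => c * g t).
Proof.
move=> c0 [pf pg fg]; split=> [||A X MA pA MX pX]; try exact: papproxZ.
have Mf B : M B -> positive_op B -> M (fun_calc f B) by move=> *; apply: vn_fun_calc.
have Mg : M (fun_calc g A) by apply: vn_fun_calc.
rewrite !fun_calcZ //.
have -> (y : H -> H) : (c%:C *: fun_calc g A) \o y = c%:C *: (fun_calc g A \o y) by [].
rewrite !(rtrZ vM tM) //; try (by apply: Mf); try exact: vnM.
by have := ler_wpM2l c0 (fg A X MA pA MX pX); lra.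
Qed.

Lemma kleinD f g f' g' : klein f g -> klein f' g' ->
  klein (fun t => f t + f' t) (fun t => g t + g' t).
Proof.
move=> [pf pg fg] [pf' pg' fg']; split=> [||A X MA pA MX pX]; try exact: papproxD.
have Mg : M (fun_calc g A) by apply: vn_fun_calc.
have Mg' : M (fun_calc g' A) by apply: vn_fun_calc.
rewrite !fun_calcD //.
have -> (y : H -> H) : (fun_calc g A + fun_calc g' A) \o y =
  (fun_calc g A \o y) + (fun_calc g' A \o y) by [].
rewrite !(rtrD tM) //; try (by apply: vn_fun_calc); try exact: vnM.
by have := fg A X MA pA MX pX; have := fg' A X MA pA MX pX; lra.
Qed.

(** This is the trace of [resolvent_gap]: traciality brings the two resolvents of A together into
    their square, which is the derivative. *)
Lemma klein_inv c : 0 < c ->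
  klein (fun t => - (t + c)^-1) (fun t => (t + c)^-1 * (t + c)^-1).
Proof.
move=> c0; have pI := papprox_inv c0.
have pN : papprox (fun t => - (t + c)^-1).
  by apply: papprox_ext (papproxZ (-1) pI) => t _; rewrite mulN1r.
split=> // [|A X MA pA MX pX]; first exact: papproxM.
have Ma : M (resolvent c A) by apply: vn_fun_calc.
have Mx : M (resolvent c X) by apply: vn_fun_calc.
have E B : positive_op B -> fun_calc (fun t => - (t + c)^-1) B = - resolvent c B.
  move=> pB; rewrite -[RHS]scaleN1r -(rmorphN1 (real_complex R)) -fun_calcZ //.
  by congr fun_calc; apply/funext => t; rewrite mulN1r.
rewrite !E // !(rtrN vM tM) // fun_calcM // -/(resolvent c A).
have := rtr_ge0 tM _ (resolvent_gap c0 pA pX).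
rewrite !(rtrB vM tM) //; try by repeat first [exact: Ma|exact: Mx|apply: vnB|apply: vnM].
have -> : rtr (resolvent c A \o (A - X) \o resolvent c A) =
    rtr (resolvent c A \o resolvent c A \o A) - rtr (resolvent c A \o resolvent c A \o X).
  rewrite -(rtrC tM) //; last by repeat apply: vnM => //; apply: vnB.
  rewrite -(rtrB vM tM) //; try by repeat apply: vnM => //.
  congr rtr; apply/funext => h; rewrite !fctE /= .
  by rewrite !(linopB _ _ (vn_linear vM Ma)).
have H0 : M (resolvent c X - resolvent c A - (resolvent c A \o (A - X) \o resolvent c A)).
  by repeat first [exact: Ma|exact: Mx|apply: vnB => //|apply: vnM => //].
by move=> /(_ H0); lra.
Qed.

Lemma klein_limit f g :
  (forall L e, 0 < e -> exists f' g', klein f' g' /\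
     forall t, 0 <= t <= L -> `|f' t - f t| <= e /\ `|g' t - g t| <= e) ->
  klein f g.
Proof.
move=> hfg.
have pf : papprox f.
  apply: papprox_limit => L e e0; have [f' [g' [[pf' _ _] fg']]] := hfg L e e0.
  by exists f' => // t /fg'[].
have pg : papprox g.
  apply: papprox_limit => L e e0; have [f' [g' [[_ pg' _] fg']]] := hfg L e e0.
  by exists g' => // t /fg'[].
split=> // A X MA pA MX pX; apply/ler_addgt0Pr => e e0.
have rX := rtr_ge0 tM MX pX; have rA := rtr_ge0 tM MA pA.
(* Four replacements are made, with weights 1, 1, tau(X) and tau(A). *)
pose K := 2 + rtr X + rtr A; have K0 : 0 < K by rewrite ltr_pwDl // ltr_pwDl.
pose d := e / K; have d0 : 0 < d by rewrite divr_gt0.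
have [f' [g' [[pf' pg' k'] fg']]] := hfg (Num.max (opnorm A) (opnorm X)) d d0.
have hA t : 0 <= t <= opnorm A -> 0 <= t <= Num.max (opnorm A) (opnorm X).
  by move=> /andP[-> tA]; rewrite le_max tA.
have hX t : 0 <= t <= opnorm X -> 0 <= t <= Num.max (opnorm A) (opnorm X).
  by move=> /andP[-> tA]; rewrite le_max tA orbT.
(* Taking the weight to be the identity specializes the weighted comparisons to traces of f(X) and
   f(A). *)
have M1 := vn1 vM; have p1 := positive_op1 H.
have n1 : rtr (fun_calc f X) <= rtr (fun_calc f' X) + d.
  have := @rtr_fun_calc_near f f' d X idfun MX pX M1 p1 pf pf'.
  rewrite (rtr1 tM) mulr1; apply=> t /hX/fg'[]; by rewrite distrC.
have n2 : rtr (fun_calc f' A) <= rtr (fun_calc f A) + d.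
  have := @rtr_fun_calc_near f' f d A idfun MA pA M1 p1 pf' pf.
  by rewrite (rtr1 tM) mulr1; apply=> t /hA/fg'[].
have n3 : rtr (fun_calc g' A \o X) <= rtr (fun_calc g A \o X) + d * rtr X.
  by apply: rtr_fun_calc_near => // t /hA/fg'[].
have n4 : rtr (fun_calc g A \o A) <= rtr (fun_calc g' A \o A) + d * rtr A.
  by apply: rtr_fun_calc_near => // t /hA/fg'[_]; rewrite distrC.
have n5 := k' A X MA pA MX pX.
have dK : d * K = e by rewrite divfK // gt_eqF.
rewrite -dK /K; lra.
Qed.

Lemma trace_antitone_powR p c : 0 < p < 1 -> 0 < c ->
  trace_antitone (fun t => (t + c) `^ (p - 1)).
Proof.
move=> p01 c0; apply: trace_antitone_limit => L e e0.
have [l [l0 hl]] := resolvent_sum_approx (L + c) p01 c0 e0.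
exists (fun t => \sum_(z <- l) z.1 / (t + c + z.2)); last first.
  by move=> t /andP[t0 tL]; have [|] := hl (t + c); first by rewrite lerDr t0 lerD2r.
elim: l l0 {hl} => [|z l IH] l0.
  have -> : (fun t => \sum_(z <- [::]) z.1 / (t + c + z.2)) = (fun t : R => 0 * (t + c)^-1).
    by apply/funext => t; rewrite big_nil mul0r.
  by apply: trace_antitoneZ => //; exact: trace_antitone_inv.
have -> : (fun t => \sum_(z <- z :: l) z.1 / (t + c + z.2)) =
    (fun t => z.1 * (t + (c + z.2))^-1 + \sum_(z <- l) z.1 / (t + c + z.2)).
  by apply/funext => t; rewrite big_cons addrA.
have [z1 z2] := l0 z (mem_head _ _).
apply: trace_antitoneD; last by apply: IH => w wl; apply: l0; rewrite in_cons wl orbT.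
by apply: trace_antitoneZ; [exact: ltW|apply: trace_antitone_inv; rewrite addr_gt0].
Qed.

(** A Klein pair survives a limit only if function and derivative converge together, which is why
    the grid estimates come in pairs for one list. *)
Lemma klein_powR p c : 0 < p < 1 -> 0 < c ->
  klein (fun t => (t + c) `^ p) (fun t => p * (t + c) `^ (p - 1)).
Proof.
move=> p01 c0; have /andP[p0 p1] := p01; apply: klein_limit => L e e0.
(* An upper bound of t + c, the factor by which the error of the power p - 1 is multiplied. *)
pose K := `|L| + c + 1; have K0 : 0 < K by rewrite ltr_pwDr // addr_ge0 // ltW.
have K1 : 1 <= K by rewrite lerDr addr_ge0 // ltW.
have eK0 : 0 < e / K by rewrite divr_gt0.
have [l [l0 hl]] := resolvent_sum_approx (L + c) p01 c0 eK0.
exists (fun t => \sum_(z <- l) (t + c) * (z.1 / (t + c + z.2))).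
exists (fun t => \sum_(z <- l) z.1 * z.2 / (t + c + z.2) ^+ 2); split; last first.
  move=> t /andP[t0 tL]; have [|h1 h2] := hl (t + c); first by rewrite lerDr t0 lerD2r.
  have tc0 : 0 < t + c by rewrite ltr_wpDl.
  split; last by rewrite (le_trans h2) // ler_pdivrMr // ler_peMr // ltW.
  rewrite -mulr_sumr -(mulr_powRB1 (ltW tc0) p0) -mulrBr normrM gtr0_norm //.
  rewrite -[leRHS](divfK (_ : K != 0)) ?gt_eqF // mulrC ler_pM //.
    exact: ltW.
  by have := ler_norm L; rewrite /K; lra.
elim: l l0 {hl} => [|z l IH] l0.
  have := klein_cst 0; congr klein; apply/funext => t; by rewrite big_nil.
have [z1 z2] := l0 z (mem_head _ _).
have cz : 0 < c + z.2 by rewrite addr_gt0.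
have {}IH := IH (fun w wl => l0 w (mem_behead (s := z :: l) wl)).
(* Each term (t + c) z1 / (t + c + z2) is the constant z1 minus z1 z2 / (t + c + z2), a positive
   multiple of the pair in [klein_inv]. *)
apply: klein_ext (kleinD (kleinD (klein_cst z.1)
    (kleinZ (ltW (mulr_gt0 z1 z2)) (klein_inv cz))) IH) => t t0;
  rewrite big_cons; congr (_ + _).
  by rewrite -[t + c + z.2]addrA; field; rewrite gt_eqF // ltr_wpDl.
by rewrite add0r -addrA expr2 invfM mulrA.
Qed.

End TraceInequalities.

(** * The dual Doob inequality *)

Section DualDoob.
Variables (R : realType) (H : hilbertSpace R) (M : set (H -> H)).
Variable tau : (H -> H) -> R[i].
Hypotheses (vM : von_neumann_algebra M) (tM : normal_faithful_tracial_state M tau).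
Implicit Types (a b x y A B X : H -> H) (c e t p : R) (f g : R -> R).

Local Notation rtr := (real_trace tau).

Lemma comp_sumr a (I : Type) (r : seq I) (P : pred I) (F : I -> H -> H) :
  linear a -> a \o (\sum_(i <- r | P i) F i) = \sum_(i <- r | P i) (a \o F i).
Proof.
move=> la; elim/big_rec2: _ => [|i y1 y2 _ <-].
  by apply/funext => h /=; rewrite linop0.
by apply/funext => h; rewrite /= !fctE (linopD _ _ la).
Qed.

Lemma Lp_norm_positive p a : positive_op a ->
  Lp_norm tau p a = rtr (fun_calc (fun t => t `^ p) a) `^ p^-1.
Proof.
move=> pa; rewrite /Lp_norm op_abs_positive //; apply: papprox_powR.
by rewrite invr_gt0 ltr0n invf_le1 // ler1n.
Qed.

Variables (N : nat -> set (H -> H)) (E : nat -> (H -> H) -> H -> H).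
Hypotheses (vN : forall k, (1 <= k)%N -> von_neumann_algebra (N k) /\ N k `<=` M)
  (NS : forall k, (1 <= k)%N -> N k `<=` N k.+1)
  (cE : forall k, (1 <= k)%N -> conditional_expectation M (N k) tau (E k)).
Variables (n : nat) (x : nat -> H -> H).
Hypothesis x_pos : forall k, (1 <= k <= n)%N -> M (x k) /\ positive_op (x k).

Let S m := \sum_(1 <= k < m.+1) E k (x k).
Let X := \sum_(1 <= k < n.+1) x k.

Let Ex k : (1 <= k <= n)%N -> [/\ N k (E k (x k)), M (E k (x k)) & positive_op (E k (x k))].
Proof.
move=> kn; have /andP[k1 _] := kn; have [Mx px] := x_pos kn.
have Nx := condexp_range (cE k1) Mx; split=> //; first by have [_] := vN k1; exact.
exact: condexp_pos (cE k1) _ Mx px.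
Qed.

Let SS m : S m.+1 = S m + E m.+1 (x m.+1).
Proof. by rewrite /S big_nat_recr. Qed.

Let S_pos m : (m <= n)%N -> M (S m) /\ positive_op (S m).
Proof.
elim: m => [|m IH] mn.
  by rewrite /S big_geq //; split; [exact: vn0|exact: positive_op0].
have [MS pS] := IH (ltnW mn); have [_ MEx pE] := @Ex m.+1 mn.
by rewrite SS; split; [exact: vnD|exact: positive_opD].
Qed.

Let S_in m : (1 <= m <= n)%N -> N m (S m).
Proof.
elim: m => // m IH /andP[_ mn]; have [vNm _] := vN (ltn0Sn m).
rewrite SS; apply: vnD => //; last by have [] := @Ex m.+1 mn.
(* Nothing is known about N 0, so the first step uses that S 0 = 0 belongs to N 1. *)
case: m IH vNm mn => [|m] IH vNm mn; first by rewrite /S big_geq //; exact: vn0.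
by apply: NS => //; apply: IH; rewrite /= ltnW.
Qed.

Let S_le m : (m <= n)%N -> positive_op (S n - S m).
Proof.
move=> mn; rewrite -(subnKC mn); move: (n - m)%N (subnKC mn) => d dn.
have {}dn : (m + d <= n)%N by rewrite dn.
elim: d dn => [|d IH] dn; first by rewrite addn0 subrr; exact: positive_op0.
rewrite addnS in dn *; rewrite SS addrAC.
by apply: positive_opD; [apply: IH; exact: ltnW|have [] := @Ex (m + d).+1 dn].
Qed.

Let X_pos : M X /\ positive_op X.
Proof.
rewrite /X big_nat; split.
  by apply: vn_sum => // k kn; have [] := x_pos kn.
by apply: positive_op_sum => k kn; have [] := x_pos kn.
Qed.

Lemma telescoped_klein p c : 0 < p < 1 -> 0 < c ->
  p * rtr (fun_calc (fun t => (t + c) `^ (p - 1)) (S n) \o X) <=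
  rtr (fun_calc (fun t => (t + c) `^ p) (S n)).
Proof.
move=> p01 c0; have /andP[p0 p1] := p01.
set g := fun t => (t + c) `^ (p - 1); set f := fun t => (t + c) `^ p.
have [pf ppg hk] := klein_powR vM tM p01 c0.
have [pg hg] := trace_antitone_powR vM tM p01 c0.
have [MS pS] := S_pos (leqnn n).
have MgS m : (m <= n)%N -> M (fun_calc g (S m)).
  by move=> mn; have [? ?] := S_pos mn; apply: vn_fun_calc.
have step1 : rtr (fun_calc g (S n) \o X) <=
    \sum_(1 <= k < n.+1) rtr (fun_calc g (S k) \o E k (x k)).
  (* The redundant range condition is kept in the sum so that [rtr_sum] can use it for membership in
     M. *)
  have -> : fun_calc g (S n) \o X =
      \sum_(1 <= k < n.+1 | (1 <= k <= n)%N) (fun_calc g (S n) \o x k).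
    have lg := vn_linear vM (MgS n (leqnn n)).
    by rewrite /X big_nat comp_sumr.
  rewrite (rtr_sum vM tM) => [|k kn]; last first.
    by apply: vnM => //; [exact: MgS|have [] := x_pos kn].
  rewrite -big_nat big_nat [leRHS]big_nat; apply: ler_sum => k kn.
  have /andP[k1 kn'] : (1 <= k <= n)%N by [].
  have [Mx px] := x_pos kn; have [MSk pSk] := S_pos kn'.
  have [vNk NM] := vN k1.
  apply: (le_trans (hg _ _ _ MS pS MSk pSk Mx px (S_le kn'))).
  have Ng : N k (fun_calc g (S k)) by apply: vn_fun_calc => //; exact: S_in.
  (* As g(S_k) lies in N k it enters the conditional expectation, which the trace then ignores. *)
  rewrite -(condexp_modl (cE k1) Mx Ng) le_eqVlt; apply/orP; left; apply/eqP.
  by rewrite /real_trace (condexp_trace (cE k1)) //; apply: vnM => //; exact: NM.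
have step2 m : (m <= n)%N ->
    p * \sum_(1 <= k < m.+1) rtr (fun_calc g (S k) \o E k (x k)) <= rtr (fun_calc f (S m)).
  elim: m => [|m IH] mn.
    have [M0 p0'] := S_pos (leq0n n); rewrite big_geq // mulr0.
    apply: (rtr_ge0 tM); first exact: vn_fun_calc.
    by apply: fun_calc_ge0 => // t _; exact: powR_ge0.
  have [M1 p1'] := S_pos mn; have [M2 p2'] := S_pos (ltnW mn).
  have := hk _ _ M1 p1' M2 p2'; rewrite -/f fun_calcZ // -/g.
  rewrite big_nat_recr //= mulrDr.
  have [_ MEx _] := @Ex m.+1 mn.
  have Mg := MgS m.+1 mn; have lg := vn_linear vM Mg.
  have pgE (y : H -> H) : (p%:C *: fun_calc g (S m.+1)) \o y =
    p%:C *: (fun_calc g (S m.+1) \o y) by [].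
  rewrite !pgE.
  have -> : fun_calc g (S m.+1) \o S m.+1 =
     (fun_calc g (S m.+1) \o S m) + (fun_calc g (S m.+1) \o E m.+1 (x m.+1)).
    by apply/funext => h; rewrite {2}SS /= !fctE /= (linopD _ _ lg).
  rewrite !(rtrZ vM tM) ?(rtrD tM); try by first [exact: vnM|apply: vnD => //; exact: vnM].
  have := IH (ltnW mn); lra.
apply: le_trans (step2 n (leqnn n)); by rewrite ler_pM2l.
Qed.

(** With f, g the shifted powers p and p - 1, Klein bounds tau(f(pX)) by tau(f(S)) + p^2 tau(g(S) X)
    - p tau(g(S) S). The middle term is at most p tau(f(S)) and the last is -p tau(f(S)) + p c
    tau(g(S)), so the multiples of p cancel up to the small p c tau(g(S)). *)
Lemma trace_pow_le p : 0 < p < 1 ->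
  p `^ p * rtr (fun_calc (fun t => t `^ p) X) <= rtr (fun_calc (fun t => t `^ p) (S n)).
Proof.
move=> p01; have /andP[p0 p1] := p01; have p01' : 0 < p <= 1 by rewrite p0 ltW.
have [MX pX] := X_pos; have [MS pS] := S_pos (leqnn n).
have pp := papprox_powR p01'.
have MpX : M (p%:C *: X) by apply: vnZ.
have ppX : positive_op (p%:C *: X) by apply: positive_opZ => //; exact: ltW.
have scale : p `^ p * rtr (fun_calc (fun t => t `^ p) X) =
    rtr (fun_calc (fun t => t `^ p) (p%:C *: X)).
  rewrite -{2}(op_hornerX X) -op_hornerZ fun_calc_comp //; last first.
    by move=> t t0; rewrite !hornerE mulr_ge0 // ltW.
  rewrite -(rtrZ vM tM); last exact: vn_fun_calc.
  rewrite -fun_calcZ //.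
  congr real_trace; apply: fun_calc_ext => //; first exact: papproxZ.
    by apply: (papprox_comp pp) => t t0; rewrite !hornerE mulr_ge0 // ltW.
  by move=> t /andP[t0 _]; rewrite !hornerE powRM // ltW.
rewrite scale; apply/ler_addgt0Pr => e e0.
have e20 : 0 < e / 2 by rewrite divr_gt0.
(* The shift is charged twice, each time at most c^p: in c tau(g(S)) and in passing from f(S) back
   to S^p. *)
have [c c0 ce] := powR_small p0 e20.
have [pf ppg hk] := klein_powR vM tM p01 c0.
have [pg _] := trace_antitone_powR vM tM p01 c0.
have := telescoped_klein p01 c0.
have := hk _ _ MS pS MpX ppX.
set g := fun t => (t + c) `^ (p - 1) in pg ppg hk *; set f := fun t => (t + c) `^ p in pf hk *.
have Mg : M (fun_calc g (S n)) by apply: vn_fun_calc.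
have lg := vn_linear vM Mg.
have M1 := vn1 vM; have p1' := positive_op1 H.
rewrite fun_calcZ // -/g.
have pgE (y : H -> H) : (p%:C *: fun_calc g (S n)) \o y =
    p%:C *: (fun_calc g (S n) \o y) by [].
rewrite !pgE.
have -> : fun_calc g (S n) \o (p%:C *: X) = p%:C *: (fun_calc g (S n) \o X).
  by apply/funext => h; rewrite /= !fctE /= (linopZ _ _ lg).
rewrite !(rtrZ vM tM) //; try by first [exact: vnM|apply: vnZ => //; exact: vnM].
have -> : rtr (fun_calc g (S n) \o S n) =
    rtr (fun_calc f (S n)) - c * rtr (fun_calc g (S n)).
  rewrite -{2}(fun_calc_id pS) -fun_calcM //; last first.
    by apply: papprox_ext (papprox_horner 'X) => t _; rewrite hornerX.
  rewrite -(rtrZ vM tM) // -(rtrB vM tM); last 2 first.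
  - exact: vn_fun_calc.
  - exact: vnZ.
  rewrite -fun_calcZ // -fun_calcB //; last exact: papproxZ.
  congr real_trace; apply: fun_calc_ext => //.
  - apply: papproxM => //.
    by apply: papprox_ext (papprox_horner 'X) => t _; rewrite hornerX.
  - by apply: papproxB => //; exact: papproxZ.
  - move=> t /andP[t0 _]; rewrite /f /g -(@mulr_powRB1 _ (t + c) p) ?addr_ge0 ?(ltW c0) //.
    by ring.
have n1 : c * rtr (fun_calc g (S n)) <= e / 2.
  rewrite -(rtrZ vM tM) // -fun_calcZ //.
  have := @rtr_fun_calc_le _ _ _ _ vM tM (fun t => c * g t) (fun=> c `^ p) (S n)
    idfun MS pS M1 p1'.
  have hE : rtr (fun_calc (fun=> c `^ p) (S n) \o idfun) = c `^ p.
    rewrite fun_calc_cst //.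
    by rewrite -[X in real_trace _ X]/((c `^ p)%:C *: idfun) (rtrZ vM tM) // (rtr1 tM) mulr1.
  rewrite hE => h.
  apply: le_trans ce; apply: h; [exact: papproxZ|exact: papprox_cst|].
  move=> t /andP[t0 _]; rewrite -(mulr_powRB1 (ltW c0) p0) ler_pM2l // /g.
  have tc0 : 0 < t + c by rewrite ltr_wpDl.
  rewrite -[p - 1]opprB !powRN lef_pV2 ?posrE ?powR_gt0 //.
  by rewrite ge0_ler_powR ?nnegrE ?(ltW c0) ?(ltW tc0) ?lerDr // subr_ge0 ltW.
have n2 : rtr (fun_calc (fun t => t `^ p) (p%:C *: X)) <= rtr (fun_calc f (p%:C *: X)).
  apply: (@rtr_fun_calc_le _ _ _ _ vM tM _ _ _ idfun) => // t /andP[t0 _].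
  by rewrite /f ge0_ler_powR ?nnegrE ?(ltW p0) ?addr_ge0 ?(ltW c0) // lerDl ltW.
have n3 : rtr (fun_calc f (S n)) <= rtr (fun_calc (fun t => t `^ p) (S n)) + e / 2.
  have := @rtr_fun_calc_near _ _ _ _ vM tM f (fun t => t `^ p) (e / 2) (S n) idfun
    MS pS M1 p1' pf pp.
  rewrite (rtr1 tM) mulr1; apply=> t /andP[t0 _].
  rewrite ger0_norm; last first.
    by rewrite subr_ge0 ge0_ler_powR ?nnegrE ?(ltW p0) ?addr_ge0 ?(ltW c0) // lerDl ltW.
  by have := powR_subadditive p01' t0 (ltW c0); rewrite /f; lra.
move=> k1 k2.
have n4 : 0 <= c * rtr (fun_calc g (S n)).
  rewrite mulr_ge0 ?(ltW c0) // (rtr_ge0 tM) //; apply: fun_calc_ge0 => // t _.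
  exact: powR_ge0.
have n5 : p * (c * rtr (fun_calc g (S n))) <= c * rtr (fun_calc g (S n)).
  by rewrite ler_piMl // ltW.
have n6 : p * (p * rtr (fun_calc g (S n) \o X)) <= p * rtr (fun_calc f (S n)).
  by rewrite ler_pM2l.
move: k1 k2 n1 n2 n3 n4 n5 n6; clear.
move: (rtr (fun_calc f _)) (rtr (fun_calc f _)) (rtr (fun_calc g _)).
move: (rtr (fun_calc g _ \o _)) (rtr (fun_calc _ _)) (rtr (fun_calc _ _)).
by move=> *; lra.
Qed.

Lemma dual_Doob_Lp p : 0 < p <= 1 -> Lp_norm tau p X <= 1 / p * Lp_norm tau p (S n).
Proof.
move=> p01; have /andP[p0 p1] := p01.
have [MX pX] := X_pos; have [MS pS] := S_pos (leqnn n).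
have pp := papprox_powR p01.
rewrite !Lp_norm_positive //.
have r0 : 0 <= rtr (fun_calc (fun t => t `^ p) X).
  by apply: (rtr_ge0 tM); [exact: vn_fun_calc|apply: fun_calc_ge0 => // t _; exact: powR_ge0].
have r1 : 0 <= rtr (fun_calc (fun t => t `^ p) (S n)).
  by apply: (rtr_ge0 tM); [exact: vn_fun_calc|apply: fun_calc_ge0 => // t _; exact: powR_ge0].
have key : p `^ p * rtr (fun_calc (fun t => t `^ p) X) <=
    rtr (fun_calc (fun t => t `^ p) (S n)).
  (* For p = 1 the claim is that each E k preserves the trace. *)
  have [p1'|p1'] := eqVneq p 1; last by apply: trace_pow_le; rewrite p0 lt_def eq_sym p1'.
  subst p; have id1 A : positive_op A -> fun_calc (fun t => t `^ 1) A = A.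
    move=> pA; rewrite -[RHS]fun_calc_id //; apply: fun_calc_ext => //.
      by apply: papprox_ext (papprox_horner 'X) => t _; rewrite hornerX.
    by move=> t /andP[t0 _]; rewrite powRr1.
  rewrite !id1 // powRr1 // mul1r /X /S !big_nat.
  rewrite !(rtr_sum vM tM); last 2 first.
  - by move=> k kn; have [] := Ex kn.
  - by move=> k kn; have [] := x_pos kn.
  apply: ler_sum => k kn; have /andP[k1 _] := kn; have [Mx _] := x_pos kn.
  by rewrite /real_trace (condexp_trace (cE k1)).
rewrite -ler_pdivrMl ?divr_gt0 // invf_div divr1.
(* Writing p as a p-th root of p^p lets it join the moment under the exponent 1/p. *)
have pE : p = (p `^ p) `^ p^-1 by rewrite -powRrM divff ?gt_eqF // powRr1 // ltW.
rewrite [X in X * _]pE -powRM ?powR_ge0 //.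
by rewrite ge0_ler_powR ?nnegrE ?mulr_ge0 ?powR_ge0 // invr_ge0 ltW.
Qed.

End DualDoob.

Lemma dual_Doob_bound (R : realType) (p : R) : 0 < p <= 1 ->
  dual_Doob_inequality p (1 / p).
Proof.
move=> p01 H M tau N E vM tM vN NS cE n x _ x_pos.
exact: (dual_Doob_Lp vM tM vN NS cE x_pos).
Qed.

(** * Finite-dimensional Hilbert spaces *)

(* An alias, so that the l^2 norm below does not clash with the sup norm that
   the library puts on matrices. *)
Definition ell2 (R : realType) (n : nat) : Type := 'rV[R[i]]_n.

HB.instance Definition _ (R : realType) n := GRing.Lmodule.copy (ell2 R n) 'rV[R[i]]_n.
HB.instance Definition _ (R : realType) n := Vector.copy (ell2 R n) 'rV[R[i]]_n.

Section Ell2.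
Variables (R : realType) (n : nat).
Local Notation C := R[i].
Local Notation T := (ell2 R n).
Implicit Types x y : T.

Definition coordinate x (i : 'I_n) : C := (x : 'rV[C]_n) 0 i.

Lemma coordinateP x y : coordinate x =1 coordinate y -> x = y.
Proof. by move=> xy; apply/rowP => i; exact: xy. Qed.
Lemma coordinateD x y i : coordinate (x + y) i = coordinate x i + coordinate y i.
Proof. by rewrite /coordinate mxE. Qed.
Lemma coordinateN x i : coordinate (- x) i = - coordinate x i.
Proof. by rewrite /coordinate mxE. Qed.
Lemma coordinateZ (c : C) x i : coordinate (c *: x) i = c * coordinate x i.
Proof. by rewrite /coordinate mxE. Qed.
Lemma coordinate0 i : coordinate 0 i = 0.
Proof. by rewrite /coordinate mxE. Qed.

Definition vec (f : 'I_n -> C) : T := \row_i f i.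
Lemma coordinate_vec f i : coordinate (vec f) i = f i.
Proof. by rewrite /coordinate mxE. Qed.

Definition ell2_dot x y : C := \sum_i coordinate x i * Num.conj (coordinate y i).

Lemma ell2_dot_bilinear :
  bilinear_for *%R (Num.conj \; *%R) ell2_dot.
Proof.
split=> [y c x x'|x c y y'] /=; rewrite /ell2_dot mulr_sumr -big_split /=;
  apply: eq_bigr => i _; rewrite coordinateD coordinateZ.
  by rewrite mulrDl mulrA.
by rewrite rmorphD rmorphM mulrDr mulrCA.
Qed.

HB.instance Definition _ := bilinear_isBilinear.Build C T T C *%R
  (Num.conj \; *%R) ell2_dot ell2_dot_bilinear.

Lemma ell2_dot_herm x y : ell2_dot x y = (-1) ^+ false * Num.conj (ell2_dot y x).
Proof.
rewrite expr0 mul1r rmorph_sum; apply: eq_bigr => i _.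
by rewrite rmorphM /= conjCK mulrC.
Qed.

HB.instance Definition _ := isHermitianSesquilinear.Build C T false Num.conj
  ell2_dot ell2_dot_herm.

Lemma ell2_dot_gt0 x : x != 0 -> 0 < ell2_dot x x.
Proof.
move=> x0; have ge0 i : 0 <= coordinate x i * Num.conj (coordinate x i) by exact: mul_conjC_ge0.
rewrite lt_def sumr_ge0 // andbT; apply: contraNneq x0 => /eqP.
rewrite psumr_eq0 // => /allP h; apply/eqP/coordinateP => i; rewrite coordinate0.
by have := h i (mem_index_enum i); rewrite mul_conjC_eq0 => /eqP.
Qed.

HB.instance Definition _ := isDotProduct.Build C T ell2_dot ell2_dot_gt0.

Definition ell2_norm x : C := sqrtC (ell2_dot x x).

Lemma ell2_normD x y : ell2_norm (x + y) <= ell2_norm x + ell2_norm y.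
Proof. by have [] := triangle_lerif ell2_dot x y. Qed.

Lemma ell2_normZ (c : C) x : ell2_norm (c *: x) = `|c| * ell2_norm x.
Proof.
rewrite /ell2_norm (dnormZ ell2_dot) sqrtCM ?nnegrE ?exprn_ge0 ?(dnorm_ge0 ell2_dot) //.
by rewrite sqrCK.
Qed.

Lemma ell2_norm_eq0 x : ell2_norm x = 0 -> x = 0.
Proof. by move=> /eqP; rewrite sqrtC_eq0 (dnorm_eq0 ell2_dot) => /eqP. Qed.

HB.instance Definition _ := Lmodule_isNormed.Build C T ell2_normD ell2_normZ ell2_norm_eq0.

Lemma ell2_normE x : `|x| ^+ 2 = ell2_dot x x.
Proof. by rewrite sqrtCK. Qed.

Lemma coordinate_le x i : `|coordinate x i| <= `|x|.
Proof.
rewrite -(ler_pXn2r (ltn0Sn 1)) ?nnegrE // ell2_normE /ell2_dot (bigD1 i) //= normCK.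
by rewrite lerDl sumr_ge0 // => j _; exact: mul_conjC_ge0.
Qed.

Lemma ell2_norm_le x : `|x| <= \sum_i `|coordinate x i|.
Proof.
have s0 : 0 <= \sum_i `|coordinate x i| by rewrite sumr_ge0.
rewrite -(ler_pXn2r (ltn0Sn 1)) ?nnegrE // ell2_normE expr2 mulr_suml.
apply: ler_sum => i _; rewrite -normCK expr2 ler_wpM2l // (bigD1 i) //= lerDl.
by rewrite sumr_ge0.
Qed.

Lemma normc_ge_Im (z : C) : `|complex.Im z|%:C <= `|z|.
Proof. by rewrite normc_def lecR -sqrtr_sqr ler_wsqrtr // lerDr sqr_ge0. Qed.

Lemma normc_le_ReIm (z : C) : `|z| <= (`|complex.Re z| + `|complex.Im z|)%:C.
Proof.
rewrite normc_def lecR -[leRHS]ger0_norm ?addr_ge0 // -sqrtr_sqr ler_wsqrtr //.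
by rewrite sqrrD !real_normK ?num_real // lerD2r lerDl mulrn_wge0 // mulr_ge0.
Qed.

(** Real and imaginary parts of coordinates are 1-Lipschitz, hence Cauchy along F; the norm is
    controlled by the sum of the coordinates. *)
Lemma ell2_complete (F : set_system T) : ProperFilter F -> cauchy F -> cvg F.
Proof.
move=> FF Fc; apply/cvg_ex.
have lim_of (phi : T -> R) : (forall x y, `|phi x - phi y|%:C <= `|x - y|) ->
    exists l : R, phi @ F --> l.
  move=> hphi; apply/cvg_ex; apply: R_complete.
  apply/cauchy_exP => e e0.
  have /cauchyP /(_ e%:C) := Fc; rewrite ltcR => /(_ e0) [x0 hx0].
  exists (phi x0); rewrite /nbhs /=; apply: filterS hx0 => y.
  rewrite -!ball_normE /= => xy; rewrite -ltcR.
  exact: le_lt_trans (hphi _ _) xy.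
have /choice[re hre] : forall i, exists l : R, (fun x => complex.Re (coordinate x i)) @ F --> l.
  move=> i; apply: lim_of => x y; rewrite -raddfB -coordinateN -coordinateD.
  by rewrite (le_trans _ (coordinate_le _ i)) // normc_ge_Re.
have /choice[im him] : forall i, exists l : R, (fun x => complex.Im (coordinate x i)) @ F --> l.
  move=> i; apply: lim_of => x y; rewrite -raddfB -coordinateN -coordinateD.
  by rewrite (le_trans _ (coordinate_le _ i)) // normc_ge_Im.
exists (vec (fun i => re i +i* im i)).
apply/cvgrPdist_lt => e e0.
have eE : e = (complex.Re e)%:C by rewrite RRe_real // gtr0_real.
have {}e0 : 0 < complex.Re e by move: e0; rewrite {1}eE ltcR.
(* Each of the n coordinates contributes two errors; the extra 1 makes the bound strict and covers n
   = 0. *)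
pose d := complex.Re e / (2 * n%:R + 1).
have n0 : 0 < 2 * n%:R + 1 :> R by rewrite ltr_wpDl // mulr_ge0.
have d0 : 0 < d by rewrite divr_gt0.
have Hre : \forall x \near F, forall i, `|re i - complex.Re (coordinate x i)| < d.
  by apply: filter_forall => i; have /cvgrPdist_lt /(_ d d0) := hre i.
have Him : \forall x \near F, forall i, `|im i - complex.Im (coordinate x i)| < d.
  by apply: filter_forall => i; have /cvgrPdist_lt /(_ d d0) := him i.
apply: filterS2 Hre Him => x xre xim.
rewrite eE (le_lt_trans (ell2_norm_le _)) //.
apply: (@le_lt_trans _ _ (\sum_(i < n) (d + d)%:C)).
  apply: ler_sum => i _; rewrite coordinateD coordinateN coordinate_vec.
  rewrite (le_trans (normc_le_ReIm _)) // lecR !raddfB /=.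
  by rewrite lerD ?ltW.
rewrite -rmorph_sum /= ltcR sumr_const card_ord -mulr_natr.
have -> : complex.Re e = d * (2 * n%:R + 1) by rewrite divfK // gt_eqF.
by lra.
Qed.

HB.instance Definition _ := Uniform_isComplete.Build T ell2_complete.

Definition ell2_hilbert : hilbertSpace R :=
  @HilbertSpace R (T : completeNormedModType C) (ell2_dot : {dot T for Num.conj}) ell2_normE.

End Ell2.

(** * Diagonal operators *)

Section DiagonalOperators.
Variables (R : realType) (n : nat).
Local Notation C := R[i].
Local Notation H := (ell2_hilbert R n).
Implicit Types (x y h : H) (a b : H -> H) (d f : 'I_n -> C) (r s : 'I_n -> R).

Definition diag d : H -> H := fun x => vec (fun i => d i * coordinate x i).

Lemma coord_diag d x i : coordinate (diag d x) i = d i * coordinate x i.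
Proof. exact: coordinate_vec. Qed.

Definition basis (i : 'I_n) : H := vec (fun j => (j == i)%:R).

Lemma coord_basis i j : coordinate (basis i) j = (j == i)%:R.
Proof. exact: coordinate_vec. Qed.

Definition entry a (i : 'I_n) : C := coordinate (a (basis i)) i.

Lemma entry_diag d i : entry (diag d) i = d i.
Proof. by rewrite /entry coord_diag coord_basis eqxx mulr1. Qed.

Lemma diag_ext d f : d =1 f -> diag d = diag f.
Proof. by move=> df; apply/funext => x; apply: coordinateP => i; rewrite !coord_diag df. Qed.

Lemma diagD d f : diag d + diag f = diag (fun i => d i + f i).
Proof.
apply/funext => x; apply: coordinateP => i.
by rewrite fctE coordinateD !coord_diag mulrDl.
Qed.
Lemma diagZ (c : C) d : c *: diag d = diag (fun i => c * d i).
Proof.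
apply/funext => x; apply: coordinateP => i.
by rewrite fctE coordinateZ !coord_diag mulrA.
Qed.
Lemma diagB d f : diag d - diag f = diag (fun i => d i - f i).
Proof.
apply/funext => x; apply: coordinateP => i.
by rewrite !fctE coordinateD coordinateN !coord_diag mulrBl.
Qed.
Lemma diagM d f : diag d \o diag f = diag (fun i => d i * f i).
Proof.
by apply/funext => x; apply: coordinateP => i; rewrite /= !coord_diag mulrA.
Qed.
Lemma diag1 : idfun = diag (fun=> 1).
Proof. by apply/funext => x; apply: coordinateP => i; rewrite coord_diag mul1r. Qed.
Lemma diag0 : 0 = diag (fun=> 0).
Proof. by apply/funext => x; apply: coordinateP => i; rewrite coord_diag mul0r coordinate0. Qed.

Lemma diag_sum (I : Type) (l : seq I) (F : I -> 'I_n -> C) :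
  \sum_(k <- l) diag (F k) = diag (fun i => \sum_(k <- l) F k i).
Proof.
elim: l => [|k l IH].
  by rewrite big_nil diag0; apply: diag_ext => i; rewrite big_nil.
by rewrite big_cons IH diagD; apply: diag_ext => i; rewrite big_cons.
Qed.

Lemma linear_diag d : linear (diag d).
Proof.
move=> c x y; apply: coordinateP => i.
by rewrite coord_diag !coordinateD !coordinateZ !coord_diag mulrDr mulrCA.
Qed.

Lemma dotE x y : hs_dot H x y = \sum_i coordinate x i * Num.conj (coordinate y i).
Proof. by []. Qed.

Lemma diag_opbound d (K : R) : 0 <= K -> (forall i, `|d i| <= K%:C) -> opbound (diag d) K.
Proof.
move=> K0 dK x; rewrite nrm_le_sqr ?mulr_ge0 ?nrm_ge0 // exprMn nrm_sqr.
have : (rdot (diag d x) (diag d x))%:C <= (K ^+ 2 * rdot x x)%:C.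
  rewrite rmorphM /= rmorphXn /= -!dot_rdot !dotE mulr_sumr; apply: ler_sum => i _.
  rewrite coord_diag -!normCK normrM exprMn ler_wpM2r ?exprn_ge0 //.
  by rewrite lerXn2r // nnegrE // ler0c.
by rewrite lecR.
Qed.

Lemma diag_bounded d : bounded_op (diag d).
Proof.
pose K := \sum_i complex.Re `|d i|.
have ge i : 0 <= complex.Re `|d i| by rewrite -ler0c RRe_real // ger0_real.
apply: (@opbound_bounded _ _ _ K); first exact: sumr_ge0.
  exact: linear_diag.
apply: diag_opbound => [|i]; first exact: sumr_ge0.
rewrite -[leLHS]RRe_real ?ger0_real // lecR /K (bigD1 i) //= lerDl.
by apply: sumr_ge0 => j _; exact: ge.
Qed.

Lemma diag_adjoint d : is_adjoint (diag d) (diag (fun i => Num.conj (d i))).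
Proof.
move=> x y; rewrite !dotE; apply: eq_bigr => i _.
by rewrite !coord_diag rmorphM /= conjCK mulrCA mulrA.
Qed.

Lemma adj_diag d : adj (diag d) = diag (fun i => Num.conj (d i)).
Proof. by apply: adj_eq; [exact: diag_bounded|exact: diag_adjoint]. Qed.

Lemma dot_diag_basis d i : hs_dot H (diag d (basis i)) (basis i) = d i.
Proof.
rewrite dotE (bigD1 i) //= big1 ?addr0 => [|j ji].
  by rewrite coord_diag !coord_basis eqxx mulr1 rmorph1 mulr1.
by rewrite coord_diag !coord_basis (negPf ji) mulr0 mul0r.
Qed.

Lemma diag_positive d : positive_op (diag d) <-> forall i, 0 <= d i.
Proof.
split=> [[_ pd] i|d0]; first by have := pd (basis i); rewrite dot_diag_basis.
split=> [|h]; first exact: diag_bounded.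
rewrite dotE sumr_ge0 // => i _; rewrite coord_diag -mulrA mulr_ge0 //.
exact: mul_conjC_ge0.
Qed.

Definition diagonal_ops : set (H -> H) := [set a | exists d, a = diag d].

Lemma diagonal_diag d : diagonal_ops (diag d).
Proof. by exists d. Qed.

Lemma diagonalP a : diagonal_ops a -> a = diag (entry a).
Proof. by case=> d ->; apply: diag_ext => i; rewrite entry_diag. Qed.

Lemma commute_diagonal a : linear a ->
  (forall i, a \o diag (fun j => (j == i)%:R) = diag (fun j => (j == i)%:R) \o a) ->
  diagonal_ops a.
Proof.
move=> la ca; exists (entry a); apply/funext => x; apply: coordinateP => i.
have := congr1 (fun g => coordinate (g x) i) (ca i); rewrite /= coord_diag eqxx mul1r => <-.
have -> : diag (fun j => (j == i)%:R) x = coordinate x i *: basis i.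
  apply: coordinateP => j; rewrite coord_diag coordinateZ coord_basis.
  by case: eqVneq => [->|_]; rewrite ?mul1r ?mulr1 // mul0r mulr0.
by rewrite linopZ // coordinateZ coord_diag mulrC.
Qed.

(** The matrix unit e_ij, which detects whether the entries i and j of a diagonal operator agree. *)
Definition unit_op (i j : 'I_n) : H -> H := fun x => coordinate x j *: basis i.

Lemma unit_op_bounded i j : bounded_op (unit_op i j).
Proof.
apply: (@opbound_bounded _ _ _ (nrm (basis i))); first exact: nrm_ge0.
  by move=> c x y; rewrite /unit_op coordinateD coordinateZ scalerDl scalerA.
move=> x; rewrite nrmZ mulrC ler_wpM2l ?nrm_ge0 //.
by rewrite -lecR -nrmE RRe_real ?ger0_real //; exact: (coordinate_le x).
Qed.

Lemma unit_op_diag i j d : unit_op i j \o diag d = diag d \o unit_op i j <->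
  d i = d j.
Proof.
have E1 x l : coordinate ((unit_op i j \o diag d) x) l = d j * coordinate x j * (l == i)%:R.
  by rewrite /= coordinateZ coord_diag coord_basis.
have E2 x l : coordinate ((diag d \o unit_op i j) x) l = d i * coordinate x j * (l == i)%:R.
  rewrite /= coord_diag coordinateZ coord_basis.
  by case: eqVneq => [->|_]; rewrite ?mulr1 // !mulr0.
split=> [e|e].
  have := congr1 (fun g => coordinate (g (basis j)) i) e.
  by rewrite E1 E2 coord_basis !eqxx !mulr1.
by apply/funext => x; apply: coordinateP => l; rewrite E1 E2 e.
Qed.

(** Multiplication by functions measurable for the partition into T and the single points outside
    T. *)
Definition block (T : pred 'I_n) : set (H -> H) :=
  [set a | exists2 d, a = diag d & forall i j, T i -> T j -> d i = d j].

Lemma block_diagonal T : block T `<=` diagonal_ops.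
Proof. by move=> _ [d -> _]; exact: diagonal_diag. Qed.

(** All diagonal operators lie in the commutant, so the bicommutant is diagonal; the matrix units
    with both indices in T lie there too and force the entries on T to be equal. *)
Lemma block_vn T : von_neumann_algebra (block T).
Proof.
split=> [_ [d -> dT]|].
  by rewrite adj_diag; exists (fun i => Num.conj (d i)) => // i j Ti Tj; rewrite (dT i j).
have cD d : commutant (block T) (diag d).
  split=> [|_ [f -> _]]; first exact: diag_bounded.
  by rewrite !diagM; apply: diag_ext => i; rewrite mulrC.
apply/seteqP; split=> [a [[la _] ca]|a Ta].
  have [d ad] : diagonal_ops a by apply: commute_diagonal => // i; exact: ca (cD _).
  exists d => // i j Ti Tj; apply/unit_op_diag; rewrite -ad; apply/esym/ca.
  split=> [|_ [f -> fT]]; first exact: unit_op_bounded.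
  by apply/unit_op_diag; exact: fT.
have [d ad dT] := Ta; split; first by rewrite ad; exact: diag_bounded.
by move=> b [_ cb]; rewrite cb.
Qed.

Lemma diagonal_block : diagonal_ops = block pred0.
Proof.
by apply/seteqP; split=> [_ [d ->]|_ [d -> _]]; [exists d|exists d].
Qed.

Lemma diagonal_vn : von_neumann_algebra diagonal_ops.
Proof. by rewrite diagonal_block; exact: block_vn. Qed.

Definition wtrace (mu : 'I_n -> R) a : C := \sum_i (mu i)%:C * entry a i.

Variable mu : 'I_n -> R.
Hypotheses (mu_gt0 : forall i, 0 < mu i) (mu1 : \sum_i mu i = 1).

Let muC i : 0 < (mu i)%:C. Proof. by rewrite ltcR. Qed.

Lemma wtrace_diag d : wtrace mu (diag d) = \sum_i (mu i)%:C * d i.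
Proof. by apply: eq_bigr => i _; rewrite entry_diag. Qed.

Lemma entryD a b i : entry (a + b) i = entry a i + entry b i.
Proof. by rewrite /entry fctE coordinateD. Qed.
Lemma entryZ c a i : entry (c *: a) i = c * entry a i.
Proof. by rewrite /entry fctE coordinateZ. Qed.

Lemma wtrace_linear c a b : wtrace mu (c *: a + b) = c * wtrace mu a + wtrace mu b.
Proof.
rewrite /wtrace mulr_sumr -big_split; apply: eq_bigr => i _ /=.
by rewrite entryD entryZ mulrDr mulrCA.
Qed.

Lemma op_le_diag d f : op_le (diag d) (diag f) <-> forall i, d i <= f i.
Proof.
rewrite /op_le diagB diag_positive; split=> h i; have := h i;
  by rewrite subr_ge0.
Qed.

(** If no member of S came within e of the supremum at coordinate i, lowering that coordinate by e
    would give a smaller upper bound. Directedness then serves the finitely many coordinates at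
    once. *)
Lemma directed_sup_approx (S : set (H -> H)) a (e : R) : directed_sup diagonal_ops S a ->
  0 < e -> exists2 s, S s & forall i, entry a i - e%:C <= entry s i.
Proof.
move=> [S0 Sp Sd [Da aub] al] e0.
have one i : exists2 s, S s & entry a i - e%:C <= entry s i.
  apply: contrapT => no.
  pose b := diag (fun j => entry a j - (j == i)%:R * e%:C).
  have : op_le a b.
    apply: al => [|s Ss]; first exact: diagonal_diag.
    have [Ds ps] := Sp s Ss; have := aub s Ss.
    rewrite (diagonalP Ds) (diagonalP Da) => /op_le_diag sa.
    apply/op_le_diag => j; case: eqVneq => [->|_]; last by rewrite mul0r subr0.
    rewrite mul1r; have := sa i; have : ~ entry a i - e%:C <= entry s i.
      by move=> h; apply: no; exists s.
    (* The order of [R[i]] is partial: the negated comparison can be reversed only after the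
       imaginary parts are known to agree. *)
    rewrite !lecE raddfB /= => h1 /andP[/eqP h2 h3].
    rewrite raddfB /= subr0 h2 eqxx /=.
    by move: h1; rewrite !raddfB /= subr0 h2 eqxx /= => /negP; rewrite -ltNge => /ltW.
  rewrite (diagonalP Da) => /op_le_diag /(_ i).
  by rewrite eqxx mul1r lerDl oppr_ge0 lt_geF // ltcR.
have all (l : seq 'I_n) : exists2 s, S s & forall i, i \in l -> entry a i - e%:C <= entry s i.
  elim: l => [|i l [s Ss sl]]; first by have [s Ss] := S0; exists s.
  have [t St ti] := one i; have [u [Su su tu]] := Sd s t Ss St.
  have [Ds _] := Sp s Ss; have [Dt _] := Sp t St; have [Du _] := Sp u Su.
  move: su tu; rewrite (diagonalP Ds) (diagonalP Dt) (diagonalP Du).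
  move=> /op_le_diag su /op_le_diag tu; exists u => // j.
  rewrite in_cons => /orP[/eqP ->|jl]; first exact: le_trans (tu i).
  exact: le_trans (sl j jl) (su j).
have [s Ss hs] := all (index_enum 'I_n); exists s => // i.
exact/hs/mem_index_enum.
Qed.

Lemma wtrace_state : normal_faithful_tracial_state diagonal_ops (wtrace mu).
Proof.
split.
- by move=> c a b _ _; exact: wtrace_linear.
- move=> _ [d ->] /diag_positive d0; rewrite wtrace_diag sumr_ge0 // => i _.
  by rewrite mulr_ge0 // ltW.
- rewrite diag1 wtrace_diag -[RHS](rmorph1 (real_complex R)) -mu1 rmorph_sum.
  by apply: eq_bigr => i _; rewrite mulr1.
- by move=> _ _ [d ->] [f ->]; rewrite !diagM; congr wtrace; apply: diag_ext => i; rewrite mulrC.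
- move=> _ [d ->]; rewrite adj_diag diagM wtrace_diag => /eqP.
  rewrite psumr_eq0 => [/allP h|i _]; last first.
    by apply: mulr_ge0; [exact: ltW|rewrite mulrC mul_conjC_ge0].
  rewrite diag0; apply: diag_ext => i; have := h i (mem_index_enum i).
  by rewrite mulf_eq0 gt_eqF //= mulrC mul_conjC_eq0 => /eqP.
- move=> S a dS; have [S0 Sp Sd [Da aub] al] := dS.
  have ub : ubound [set complex.Re (wtrace mu s) | s in S] (complex.Re (wtrace mu a)).
    move=> _ [s Ss <-]; have [Ds _] := Sp s Ss; have := aub s Ss.
    rewrite (diagonalP Ds) (diagonalP Da) => /op_le_diag sa.
    suff : wtrace mu (diag (entry s)) <= wtrace mu (diag (entry a)).
      by rewrite lecE => /andP[].
    by rewrite !wtrace_diag ler_sum // => i _; rewrite ler_pM2l.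
  have [s0 Ss0] := S0.
  apply/eqP; rewrite eq_le; apply/andP; split; last first.
    by apply: ge_sup => //; exists (complex.Re (wtrace mu s0)), s0.
  apply/ler_addgt0Pr => e e0.
  have [s Ss sa] := directed_sup_approx dS e0.
  have : complex.Re (wtrace mu s) <= sup [set complex.Re (wtrace mu s) | s in S].
    by apply: ub_le_sup; [exists (complex.Re (wtrace mu a))|exists s].
  have : wtrace mu a - e%:C <= wtrace mu s.
    have -> : e%:C = \sum_i (mu i)%:C * e%:C.
      by rewrite -mulr_suml -rmorph_sum /= mu1 mul1r.
    rewrite /wtrace -sumrB ler_sum // => i _.
    by rewrite -mulrBr ler_pM2l.
  by rewrite lecE !raddfB /= => /andP[_ h1 h2]; lra.
Qed.

Definition block_mean (T : pred 'I_n) d : C :=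
  (\sum_(j | T j) (mu j)%:C * d j) / \sum_(j | T j) (mu j)%:C.

Definition block_exp (T : pred 'I_n) a : H -> H :=
  diag (fun i => if T i then block_mean T (entry a) else entry a i).

Lemma block_mass_gt0 (T : pred 'I_n) i : T i -> 0 < \sum_(j | T j) (mu j)%:C.
Proof.
move=> Ti; rewrite (bigD1 i) //= ltr_wpDr ?ltcR // sumr_ge0 // => j _.
by rewrite ler0c ltW.
Qed.

Lemma block_condexp (T : pred 'I_n) :
  conditional_expectation diagonal_ops (block T) (wtrace mu) (block_exp T).
Proof.
have meanM (d f : 'I_n -> C) i : T i -> (forall i j, T i -> T j -> f i = f j) ->
    block_mean T (fun j => d j * f j) = block_mean T d * f i.
  move=> Ti fT; rewrite /block_mean [RHS]mulrAC; congr (_ / _); rewrite mulr_suml.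
  by apply: eq_bigr => j Tj; rewrite (fT j i) // mulrA.
have mean1 i : T i -> block_mean T (fun=> 1) = 1.
  move=> Ti; rewrite /block_mean; under eq_bigr do rewrite mulr1.
  by rewrite divff // gt_eqF // (block_mass_gt0 Ti).
split.
- move=> a _; exists (fun i => if T i then block_mean T (entry a) else entry a i) => // i j.
  by move=> -> ->.
- move=> c a b _ _; rewrite /block_exp diagZ diagD; apply: diag_ext => i.
  case: ifP => _; last by rewrite entryD entryZ.
  rewrite /block_mean mulrA mulr_sumr -mulrDl -big_split; congr (_ / _).
  by apply: eq_bigr => j _ /=; rewrite entryD entryZ mulrDr mulrCA.
- move=> _ [d ->] /diag_positive d0; apply/diag_positive => i.
  case: ifP => _; last by rewrite entry_diag.
  by rewrite divr_ge0 // sumr_ge0 // => j _; rewrite ?entry_diag ?mulr_ge0 // ltW.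
- move=> a _; rewrite /block_exp wtrace_diag /wtrace (bigID T) [RHS](bigID T) /=.
  congr (_ + _); last by apply: eq_bigr => i /negPf ->.
  transitivity (\sum_(i | T i) (mu i)%:C * block_mean T (entry a)).
    by apply: eq_bigr => i ->.
  rewrite -mulr_suml /block_mean; have [i Ti|noT] := pickP T.
    by rewrite mulrCA divff ?mulr1 // gt_eqF // (block_mass_gt0 Ti).
  by rewrite !big_pred0 // mul0r.
- move=> _ [d -> dT]; apply: diag_ext => i; case: ifP => [Ti|_]; last by rewrite entry_diag.
  rewrite -[RHS]mul1r -[X in _ = X * _](mean1 i Ti) -(meanM (fun=> 1) d i) //.
  rewrite /block_mean; congr (_ / _); apply: eq_bigr => j _.
  by rewrite entry_diag mul1r.
- move=> a y Da [f -> fT]; rewrite (diagonalP Da) diagM /block_exp diagM.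
  apply: diag_ext => i; case: ifP => [Ti|_]; last by rewrite !entry_diag.
  rewrite -(meanM _ _ i) //; congr (_ / _); apply: eq_bigr => j _.
  by rewrite !entry_diag.
- move=> a y Da [f -> fT]; rewrite (diagonalP Da) diagM /block_exp diagM.
  apply: diag_ext => i; case: ifP => [Ti|_]; last by rewrite !entry_diag.
  rewrite mulrC -(meanM _ _ i) //; congr (_ / _); apply: eq_bigr => j _.
  by rewrite !entry_diag [f j * _]mulrC.
Qed.

Definition rdiag r := diag (fun i => (r i)%:C).

Lemma op_horner_rdiag q r : op_horner q (rdiag r) = rdiag (fun i => q.[r i]).
Proof.
elim/poly_ind: q => [|q c IH].
  by rewrite op_horner0 diag0; apply: diag_ext => i; rewrite horner0.
rewrite op_hornerD op_hornerMX op_hornerC IH diag1 diagZ diagM diagD.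
by apply: diag_ext => i; rewrite !hornerE rmorphD rmorphM.
Qed.

Lemma Lp_norm_rdiag p r : 0 < p <= 1 -> (forall i, 0 <= r i) ->
  Lp_norm (wtrace mu) p (rdiag r) = (\sum_i mu i * r i `^ p) `^ p^-1.
Proof.
move=> p01 r0; have pr : positive_op (rdiag r) by apply/diag_positive => i; rewrite ler0c.
rewrite Lp_norm_positive //; congr (_ `^ _).
have -> : fun_calc (fun t => t `^ p) (rdiag r) = rdiag (fun i => r i `^ p).
  apply: (@fun_calc_eq _ _ _ _ _ 1) => // [|e e0]; first exact: papprox_powR.
  (* An interval containing the norm and every entry, so that the norm of a diagonal operator need
     not be computed. *)
  pose L := Num.max (opnorm (rdiag r)) (\sum_i r i).
  have [q hq] := papprox_powR p01 L e0; exists q => [t /andP[t0 tL]|].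
    by rewrite hq // t0 le_max tL.
  rewrite mulr1 op_horner_rdiag diagB; apply: diag_opbound => [|i]; first exact: ltW.
  rewrite -rmorphB /= normc_def expr0n addr0 sqrtr_sqr lecR hq // r0 le_max.
  by apply/orP; right; rewrite (bigD1 i) //= lerDl sumr_ge0.
rewrite /real_trace wtrace_diag raddf_sum; apply: eq_bigr => i _.
by rewrite -rmorphM.
Qed.

End DiagonalOperators.

(** * Sharpness of the constant *)

Section Sharpness.
Variables (R : realType) (p b : R).
Hypotheses (p01 : 0 < p <= 1) (b1 : 1 < b).

Let p0 : 0 < p. Proof. by case/andP: p01. Qed.
Let b0 : 0 < b. Proof. exact: lt_trans ltr01 b1. Qed.
Let beta := b `^ p.
Let r := beta^-1.
(** 1 - r is the share of an atom in its tail, and b / (b - 1) bounds a geometric sum by its last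
    term; K is the factor in S <= K X. *)
Let K := (1 - r) * (b / (b - 1)).

Let beta1 : 1 < beta.
Proof.
rewrite /beta [ltLHS](_ : 1 = 1 `^ p); last by rewrite powR1.
by rewrite gt0_ltr_powR ?nnegrE ?ler01 ?(ltW b0).
Qed.
Let beta0 : 0 < beta. Proof. exact: lt_trans ltr01 beta1. Qed.
Let r0 : 0 < r. Proof. by rewrite invr_gt0. Qed.
Let r1 : r < 1. Proof. by rewrite invf_lt1. Qed.
Let b10 : 0 < b - 1. Proof. by rewrite subr_gt0. Qed.
Let K0 : 0 < K.
Proof. by rewrite mulr_gt0 ?divr_gt0 // subr_gt0. Qed.

(** K equals (beta - 1) / (b - 1) times b / beta; the first factor is at most p by Bernoulli, and
    beta > 1. *)
Let K_le : K <= p * b.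
Proof.
have beta_le : beta - 1 <= p * (b - 1).
  have [pE|pn1] := eqVneq p 1; first by rewrite /beta pE powRr1 ?(ltW b0) // mul1r.
  have p1 : p < 1 by case/andP: p01 => _; rewrite lt_def eq_sym pn1.
  by have := powR_bernoulli p0 p1 b0; rewrite -/beta; lra.
have -> : K = (beta - 1) * (b / (b - 1) / beta).
  by rewrite /K /r; field; rewrite !gt_eqF.
apply: (@le_trans _ _ (p * (b - 1) * (b / (b - 1) / beta))).
  by rewrite ler_pM2r // !divr_gt0.
have -> : p * (b - 1) * (b / (b - 1) / beta) = p * b / beta.
  by field; rewrite !gt_eqF.
by rewrite ler_pdivrMr // ler_peMr ?(ltW beta1) // mulr_ge0 ?ltW.
Qed.

Let geometric_le l j :
  \sum_(1 <= k < l.+1) (if (k <= j)%N then (1 - r) * b ^+ k else 0) <= K * b ^+ minn l j.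
Proof.
elim: l => [|l IH].
  by rewrite big_geq // mulr_ge0 ?exprn_ge0 // ltW.
rewrite big_nat_recr //=; have [lj|lj] := ltnP l j; last first.
  by rewrite addr0; move: IH; rewrite (minn_idPr lj) (minn_idPr (leqW lj)).
move: IH; rewrite (minn_idPl (ltnW lj)) (minn_idPl lj) => IH.
have -> : K * b ^+ l.+1 = K * b ^+ l + (1 - r) * b ^+ l.+1.
  by rewrite /K exprS; field; rewrite gt_eqF.
by rewrite lerD2r.
Qed.

Variable m : nat.
Local Notation I := ('I_m.+1).

(** Atoms are numbered from 0, so atom i belongs to step k = i + 1. The last atom m takes all the
    remaining mass r^m; it is charged by S but not by X. *)
Let mu (i : I) : R := if (i < m)%N then (1 - r) * r ^+ i else r ^+ m.
Let T (k : nat) : pred I := [pred i : I | (k <= i.+1)%N].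
Let x (k : nat) : ell2_hilbert R m.+1 -> ell2_hilbert R m.+1 :=
  rdiag (fun i : I => if i.+1 == k then b ^+ k else 0).
Let y (k : nat) (i : I) : R := if (k <= i.+1)%N then (1 - r) * b ^+ k else 0.

Let mu_gt0 i : 0 < mu i.
Proof. by rewrite /mu; case: ifP => _; rewrite ?mulr_gt0 ?exprn_gt0 ?subr_gt0. Qed.

Let tail_mass k : (k <= m)%N -> \sum_(i : I | (k <= i)%N) mu i = r ^+ k.
Proof.
move=> km; rewrite big_mkcond big_ord_recr /= km /mu ltnn.
rewrite -[RHS](subrK (r ^+ m)); congr (_ + _); rewrite -big_mkcond /=.
transitivity (\sum_(i < m | (k <= i)%N) (1 - r) * r ^+ i).
  by apply: eq_bigr => i _; rewrite ltn_ord.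
have -> : \sum_(i < m | (k <= i)%N) (1 - r) * r ^+ i = \sum_(k <= i < m) (1 - r) * r ^+ i.
  by rewrite big_geq_mkord.
rewrite -[RHS]opprB -(telescope_sumr (fun i => r ^+ i)) // -sumrN.
by apply: eq_bigr => i _; rewrite exprS; ring.
Qed.

Let mu1 : \sum_i mu i = 1.
Proof. by rewrite -(expr0 r) -(tail_mass (leq0n m)); apply: eq_bigl. Qed.

Let Ex k : (1 <= k <= m)%N -> block_exp mu (T k) (x k) = rdiag (y k).
Proof.
case: k => // k /= km; apply: diag_ext => i; rewrite /y /T /= ltnS.
case: ifP => ki; last first.
  rewrite entry_diag eqSS; case: eqVneq => // ik.
  by rewrite ik leqnn in ki.
rewrite /block_mean -!rmorph_sum /=.
have -> : \sum_(j : I | (k < j.+1)%N) mu j = r ^+ k by rewrite -tail_mass // ltnW.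
pose k' := Ordinal (leqW km).
rewrite (bigD1 k') /= ?leqnn // big1 ?addr0; last first.
  by move=> j /andP[_ jk]; rewrite entry_diag eqSS (negbTE jk : (j == k :> nat) = false) mulr0.
rewrite entry_diag eqxx /mu /= km -rmorphM /= -fmorphV -rmorphM /=; congr (_%:C).
by field; rewrite gt_eqF // exprn_gt0.
Qed.

Let X_sum : \sum_(1 <= k < m.+1) x k = rdiag (fun i : I => if (i < m)%N then b ^+ i.+1 else 0).
Proof.
rewrite /x diag_sum; apply: diag_ext => i; rewrite -rmorph_sum /=; congr (_%:C).
case: ifP => im; last first.
  rewrite big_nat big1 // => k /andP[k1 km]; case: eqP => // ik.
  by rewrite -ik ltnS im in km.
rewrite (bigD1_seq i.+1) /= ?iota_uniq //; last by rewrite mem_index_iota.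
by rewrite eqxx big1 ?addr0 // => k ik; rewrite eq_sym (negPf ik).
Qed.

Let Y_sum : \sum_(1 <= k < m.+1) block_exp mu (T k) (x k) =
  rdiag (fun i : I => \sum_(1 <= k < m.+1) y k i).
Proof.
rewrite big_nat (eq_bigr (fun k => rdiag (y k))) => [|k km]; last exact: Ex.
by rewrite -big_nat diag_sum; apply: diag_ext => i; rewrite rmorph_sum.
Qed.

(** The p-th moment of X: as r = 1 / beta, the mass and the p-th power balance and each of the m
    atoms contributes beta - 1. *)
Let G := m%:R * (beta - 1).

Let powX k : (b ^+ k) `^ p = beta ^+ k.
Proof.
elim: k => [|k IH]; first by rewrite !expr0 powR1.
by rewrite !exprS powRM ?exprn_ge0 ?(ltW b0) // IH.
Qed.

Let rbeta k : r ^+ k * beta ^+ k = 1.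
Proof. by rewrite -exprMn mulVf ?expr1n // gt_eqF. Qed.

Let X_moment :
  \sum_(i : I) mu i * (if (i < m)%N then b ^+ i.+1 else 0) `^ p = G.
Proof.
rewrite big_ord_recr /= ltnn powR0 ?gt_eqF // mulr0 addr0.
transitivity (\sum_(i < m) (beta - 1)); last by rewrite sumr_const card_ord /G mulr_natl.
apply: eq_bigr => i _; rewrite /mu /= ltn_ord powX exprS mulrACA mulrA.
rewrite -[_ * r ^+ i * _]mulrA rbeta mulr1 mulrBl mul1r.
by rewrite /r mulVf // gt_eqF.
Qed.

(** The added 1 is the last atom, where r^m beta^m = 1 for every m. *)
Let Y_moment :
  \sum_(i : I) mu i * (\sum_(1 <= k < m.+1) y k i) `^ p <= K `^ p * (G + 1).
Proof.
have term i : (\sum_(1 <= k < m.+1) y k i) `^ p <= K `^ p * beta ^+ minn m i.+1.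
  rewrite -powX -powRM ?exprn_ge0 ?(ltW K0) ?(ltW b0) //.
  rewrite ge0_ler_powR ?nnegrE ?(ltW p0) ?geometric_le // /y.
    apply: sumr_ge0 => k _; case: ifP => // _.
    by rewrite mulr_ge0 ?exprn_ge0 ?(ltW b0) // subr_ge0 ltW.
  by rewrite mulr_ge0 ?exprn_ge0 // ltW.
apply: (@le_trans _ _ (\sum_(i : I) mu i * (K `^ p * beta ^+ minn m i.+1))).
  by apply: ler_sum => i _; rewrite ler_pM2l.
rewrite -X_moment big_ord_recr [X in _ * (X + 1)]big_ord_recr /= /mu /= ltnn.
rewrite powR0 ?gt_eqF // mulr0 addr0 mulrDr mulr1 (minn_idPl _) //.
apply: lerD; last by rewrite mulrCA rbeta mulr1.
rewrite mulr_sumr; apply: ler_sum => i _; rewrite ltn_ord powX.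
by rewrite (minn_idPr _) // mulrCA.
Qed.

Lemma sharpness_bound (C : R) : 0 < C -> dual_Doob_inequality p C ->
  m%:R * (b `^ p - 1) <= (C * (p * b)) `^ p * (m%:R * (b `^ p - 1) + 1).
Proof.
rewrite -/beta -/G => C0 ineq.
have G0 : 0 <= G by rewrite mulr_ge0 // subr_ge0 ltW.
have [m0|m0] := posnP m.
  by rewrite /G m0 mul0r add0r mulr1 powR_ge0.
have := ineq _ _ (wtrace mu) (fun k => block (T k)) (fun k => block_exp mu (T k))
  (diagonal_vn R m.+1) (wtrace_state mu_gt0 mu1).
have H1 k : (1 <= k)%N -> von_neumann_algebra (@block R m.+1 (T k)) /\
    @block R m.+1 (T k) `<=` @diagonal_ops R m.+1.
  by move=> _; split; [exact: block_vn|exact: block_diagonal].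
have H2 k : (1 <= k)%N -> @block R m.+1 (T k) `<=` @block R m.+1 (T k.+1).
  (* The tails shrink as k grows, so fewer entries are forced to be equal and the algebras
     increase. *)
  move=> _ _ [d -> dT]; exists d => // i j /ltnW Ti /ltnW Tj; exact: dT.
have H3 k : (1 <= k)%N -> conditional_expectation (@diagonal_ops R m.+1)
    (@block R m.+1 (T k)) (wtrace mu) (block_exp mu (T k)).
  by move=> _; exact: block_condexp.
have H4 k : (1 <= k <= m)%N -> @diagonal_ops R m.+1 (x k) /\ positive_op (x k).
  move=> _; split; first exact: diagonal_diag.
  by apply/diag_positive => i; rewrite ler0c; case: ifP => // _; rewrite exprn_ge0 // ltW.
move=> /(_ H1 H2 H3 m x m0 H4).
rewrite X_sum Y_sum !Lp_norm_rdiag //; last 2 first.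
- move=> i; apply: sumr_ge0 => k _; rewrite /y; case: ifP => // _.
  by rewrite mulr_ge0 ?exprn_ge0 ?(ltW b0) // subr_ge0 ltW.
- by move=> i; case: ifP => // _; rewrite exprn_ge0 // ltW.
rewrite X_moment => h.
have S0 : 0 <= \sum_(i : I) mu i * (\sum_(1 <= k < m.+1) y k i) `^ p.
  by apply: sumr_ge0 => i _; rewrite mulr_ge0 ?powR_ge0 // ltW.
have {}h : G <= C `^ p * \sum_(i : I) mu i * (\sum_(1 <= k < m.+1) y k i) `^ p.
  have back z : 0 <= z -> (z `^ p^-1) `^ p = z.
    by move=> z0; rewrite -powRrM mulVf ?gt_eqF // powRr1.
  rewrite -(back _ G0) -[X in _ * X](back _ S0) -powRM ?powR_ge0 ?(ltW C0) //.
  by rewrite ge0_ler_powR ?nnegrE ?mulr_ge0 ?powR_ge0 ?(ltW p0) ?(ltW C0).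
apply: (le_trans h); apply: (@le_trans _ _ (C `^ p * (K `^ p * (G + 1)))).
  by rewrite ler_pM2l ?powR_gt0 ?Y_moment.
rewrite mulrA -powRM ?(ltW C0) ?(ltW K0) // ler_pM2r ?ltr_wpDl //.
have pb0 : 0 < p * b by rewrite mulr_gt0.
apply: ge0_ler_powR; rewrite ?nnegrE ?(ltW p0) ?(ltW (mulr_gt0 C0 _)) //.
by rewrite ler_pM2l.
Qed.

End Sharpness.

Lemma dual_Doob_sharp (R : realType) (p C : R) : 0 < p <= 1 -> C < 1 / p ->
  ~ dual_Doob_inequality p C.
Proof.
move=> p01 Cp ineq; have /andP[p0 p1] := p01.
(* The given C may be nonpositive; the inequality persists with a larger constant, here positive and
   still below 1/p. *)
pose D := Num.max C (1 / (2 * p)).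
have D0 : 0 < D by rewrite lt_max divr_gt0 ?orbT // mulr_gt0.
have Dp : D * p < 1.
  rewrite -ltr_pdivlMr // gt_max Cp ltr_pM2l // ltf_pV2 ?posrE ?mulr_gt0 //; lra.
have {}ineq : dual_Doob_inequality p D.
  move=> H M tau N E vM tM vN NS cE n x n1 hx.
  apply: (le_trans (ineq H M tau N E vM tM vN NS cE n x n1 hx)).
  by rewrite ler_wpM2r ?powR_ge0 // le_max lexx.
have Dp0 : 0 < D * p by rewrite mulr_gt0.
(* The midpoint of 1 and 1 / (D p), so that b > 1 and D p b < 1. *)
pose b := (1 + (D * p)^-1) / 2.
have i1 : 1 < (D * p)^-1 by rewrite invf_gt1.
have b1 : 1 < b by rewrite /b; lra.
have b0 : 0 < b := lt_trans ltr01 b1.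
have bp1 : 0 < b `^ p - 1.
  rewrite subr_gt0 [ltLHS](_ : 1 = 1 `^ p); last by rewrite powR1.
  by rewrite gt0_ltr_powR ?nnegrE ?ler01 ?(ltW b0).
pose q := (D * (p * b)) `^ p.
have q1 : q < 1.
  rewrite /q [ltRHS](_ : 1 = 1 `^ p); last by rewrite powR1.
  have Dpb : D * (p * b) < 1.
    by rewrite mulrA mulrC -ltr_pdivlMr // mul1r /b; lra.
  by rewrite gt0_ltr_powR ?nnegrE // ltW // mulr_gt0 // mulr_gt0.
(* Beyond this threshold m (b^p - 1) (1 - q) exceeds q, contradicting the bound of
   [sharpness_bound]. *)
pose B := q / (1 - q) / (b `^ p - 1).
pose m := (Num.truncn B).+1.
have Bm : B < m%:R by rewrite truncnS_gt.
have := sharpness_bound p01 b1 m D0 ineq; rewrite -/q leNgt => /negP; apply.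
move: Bm; rewrite /B !ltr_pdivrMr ?subr_gt0 //; lra.
Qed.

Theorem theorem1 (R : realType) (p : R) (hp : 0 < p <= 1) :
  dual_Doob_inequality p (1 / p) /\
  (forall C : R, C < 1 / p -> ~ dual_Doob_inequality p C).
Proof.
by split=> [|C]; [exact: dual_Doob_bound|exact: dual_Doob_sharp].
Qed.
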